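(* Let $C\subset\mathbb{C}^2$ be the analytic curve defined by the graph of a meromorphic function $s:\mathbb{C}\to\mathbb{P}^1$ with at most one pole. Then: (A) If $s$ has no poles: - There exist infinitely many complete holomorphic vector fields on $\mathbb{C}^2$ tangent to $C$, without zeros on $C$, and such that all their trajectories are proper and of type $\mathbb{C}$. Moreover, for each $X$ of them, $C$ is a trajectory $C_z$ of $X$ and $X$ is analytically equivalent, by a fiber-preserving analytic automorphism of $\mathbb{C}^2$ that takes $C_z$ into a line, to a polynomial vector field. - For any $p\in C$, there exist infinitely many complete holomorphic vector fields on $\mathbb{C}^2$ tangent to $C$, with only one zero on $C$, which is $p$, and not equivalent by an analytic automorphism. If $X$ is one of them, $C\setminus\{p\}$ is a trajectory $C_z$ of $X$ of type $\mathbb{C}^*$. Moreover, $X$ can be chosen of type $\mathbb{C}$ and with almost all its trajectories non-proper, or of type $\mathbb{C}^*$. In particular, there are infinitely many of these vector fields not equivalent by an analytic automorphism. (B) If $s$ has one pole, of order $k$: there exist infinitely many complete holomorphic vector fields on $\mathbb{C}^2$ tangent to $C$, without zeros on $C$, and such that all their trajectories are proper and of type $\mathbb{C}^*$. Moreover, for each $X$ of them, $C$ is a trajectory $C_z$ of $X$ and $X$ is analytically equivalent, by a fiber-preserving analytic automorphism of $\mathbb{C}^2$ that takes $C$ into $\{wz^k-1=0\}$, to a polynomial vector field.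
   Context: The graph is $\{(z,s(z)): s(z)\neq\infty\}\subset\mathbb{C}^2$. A vector field is tangent to a curve $C$ if $X(q)\in T_qC$ at each smooth point $q$ of $C$ ($X(q)=0$ allowed). A holomorphic vector field is complete if its solutions are defined for all complex times. Trajectories are images of maximal non-constant solutions (zeros of $X$ are not counted as trajectories); $C_z$ denotes the trajectory through a point $z$. A trajectory is of type $\mathbb{C}$ (resp. $\mathbb{C}^*$) if it is isomorphic to $\mathbb{C}$ (resp. $\mathbb{C}^*$) as a Riemann surface, and proper if its topological closure in $\mathbb{C}^2$ is an analytic curve of pure dimension one. A complete $X$ on $\mathbb{C}^2$ is of type $\mathbb{C}$ (resp. $\mathbb{C}^*$) if all trajectories $C_z$ with $z$ outside some pluripolar set invariant by the flow of $X$ are of type $\mathbb{C}$ (resp. $\mathbb{C}^*$). ''Almost all trajectories'' means all trajectories $C_z$ with $z$ outside a pluripolar set invariant by the flow. An automorphism (biholomorphism) of $\mathbb{C}^2$ is fiber-preserving if it maps vertical lines $\{z=\text{const}\}$ to vertical lines. Two vector fields are (analytically) equivalent if one is the push-forward of the other under an analytic automorphism of $\mathbb{C}^2$. *)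

(* Defs.v *)
From HB Require Import structures.
From mathcomp Require Import all_boot all_order all_algebra.
From mathcomp Require Import complex.
From mathcomp Require Import all_classical all_reals all_analysis.

Set Implicit Arguments.
Unset Strict Implicit.
Unset Printing Implicit Defensive.

Import Order.TTheory GRing.Theory Num.Theory.
Import numFieldNormedType.Exports.

Local Open Scope classical_set_scope.
Local Open Scope ring_scope.

(* Packing R[i] as a numFieldType gives it the norm topology that
   MathComp-Analysis attaches to every such field. *)
Definition Cplx (R : realType) : numFieldType := R[i].

Notation Cplx2 R := (Cplx R * Cplx R)%type.

Section Functions.
Variable R : realType.
Local Notation C := (Cplx R).
Local Notation C2 := (Cplx2 R).

(* [differentiable] is Frechet differentiability over the base field, here
   the complex numbers. *)
Definition holomorphic (V W : normedModType C) (f : V -> W) : Prop :=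
  forall x, differentiable f x.

(* The Riemann sphere is the one-point compactification of C, with [None] as
   the point at infinity. *)
Local Notation P1 := (one_point_compactification C).

Definition regular_at (s : C -> P1) (a : C) : Prop :=
  exists g : C -> C, \forall z \near a, differentiable g z /\ s z = Some (g z).

Definition pole_of_order (s : C -> P1) (a : C) (k : nat) : Prop :=
  [/\ (0 < k)%N, s a = None &
   exists g : C -> C,
     [/\ g a != 0,
         \forall z \near a, differentiable g z &
         \forall z \near a^', s z = Some (g z / (z - a) ^+ k)]].

Definition meromorphic (s : C -> P1) : Prop :=
  forall a, regular_at s a \/ exists k, pole_of_order s a k.

Definition at_most_one_pole (s : C -> P1) : Prop :=
  forall a b, s a = None -> s b = None -> a = b.

Definition graph (s : C -> P1) : set C2 := [set q | s q.1 = Some q.2].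

End Functions.

Section Curves.
Variable R : realType.
Local Notation C := (Cplx R).
Local Notation C2 := (Cplx2 R).

(* The condition is imposed at every p, including p outside A, so A is
   automatically closed. *)
Definition analytic_set (A : set C2) : Prop :=
  forall p : C2, exists (n : nat) (F : 'I_n -> C2 -> C),
    \forall q \near p,
      (forall i, differentiable (F i) q) /\ (A q <-> forall i, F i q = 0).

(* Near its point q, A is the smooth curve {f = 0}, with df(q) <> 0. *)
Definition smooth_equation (A : set C2) (q : C2) (f : C2 -> C) : Prop :=
  [/\ A q,
      \forall y \near q, differentiable f y,
      exists v, 'd f q v != 0 &
      \forall y \near q, A y <-> f y = 0].

Definition smooth_point (A : set C2) (q : C2) : Prop :=
  exists f, smooth_equation A q f.

(* The dimension of A at a point is the upper limit of the dimensions of A at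
   nearby regular points.  Dimension being locally constant on the regular
   part, density of the one-dimensional regular points says that this limit
   is 1 everywhere. *)
Definition analytic_curve (A : set C2) : Prop :=
  analytic_set A /\ A `<=` closure (smooth_point A).

(* T_q A is the kernel of df(q), for f a smooth local equation of A at q. *)
Definition tangent_space (A : set C2) (q : C2) : set C2 :=
  [set v | exists2 f, smooth_equation A q f & 'd f q v = 0].

Definition complex_line (L : set C2) : Prop :=
  exists a b c : C, (a != 0) || (b != 0) /\
    L = [set q : C2 | a * q.1 + b * q.2 = c].

Definition vertical_line (z : C) : set C2 := [set q : C2 | q.1 = z].

End Curves.

Section Pluripolar.
Variable R : realType.
Local Notation C := (Cplx R).
Local Notation C2 := (Cplx2 R).

Definition unit_circle (t : R) : C := (cos t +i* sin t)%C.

(* Upper semicontinuous, values in [-oo, +oo[, and the sub-mean value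
   inequality on every circle of every complex line.  The function -oo is
   not excluded here. *)
Definition plurisubharmonic (u : C2 -> \bar R) : Prop :=
  [/\ forall a, (u a < +oo)%E,
      lower_semicontinuous (fun a => - u a)%E &
      forall a b : C2,
        (u a <= (2 * pi)^-1%:E *
          \int[lebesgue_measure]_(t in `[0%R, (2 * pi)%R])
             u (a + unit_circle t *: b)%R)%E].

Definition pluripolar (E : set C2) : Prop :=
  exists u : C2 -> \bar R,
    [/\ plurisubharmonic u,
        exists a, u a <> -oo%E &
        forall a, E a -> u a = -oo%E].

End Pluripolar.

Section VectorFields.
Variable R : realType.
Local Notation C := (Cplx R).
Local Notation C2 := (Cplx2 R).
Implicit Types (X Y : C2 -> C2) (A T E : set C2) (phi : C -> C2).

Definition tangent X A : Prop :=
  forall q, smooth_point A q -> tangent_space A q (X q).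

Definition entire_solution X phi : Prop :=
  forall t : C, is_derive t (1 : C) phi (X (phi t)).

Definition complete_field X : Prop :=
  forall p, exists2 phi, entire_solution X phi & phi 0 = p.

Definition complete_holomorphic X : Prop := holomorphic X /\ complete_field X.

(* For a complete X, the only fields to which this is applied, the maximal
   solutions are exactly the entire ones. *)
Definition trajectory X T : Prop :=
  exists phi, [/\ entire_solution X phi, exists t, phi t <> phi 0 &
                  T = range phi].

(* The Riemann surface structure of a trajectory T is the one for which the
   solutions parametrizing T are local biholomorphisms onto T; it need not be
   induced by an embedding in C^2.  Thus g is an isomorphism from T onto the
   open set M when it is a bijection which is locally biholomorphic when read
   through these solutions. *)
Definition trajectory_iso X T (M : set C) : Prop :=
  exists g : C2 -> C, set_bij T M g /\
    forall phi, entire_solution X phi -> range phi = T ->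
      forall t : C, derivable (g \o phi) t 1 /\ 'D_1 (g \o phi) t != 0.

Definition of_type_C X T : Prop := trajectory_iso X T setT.

Definition of_type_Cstar X T : Prop := trajectory_iso X T [set z | z != 0].

Definition proper_trajectory T : Prop := analytic_curve (closure T).

Definition flow_invariant X E : Prop :=
  forall phi, entire_solution X phi -> E (phi 0) -> forall t, E (phi t).

Definition almost_all_trajectories X (P : set C2 -> Prop) : Prop :=
  exists E, [/\ pluripolar E, flow_invariant X E &
    forall z T, ~ E z -> trajectory X T -> T z -> P T].

Definition field_of_type_C X : Prop :=
  almost_all_trajectories X (of_type_C X).

Definition field_of_type_Cstar X : Prop :=
  almost_all_trajectories X (of_type_Cstar X).

Definition polynomial_field X : Prop :=
  exists P Q : {poly {poly C}},
    forall q : C2, X q = (P.[q.2%:P].[q.1], Q.[q.2%:P].[q.1]).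

Definition automorphism (Phi : C2 -> C2) : Prop :=
  holomorphic Phi /\
  exists Psi : C2 -> C2,
    [/\ holomorphic Psi, cancel Phi Psi & cancel Psi Phi].

Definition fiber_preserving (Phi : C2 -> C2) : Prop :=
  forall z, exists z', Phi @` vertical_line z = vertical_line z'.

Definition push_forward (Phi : C2 -> C2) X Y : Prop :=
  forall q, Y (Phi q) = 'd Phi q (X q).

Definition equivalent X Y : Prop :=
  exists2 Phi, automorphism Phi & push_forward Phi X Y.

Definition infinitely_many (P : (C2 -> C2) -> Prop) : Prop :=
  infinite_set [set X | P X].

Definition infinitely_many_inequivalent (P : (C2 -> C2) -> Prop) : Prop :=
  exists F : set (C2 -> C2),
    [/\ infinite_set F, forall X, F X -> P X &
        forall X Y, F X -> F Y -> X <> Y -> ~ equivalent X Y].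

End VectorFields.

(* Main.v *)
(* A fiber-preserving automorphism (z, w) |-> (z - c, al(z) w + be(z)), with al
   entire and nowhere zero and be entire, takes the curve to a model: the line
   {w = 0} if s is entire (al = 1, be = - s), and {w z^k = 1} if s = f / (z - c)^k
   with f(c) <> 0, where al is built so that al f - 1 vanishes to order k at c.
   The fields are pulled back from linear models: the constant field (n, 0), the
   diagonal fields n (z, tau w) and n (z, w) vanishing at the origin only, and
   n (z, - k w), which preserves w z^k.  For irrational tau the closure of a leaf
   of n (z, tau w) off the axes is accumulated in both coordinate directions, so
   it is not a curve; the exceptional leaves lie in {z w = 0}, which is
   pluripolar because log |z w| is plurisubharmonic by Jensen's inequality.
   Members of the diagonal families are told apart by the periods of their
   solutions. *)

Require Import Defs.
From HB Require Import structures.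
From mathcomp Require Import all_boot all_order all_algebra.
From mathcomp Require Import complex ring lra.
From mathcomp Require Import all_classical all_reals all_analysis.
From mathcomp Require Import measurable_realfun.

Set Implicit Arguments.
Unset Strict Implicit.
Unset Printing Implicit Defensive.

Import Order.TTheory GRing.Theory Num.Theory.
Import numFieldNormedType.Exports.
Local Open Scope classical_set_scope.
Local Open Scope ring_scope.

(** * Complex numbers through the real modulus *)

Section ComplexModulus.
Variable R : realType.
Local Notation C := (Cplx R).
Implicit Types z w : C.

(** Regularity drives the analytic part. The pulled-back fields contain the derivatives of [al] and
    [be], so their holomorphy requires the derivative of an entire function to be entire, and the
    construction of [al] repeatedly divides an entire function by z - c at a zero. As holomorphic
    means differentiable everywhere, with no continuity of the derivative assumed, both facts start
    from Goursat's bisection argument. Path integrals occur only as increments of antiderivatives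
    along real lines, and Cauchy's estimate is needed only on unit circles, up to a harmless factor
    2. Pluripolarity asks for a Lebesgue integral inequality for log |f|, where f may vanish on the
    circle. It is proved first for the truncations log max(|f|, d), through a second-order
    inequality over four points that avoids branches of the logarithm; then d tends to 0.
    Multiplying a model field by the integer n keeps its trajectories as sets and divides its
    periods by n: this is how one model yields infinitely many fields. *)

Definition cre z : R := complex.Re z.
Definition cim z : R := complex.Im z.
Definition mkC (x y : R) : C := Complex x y.
(** The norm of [C] takes its values in [C] itself; with this real-valued modulus, estimates are
    inequalities in [R] that [lra] and [nra] can treat. *)
Definition cmod z : R := ComplexField.Normc.normc z.
Definition ofR (x : R) : C := real_complex R x.
Definition ci : C := Complex 0 1.

Lemma normC_cmod z : `|z| = ofR (cmod z).
Proof. by case: z. Qed.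

Lemma ofR_lt x y : (ofR x < ofR y) = (x < y). Proof. exact: ltcR. Qed.
Lemma ofR_le x y : (ofR x <= ofR y) = (x <= y). Proof. exact: lecR. Qed.
Lemma ofR_gt0 x : (0 < ofR x) = (0 < x). Proof. exact: ltcR. Qed.

Lemma ofRD x y : ofR (x + y) = ofR x + ofR y.
Proof. by rewrite /ofR rmorphD. Qed.
Lemma ofRM x y : ofR (x * y) = ofR x * ofR y.
Proof. by rewrite /ofR rmorphM. Qed.
Lemma ofRN x : ofR (- x) = - ofR x.
Proof. by rewrite /ofR rmorphN. Qed.
Lemma ofRB x y : ofR (x - y) = ofR x - ofR y.
Proof. by rewrite ofRD ofRN. Qed.
Lemma ofR_nat n : ofR n%:R = n%:R.
Proof. by rewrite /ofR rmorph_nat. Qed.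
Lemma ofR0 : ofR 0 = 0. Proof. by []. Qed.
Lemma ofR1 : ofR 1 = 1. Proof. by []. Qed.
Lemma ofR_inj : injective ofR. Proof. exact: complexI. Qed.

Lemma gt0_ofR (e : C) : 0 < e -> exists2 r : R, 0 < r & e = ofR r.
Proof.
case: e => a b; rewrite (@ltcE R (Complex 0 0) (Complex a b)) /= => /andP[/eqP-> a0].
by exists a.
Qed.

Lemma cmodM z w : cmod (z * w) = cmod z * cmod w.
Proof. exact: (@ComplexField.Normc.normcM R). Qed.
Lemma cmodD z w : cmod (z + w) <= cmod z + cmod w.
Proof. exact: (@le_normcD R). Qed.
Lemma cmodN z : cmod (- z) = cmod z.
Proof. by apply: ofR_inj; rewrite -!normC_cmod normrN. Qed.
Lemma cmod0 : cmod 0 = 0.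
Proof. by apply: ofR_inj; rewrite -!normC_cmod normr0. Qed.
Lemma cmod1 : cmod 1 = 1.
Proof. by apply: ofR_inj; rewrite -!normC_cmod normr1. Qed.
Lemma cmodB z w : cmod (z - w) <= cmod z + cmod w.
Proof. by rewrite -(cmodN w) cmodD. Qed.
Lemma cmodC z w : cmod (z - w) = cmod (w - z).
Proof. by rewrite -opprB cmodN. Qed.
Lemma cmod_ge0 z : 0 <= cmod z.
Proof. by rewrite -ofR_le -normC_cmod ofR0 normr_ge0. Qed.
Lemma cmod_eq0 z : (cmod z == 0) = (z == 0).
Proof. by rewrite -(inj_eq ofR_inj) -normC_cmod ofR0 normr_eq0. Qed.
Lemma cmod_gt0 z : (0 < cmod z) = (z != 0).
Proof. by rewrite lt0r cmod_ge0 andbT cmod_eq0. Qed.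
Lemma cmodV z : cmod z^-1 = (cmod z)^-1.
Proof. exact: (@ComplexField.Normc.normcV R). Qed.
Lemma cmodX z n : cmod (z ^+ n) = cmod z ^+ n.
Proof. by elim: n => [|n IH]; rewrite ?expr0 ?cmod1// !exprS cmodM IH. Qed.
Lemma cmodBD z w : cmod z - cmod w <= cmod (z - w).
Proof. by have := cmodD (z - w) w; rewrite subrK; lra. Qed.
Lemma cmod_ofR x : cmod (ofR x) = `|x|.
Proof. by rewrite /cmod /= expr0n /= addr0 sqrtr_sqr. Qed.
Lemma cmod_ci : cmod ci = 1.
Proof. by rewrite /cmod /= expr0n /= expr1n add0r sqrtr1. Qed.

Lemma cre_le z : `|cre z| <= cmod z.
Proof.
case: z => a b; rewrite /cmod /cre /= -sqrtr_sqr ler_sqrt; last first.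
  by rewrite addr_ge0// sqr_ge0.
by rewrite lerDl sqr_ge0.
Qed.
Lemma cim_le z : `|cim z| <= cmod z.
Proof.
case: z => a b; rewrite /cmod /cim /= -sqrtr_sqr ler_sqrt; last first.
  by rewrite addr_ge0// sqr_ge0.
by rewrite lerDr sqr_ge0.
Qed.

Lemma mkCE x y : mkC x y = ofR x + ci * ofR y.
Proof. by rewrite /mkC /ofR /ci [LHS]complexE. Qed.
Lemma creimE z : z = ofR (cre z) + ci * ofR (cim z).
Proof. by rewrite -mkCE; case: z. Qed.
Lemma cmod_le z : cmod z <= `|cre z| + `|cim z|.
Proof.
rewrite {1}(creimE z); apply: le_trans (cmodD _ _) _.
by rewrite cmodM !cmod_ofR cmod_ci mul1r.
Qed.
Lemma cmod_sqr z : cmod z ^+ 2 = cre z ^+ 2 + cim z ^+ 2.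
Proof. by case: z => a b; rewrite /cmod /= sqr_sqrtr// addr_ge0// sqr_ge0. Qed.
Lemma ci2 : ci * ci = -1.
Proof. by rewrite -expr2; exact: sqr_i. Qed.

Lemma creD z w : cre (z + w) = cre z + cre w. Proof. by case: z; case: w. Qed.
Lemma cimD z w : cim (z + w) = cim z + cim w. Proof. by case: z; case: w. Qed.
Lemma creN z : cre (- z) = - cre z. Proof. by case: z. Qed.
Lemma cimN z : cim (- z) = - cim z. Proof. by case: z. Qed.
Lemma creB z w : cre (z - w) = cre z - cre w. Proof. by rewrite creD creN. Qed.
Lemma cimB z w : cim (z - w) = cim z - cim w. Proof. by rewrite cimD cimN. Qed.
Lemma creM z w : cre (z * w) = cre z * cre w - cim z * cim w.
Proof. by case: z; case: w. Qed.
Lemma cimM z w : cim (z * w) = cre z * cim w + cim z * cre w.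
Proof. by case: z => a b; case: w => c d; rewrite /cim /cre /= [b * c]mulrC. Qed.

Lemma nbhsCP (a : C) (P : set C) :
  (\forall z \near a, P z) <->
  exists2 r : R, 0 < r & forall z, cmod (z - a) < r -> P z.
Proof.
split.
  move/nbhs_ballP => [e /= e0 H]; have [r r0 re] := gt0_ofR e0.
  exists r => // z zr; apply: H; rewrite /ball /= re normC_cmod ofR_lt.
  by rewrite cmodC.
move=> [r r0 H]; apply/nbhs_ballP; exists (ofR r); first by rewrite /= ofR_gt0.
by move=> z; rewrite /ball /= normC_cmod ofR_lt cmodC => /H.
Qed.

Lemma nbhsC2P (q : C * C) (P : set (C * C)) :
  (\forall y \near q, P y) <->
  exists2 r : R, 0 < r &
    forall y, cmod (y.1 - q.1) < r -> cmod (y.2 - q.2) < r -> P y.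
Proof.
split.
  move/nbhs_ballP => [e /= e0 H]; have [r r0 re] := gt0_ofR e0.
  exists r => // y yr1 yr2; apply: H.
  by split; rewrite /ball /= re normC_cmod ofR_lt cmodC.
move=> [r r0 H]; apply/nbhs_ballP; exists (ofR r); first by rewrite /= ofR_gt0.
move=> y []; rewrite /ball /= !normC_cmod !ofR_lt => h1 h2.
by apply: H; rewrite cmodC.
Qed.

Lemma cvgCP (T : Type) (F : set_system T) (FF : Filter F) (f : T -> C) (l : C) :
  f @ F --> l <-> forall e : R, 0 < e -> \forall x \near F, cmod (f x - l) < e.
Proof.
split.
  move/cvgrPdist_lt => H e e0; have := H (ofR e); rewrite ofR_gt0 => /(_ e0).
  by apply: filterS => x; rewrite normC_cmod ofR_lt cmodC.
move=> H; apply/cvgrPdist_lt => _ /gt0_ofR[r r0 ->]; apply: filterS (H r r0) => x.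
by rewrite normC_cmod ofR_lt cmodC.
Qed.

(** The first-order expansion, with h = 0 allowed and no division; most derivatives below are
    established or exploited in this form. *)
Lemma is_deriveCP (f : C -> C) (z d : C) :
  is_derive z (1 : C) f d <->
  forall e : R, 0 < e -> exists2 r : R, 0 < r &
    forall h, cmod h < r -> cmod (f (z + h) - f z - d * h) <= e * cmod h.
Proof.
split.
  move=> [df dE] e e0.
  have : h^-1 *: (f (h *: 1 + z) - f z) @[h --> 0^'] --> d.
    by rewrite -dE; move: df; rewrite /derivable /derive; exact.
  move=> /cvgCP HH; have {HH} := HH e e0.
  move/nbhsCP => [r r0 H]; exists r => // h hr.
  have [->|h0] := eqVneq h 0.
    by rewrite addr0 mulr0 subr0 subrr cmod0 mulr0.
  have := H h; rewrite subr0 => /(_ hr h0).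
  rewrite scaler1 [h + z]addrC => {}H.
  have -> : f (z + h) - f z - d * h = h * (h^-1 *: (f (z + h) - f z) - d).
    by rewrite mulrBr -[_ *: _]/(_ * _) mulrA mulfV// mul1r [d * h]mulrC.
  rewrite cmodM mulrC ler_wpM2r ?cmod_ge0//; exact: ltW.
move=> H.
have L : h^-1 *: (f (h *: 1 + z) - f z) @[h --> 0^'] --> d.
  apply/cvgCP => e e0; have e20 : 0 < e / 2 by rewrite divr_gt0.
  have [r r0 {}H] := H _ e20.
  apply/nbhsCP; exists r => // h; rewrite subr0 => hr h0.
  rewrite scaler1 [h + z]addrC.
  have -> : h^-1 *: (f (z + h) - f z) - d = h^-1 * (f (z + h) - f z - d * h).
    rewrite mulrBr; congr (_ - _); by rewrite mulrCA mulVf// mulr1.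
  rewrite cmodM cmodV mulrC ltr_pdivrMr ?cmod_gt0//.
  apply: le_lt_trans (H h hr) _; rewrite ltr_pM2r ?cmod_gt0//; lra.
split; first by apply/cvg_ex; exists d.
exact: cvg_lim L.
Qed.
End ComplexModulus.

(** * Mean value inequality and antiderivatives on the real line *)

Section RealVariable.
Variable R : realType.
Local Notation C := (Cplx R).

(** Ends in either order, so that estimates along a segment need no orientation. *)
Definition btw (a b t : R) := (a <= t <= b) || (b <= t <= a).

Lemma btw_dist a b t : btw a b t -> `|t - a| <= `|b - a|.
Proof.
move=> /orP[] /andP[h1 h2].
  by rewrite !ger0_norm ?subr_ge0// ?lerD2r// (le_trans h1).
by rewrite distrC [leRHS]distrC !ger0_norm ?subr_ge0// ?lerB// (le_trans h1).
Qed.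

Lemma mvi_real (g g' : R -> R) (a b K : R) :
  (forall t, btw a b t -> is_derive t (1 : R) g (g' t)) ->
  (forall t, btw a b t -> `|g' t| <= K) ->
  `|g b - g a| <= K * `|b - a|.
Proof.
have main (c d : R) : c <= d ->
    (forall t, t \in `[c, d] -> is_derive t (1 : R) g (g' t)) ->
    (forall t, t \in `[c, d] -> `|g' t| <= K) ->
    `|g d - g c| <= K * (d - c).
  move=> cd dg g'K.
  have H1 (x : R) : x \in `]c, d[%R -> is_derive x (1 : R) g (g' x).
    by rewrite in_itv /= => /andP[cx xd]; apply: dg; rewrite in_itv /= !ltW.
  have H2 : {within `[c, d], continuous g}.
    by apply: derivable_within_continuous => x xcd; have [] := dg _ xcd.
  have [t tcd ->] := MVT_segment cd H1 H2.
  by rewrite normrM [`|d - c|]ger0_norm ?subr_ge0// ler_wpM2r ?subr_ge0// g'K.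
move=> dg g'K; have [ab|/ltW ba] := leP a b.
  rewrite [X in K * X]ger0_norm ?subr_ge0//.
  by apply: main => // t; rewrite in_itv /= => tab;
     [apply: dg | apply: g'K]; rewrite /btw tab.
rewrite distrC [X in K * X]distrC [X in K * X]ger0_norm ?subr_ge0//.
by apply: main => // t; rewrite in_itv /= => tab;
     [apply: dg | apply: g'K]; rewrite /btw tab orbT.
Qed.

(** The fundamental theorem differentiates an integral with fixed left end only to the right of that
    end. Normalized to vanish at 0, the integrals from different negative ends agree, so a left end
    moving with x glues them into one antiderivative on the whole line. *)
Lemma continuous_antiderivative (u : R -> R) : continuous u ->
  exists F : R -> R, forall x, is_derive x (1 : R) F (u x).
Proof.
move=> cu.
pose G (a x : R) := Rintegral (@lebesgue_measure R) `[a, x] u.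
have dG (a x : R) : a < x -> is_derive x (1 : R) (G a) (u x).
  move=> ax.
  have [] := @continuous_FTC1_closed R u a x (x + 1) _ _ ax (cu x).
  - by rewrite ltrDl.
  - apply: continuous_compact_integrable; first exact: segment_compact.
    exact: continuous_subspaceT.
  by rewrite derive1E => ? ?; split.
pose F a x := G a x - G a 0.
have dF (a x : R) : a < x -> is_derive x (1 : R) (F a) (u x).
  move=> ax; rewrite -[u x]subr0; have := dG _ _ ax => ?.
  by rewrite /F; apply: is_deriveB.
have FF (a b x : R) : a < 0 -> a < x -> b < 0 -> b < x -> F a x = F b x.
  move=> a0 ax b0 bx; apply/eqP; rewrite -subr_eq0 -normr_le0.
  have F0 c : F c 0 = 0 by rewrite /F subrr.
  have := @mvi_real (F a - F b) (fun=> 0) 0 x 0.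
  rewrite mul0r !fctE !F0 !subr0; apply => [t xt|t _]; last by rewrite normr0.
  have [at_ bt] : a < t /\ b < t.
    by split; case/orP: xt => /andP[? ?]; lra.
  by rewrite -(subrr (u t)); apply: is_deriveB; apply: dF.
exists (fun x => F (- `|x| - 1) x) => x.
(* The fixed left end -|x| - 2 lies below every y within distance 1 of x, so near x the glued
   function coincides with a single [F a]. *)
have xx : - `|x| - 2 < x by have := ler_norm (- x); rewrite normrN; lra.
apply: near_eq_is_derive (dF _ _ xx).
near=> y; have yx : `|x - y| < 1.
  by near: y; apply: cvgr_dist_lt => //; exact: cvg_id.
have := ler_norm (- y); have := ler_norm (- x); rewrite !normrN.
have := normr_ge0 x; have := normr_ge0 y.
have := ler_distD 0 x y; rewrite !subr0 !sub0r !normrN => h0 h1 h2 h3 h4.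
have h5 : `|y| <= `|x| + 1.
  by rewrite -lerBlDl (le_trans (ler_norm _))// (le_trans (ler_dist_dist _ _))// distrC ltW.
apply: FF; lra.
Unshelve. all: by end_near.
Qed.

End RealVariable.

(** * Complex-valued functions of a real variable *)

Section RealToComplex.
Variable R : realType.
Local Notation C := (Cplx R).

Lemma is_deriveRP (f : R -> R) (x d : R) :
  (forall e : R, 0 < e -> exists2 r : R, 0 < r &
    forall h, `|h| < r -> `|f (x + h) - f x - d * h| <= e * `|h|) ->
  is_derive x (1 : R) f d.
Proof.
move=> H.
have L : h^-1 *: (f (h *: 1 + x) - f x) @[h --> 0^'] --> d.
  apply/cvgrPdist_lt => e e0; have e20 : 0 < e / 2 by rewrite divr_gt0.
  have [r r0 {}H] := H _ e20.
  rewrite near_withinE; near=> h => h0.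
  have hr : `|h| < r by near: h; apply: cvgr0_norm_lt => //; exact: cvg_id.
  rewrite scaler1 [h + x]addrC distrC.
  have -> : h^-1 *: (f (x + h) - f x) - d = h^-1 * (f (x + h) - f x - d * h).
    by rewrite mulrBr; congr (_ - _); rewrite mulrCA mulVf// mulr1.
  rewrite normrM normfV mulrC ltr_pdivrMr ?normr_gt0//.
  by apply: le_lt_trans (H h hr) _; rewrite ltr_pM2r ?normr_gt0//; lra.
split; first by apply/cvg_ex; exists d.
exact: cvg_lim L.
Unshelve. all: by end_near.
Qed.

(** Derivative in a real parameter, taken componentwise, because [is_derive] on [C] is the complex
    notion. *)
Definition rder (g : R -> C) (x : R) (d : C) :=
  is_derive x (1 : R) (fun t => cre (g t)) (cre d) /\
  is_derive x (1 : R) (fun t => cim (g t)) (cim d).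

Lemma rderB f g x df dg : rder f x df -> rder g x dg ->
  rder (fun t => f t - g t) x (df - dg).
Proof.
move=> [? ?] [? ?]; split.
  rewrite (_ : (fun t => _) = (fun t => cre (f t)) - (fun t => cre (g t))); last first.
    by apply/funext => t; rewrite creB.
  by rewrite creB; exact: is_deriveB.
rewrite (_ : (fun t => _) = (fun t => cim (f t)) - (fun t => cim (g t))); last first.
  by apply/funext => t; rewrite cimB.
by rewrite cimB; exact: is_deriveB.
Qed.

Lemma rder_line (f : C -> C) (z v d : C) (x : R) :
  is_derive (z + ofR x * v) (1 : C) f d ->
  rder (fun t => f (z + ofR t * v)) x (d * v).
Proof.
move/is_deriveCP => H.
have {}H (e : R) : 0 < e -> exists2 r : R, 0 < r & forall h : R, `|h| < r ->
    cmod (f (z + ofR (x + h) * v) - f (z + ofR x * v) - d * v * ofR h) <= e * `|h|.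
  move=> e0; have m0 : 0 < cmod v + 1 by have := cmod_ge0 v; lra.
  have [r r0 {}H] := H (e / (cmod v + 1)) (divr_gt0 e0 m0).
  exists (r / (cmod v + 1)); first exact: divr_gt0.
  move=> h; rewrite ltr_pdivlMr// => hr.
  have cv : cmod (ofR h * v) <= `|h| * (cmod v + 1).
    by rewrite cmodM cmod_ofR ler_wpM2l// lerDl.
  have := H (ofR h * v) (le_lt_trans cv hr).
  have -> : z + ofR (x + h) * v = z + ofR x * v + ofR h * v by rewrite ofRD; ring.
  have -> : d * v * ofR h = d * (ofR h * v) by ring.
  move=> /le_trans; apply.
  by rewrite mulrAC ler_pdivrMr// -mulrA ler_pM2l.
split; apply: is_deriveRP => e e0; have [r r0 {}H] := H e e0; exists r => // h hr.
  apply: le_trans (H h hr); apply: le_trans (cre_le _).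
  by rewrite !creB [cre (_ * ofR h)]creM [cim (ofR h)]/= mulr0 subr0.
apply: le_trans (H h hr); apply: le_trans (cim_le _).
by rewrite !cimB [cim (_ * ofR h)]cimM [cim (ofR h)]/= mulr0 add0r.
Qed.

(** The mean value theorem has no exact complex-valued form; applying it to real and imaginary parts
    separately costs the factor 2. *)
Lemma rder_mvi (g g' : R -> C) (a b K : R) :
  (forall t, btw a b t -> rder g t (g' t)) ->
  (forall t, btw a b t -> cmod (g' t) <= K) ->
  cmod (g b - g a) <= 2 * K * `|b - a|.
Proof.
move=> dg g'K; apply: le_trans (cmod_le _) _; rewrite creB cimB.
have h1 := @mvi_real R (fun t => cre (g t)) (fun t => cre (g' t)) a b K.
have h2 := @mvi_real R (fun t => cim (g t)) (fun t => cim (g' t)) a b K.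
rewrite mulrAC mulrDl mul1r mulrDl; apply: lerD; rewrite [_ * K]mulrC.
  apply: h1 => t tab; first by have [] := dg t tab.
  exact: le_trans (cre_le _) (g'K _ tab).
apply: h2 => t tab; first by have [] := dg t tab.
exact: le_trans (cim_le _) (g'K _ tab).
Qed.

Lemma rder_continuous (g g' : R -> C) : (forall x, rder g x (g' x)) ->
  continuous (fun t => cre (g t)) /\ continuous (fun t => cim (g t)).
Proof.
move=> H; split => x; apply/differentiable_continuous/derivable1_diffP;
by have [[? _] [? _]] := H x.
Qed.

Lemma rder_antiderivative (g : R -> C) :
  continuous (fun t => cre (g t)) -> continuous (fun t => cim (g t)) ->
  exists A : R -> C, forall x, rder A x (g x).
Proof.
move=> /continuous_antiderivative[F dF] /continuous_antiderivative[G dG].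
by exists (fun x => mkC (F x) (G x)) => x; split; [exact: dF|exact: dG].
Qed.

End RealToComplex.

(** * Goursat's theorem *)

Section Goursat.
Variable R : realType.
Local Notation C := (Cplx R).

Definition entire (f : C -> C) := forall z, derivable f z (1 : C).

Lemma entireP (f : C -> C) z : entire f -> is_derive z (1 : C) f ('D_1 f z).
Proof. by move=> ef; split. Qed.

Lemma is_derive_entire (f f' : C -> C) :
  (forall z, is_derive z (1 : C) f (f' z)) -> entire f.
Proof. by move=> H z; have [] := H z. Qed.

(* When A y and B x are antiderivatives of f along the horizontal and vertical
   lines, this is the integral of f along the boundary of a rectangle. *)
Definition contour (A B : R -> R -> C) (x0 x1 y0 y1 : R) : C :=
  (A y0 x1 - A y0 x0) + (B x1 y1 - B x1 y0)
  - (A y1 x1 - A y1 x0) - (B x0 y1 - B x0 y0).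

Lemma contour_split A B x0 x1 x2 y0 y1 y2 :
  contour A B x0 x2 y0 y2 =
  contour A B x0 x1 y0 y1 + contour A B x1 x2 y0 y1 +
  (contour A B x0 x1 y1 y2 + contour A B x1 x2 y1 y2).
Proof. rewrite /contour; ring. Qed.

Lemma nested_itv (u : nat -> R) (a : R) : 0 <= a ->
  (forall n, u n <= u n.+1 <= u n + a / 2 ^+ n.+1) ->
  exists X, forall n, u n <= X <= u n + a / 2 ^+ n.
Proof.
move=> a0 H.
have pow2 n : a / 2 ^+ n = a / 2 ^+ n.+1 + a / 2 ^+ n.+1.
  by rewrite exprS invfM; set t := (2 ^+ n)^-1; lra.
have inc n m : u n <= u (n + m)%N.
  elim: m => [|m IH]; first by rewrite addn0.
  by rewrite addnS (le_trans IH)//; case/andP: (H (n + m)%N).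
have dec n m : u (n + m)%N + a / 2 ^+ (n + m) <= u n + a / 2 ^+ n.
  elim: m => [|m IH]; first by rewrite addn0.
  apply: le_trans IH; rewrite addnS; have /andP[_] := H (n + m)%N.
  by have := pow2 (n + m)%N; lra.
have ub n m : u m <= u n + a / 2 ^+ n.
  have pos k : 0 <= a / 2 ^+ k by rewrite divr_ge0// exprn_ge0.
  have [nm|/ltnW mn] := leqP n m.
    by have := dec n (m - n)%N; have := pos m; rewrite subnKC//; lra.
  by have := inc m (n - m)%N; have := pos n; rewrite subnKC//; lra.
exists (sup (range u)) => n; apply/andP; split.
  by apply: ub_le_sup; [exists (u 0%N + a / 2 ^+ 0) => _ [m _ <-]|exists n].
by apply: ge_sup; [exists (u 0%N), 0%N|move=> _ [m _ <-]].
Qed.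

Lemma exists_pow2 (L d : R) : 0 < d -> exists n, L / 2 ^+ n < d.
Proof.
move=> d0; exists (Num.bound `|L / d|).
rewrite ltr_pdivrMr ?exprn_gt0// mulrC -ltr_pdivrMr//.
apply: le_lt_trans (ler_norm _) _; apply: lt_trans (archi_boundP (normr_ge0 _)) _.
by rewrite -natrX ltr_nat ltn_expl.
Qed.

Variables (f : C -> C) (A B : R -> R -> C).
Hypothesis ef : entire f.
Hypothesis dA : forall x y, rder (A y) x (f (mkC x y)).
Hypothesis dB : forall x y, rder (B x) y (f (mkC x y) * ci R).

Let W := contour A B.

Lemma mkC_line_x x y : mkC x y = ci R * ofR y + ofR x * 1.
Proof. by rewrite mkCE mulr1 addrC. Qed.
Lemma mkC_line_y x y : mkC x y = ofR x + ofR y * ci R.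
Proof. by rewrite mkCE [_ * ci R]mulrC. Qed.

(** The first-order expansion of f at the point has the polynomial antiderivative [Q], whose
    increments cancel around the rectangle. Only the error of the expansion remains: it is at most 2
    e s on the rectangle, so each of the four sides contributes at most 4 e s^2. *)
Lemma contour_local (X Y e : R) : 0 < e -> exists2 d, 0 < d &
  forall x0 x1 y0 y1 s, x0 <= X <= x1 -> y0 <= Y <= y1 ->
  x1 - x0 <= s -> y1 - y0 <= s -> s < d -> cmod (W x0 x1 y0 y1) <= 16 * e * s ^+ 2.
Proof.
move=> e0; pose z := mkC X Y; pose D := 'D_1 f z.
have /is_deriveCP/(_ e e0)[r r0 H] := entireP z ef.
exists (r / 2); first by rewrite divr_gt0.
move=> x0 x1 y0 y1 s /andP[x0X Xx1] /andP[y0Y Yy1] xs ys sr.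
pose Q (w : C) := f z * w + D / 2 * (w - z) ^+ 2.
have dQ w : is_derive w (1 : C) Q (f z + D * (w - z)).
  apply/is_deriveCP => e' e'0; have m0 : 0 < cmod (D / 2) + 1.
    by have := cmod_ge0 (D / 2); lra.
  exists (e' / (cmod (D / 2) + 1)); first exact: divr_gt0.
  move=> h; rewrite ltr_pdivlMr// => hr.
  rewrite (_ : _ - _ - _ = D / 2 * h * h); last by rewrite /Q; field.
  rewrite cmodM ler_wpM2r ?cmod_ge0// cmodM.
  by have := cmod_ge0 h; nra.
have near_bound x y : x0 <= x <= x1 -> y0 <= y <= y1 ->
    cmod (f (mkC x y) - (f z + D * (mkC x y - z))) <= e * (2 * s).
  move=> /andP[? ?] /andP[? ?].
  have cz : cmod (mkC x y - z) <= 2 * s.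
    apply: le_trans (cmod_le _) _; rewrite creB cimB /=.
    have : `|x - X| <= s by rewrite ler_norml; lra.
    have : `|y - Y| <= s by rewrite ler_norml; lra.
    by rewrite /mkC /=; lra.
  have := H (mkC x y - z); rewrite subrKC => /(_ _).
  rewrite opprD addrA => h.
  apply: le_trans (h _) _; last by rewrite ler_pM2l.
  by apply: le_lt_trans cz _; lra.
have s0 : 0 <= s by lra.
have side_x y : y0 <= y <= y1 ->
    cmod ((A y x1 - A y x0) - (Q (mkC x1 y) - Q (mkC x0 y))) <= 4 * e * s ^+ 2.
  move=> yy.
  have /= := @rder_mvi R (fun t => A y t - Q (mkC t y))
    (fun t => f (mkC t y) - (f z + D * (mkC t y - z))) x0 x1 (e * (2 * s)).
  move=> h; have {}h : cmod (A y x1 - Q (mkC x1 y) - (A y x0 - Q (mkC x0 y))) <=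
      2 * (e * (2 * s)) * `|x1 - x0|.
    apply: h => t tx; last by apply: near_bound => //; case/orP: tx => /andP[? ?]; lra.
    apply: rderB => //.
    rewrite (_ : (fun t => Q _) = (fun t => Q (ci R * ofR y + ofR t * 1))); last first.
      by apply/funext => u; rewrite mkC_line_x.
    rewrite -[X in rder _ _ X]mulr1; apply: rder_line; rewrite -mkC_line_x; exact: dQ.
  rewrite (_ : A y x1 - A y x0 - _ = A y x1 - Q (mkC x1 y) - (A y x0 - Q (mkC x0 y))); last by ring.
  apply: le_trans h _; rewrite ger0_norm; last lra.
  rewrite (_ : 4 * e * s ^+ 2 = 2 * (e * (2 * s)) * s); last by ring.
  by rewrite ler_wpM2l// !mulr_ge0// ltW.
have side_y x : x0 <= x <= x1 ->
    cmod ((B x y1 - B x y0) - (Q (mkC x y1) - Q (mkC x y0))) <= 4 * e * s ^+ 2.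
  move=> xx.
  have /= := @rder_mvi R (fun t => B x t - Q (mkC x t))
    (fun t => f (mkC x t) * ci R - (f z + D * (mkC x t - z)) * ci R) y0 y1 (e * (2 * s)).
  move=> h; have {}h : cmod (B x y1 - Q (mkC x y1) - (B x y0 - Q (mkC x y0))) <=
      2 * (e * (2 * s)) * `|y1 - y0|.
    apply: h => t tx; last first.
      by rewrite -mulrBl cmodM cmod_ci mulr1; apply: near_bound => //; case/orP: tx => /andP[? ?]; lra.
    apply: rderB => //.
    rewrite (_ : (fun t => Q _) = (fun t => Q (ofR x + ofR t * ci R))); last first.
      by apply/funext => u; rewrite mkC_line_y.
    by apply: rder_line; rewrite -mkC_line_y; exact: dQ.
  rewrite (_ : B x y1 - B x y0 - _ = B x y1 - Q (mkC x y1) - (B x y0 - Q (mkC x y0))); last by ring.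
  apply: le_trans h _; rewrite ger0_norm; last lra.
  rewrite (_ : 4 * e * s ^+ 2 = 2 * (e * (2 * s)) * s); last by ring.
  by rewrite ler_wpM2l// !mulr_ge0// ltW.
rewrite /W /contour.
have y00 : y0 <= y0 <= y1 by lra.
have y11 : y0 <= y1 <= y1 by lra.
have x00 : x0 <= x0 <= x1 by lra.
have x11 : x0 <= x1 <= x1 by lra.
have := side_x _ y00; have := side_x _ y11.
have := side_y _ x00; have := side_y _ x11.
set a := (_ - _ - _); set b := (_ - _ - _); set c := (_ - _ - _); set d := (_ - _ - _).
move=> ha hb hc hd.
rewrite (_ : _ - _ = d + a - c - b); last by rewrite /a /b /c /d; ring.
have := cmodB (d + a - c) b; have := cmodB (d + a) c; have := cmodD d a.
lra.
Qed.

(** Bisection: some quarter of a rectangle carries at least a quarter of its contour value.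
    Iterating, the values decrease at most like 4^-n, whereas differentiability at the limit point
    bounds them by an arbitrarily small multiple of 4^-n. *)
Lemma contour_eq0_ord (x0 x1 y0 y1 : R) : x0 <= x1 -> y0 <= y1 -> W x0 x1 y0 y1 = 0.
Proof.
move=> x01 y01; apply/eqP; rewrite -cmod_eq0; apply/negPn/negP => W0.
have {}W0 : 0 < cmod (W x0 x1 y0 y1) by rewrite lt0r W0 cmod_ge0.
pose a := x1 - x0; pose b := y1 - y0.
have a0 : 0 <= a by rewrite subr_ge0.
have b0 : 0 <= b by rewrite subr_ge0.
pose Wn n (p : R * R) := W p.1 (p.1 + a / 2 ^+ n) p.2 (p.2 + b / 2 ^+ n).
have step (np : nat * (R * R)) : exists p' : R * R,
    [/\ cmod (Wn np.1 np.2) <= 4 * cmod (Wn np.1.+1 p'),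
        np.2.1 <= p'.1 <= np.2.1 + a / 2 ^+ np.1.+1 &
        np.2.2 <= p'.2 <= np.2.2 + b / 2 ^+ np.1.+1].
  case: np => n [x y] /=; rewrite /Wn /=.
  have pow2 c : c / 2 ^+ n = c / 2 ^+ n.+1 + c / 2 ^+ n.+1 :> R.
    by rewrite exprS invfM; set t := (2 ^+ n)^-1; lra.
  rewrite !pow2; set h := a / _; set k := b / _.
  have h0 : 0 <= h by rewrite divr_ge0// exprn_ge0.
  have k0 : 0 <= k by rewrite divr_ge0// exprn_ge0.
  rewrite !addrA.
  have E : W x (x + h + h) y (y + k + k) = W x (x + h) y (y + k) +
      W (x + h) (x + h + h) y (y + k) + (W x (x + h) (y + k) (y + k + k) +
      W (x + h) (x + h + h) (y + k) (y + k + k)) by exact: contour_split.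
  have : cmod (W x (x + h + h) y (y + k + k)) <=
    cmod (W x (x + h) y (y + k)) + cmod (W (x + h) (x + h + h) y (y + k)) +
    (cmod (W x (x + h) (y + k) (y + k + k)) + cmod (W (x + h) (x + h + h) (y + k) (y + k + k))).
    by rewrite E; apply: le_trans (cmodD _ _) _; apply: lerD; exact: cmodD.
  set w := cmod _; set w1 := cmod _; set w2 := cmod _; set w3 := cmod _; set w4 := cmod _ => le4.
  have [?|?] := leP w (4 * w1); first by exists (x, y); split=> //=; lra.
  have [?|?] := leP w (4 * w2); first by exists (x + h, y); split=> //=; lra.
  have [?|?] := leP w (4 * w3); first by exists (x, y + k); split=> //=; lra.
  by exists (x + h, y + k); split=> //=; rewrite -/w4; lra.
have [st stP] := choice step.
pose fix u n := if n is m.+1 then st (m, u m) else (x0, y0).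
have bad n : cmod (W x0 x1 y0 y1) <= 4 ^+ n * cmod (Wn n (u n)).
  elim: n => [|n IH].
    by rewrite /Wn /= !expr0 mul1r !divr1 /a /b !subrKC.
  apply: le_trans IH _; rewrite exprSr -mulrA ler_wpM2l ?exprn_ge0//.
  by have [] := stP (n, u n).
have [X HX] : exists X, forall n, (u n).1 <= X <= (u n).1 + a / 2 ^+ n.
  by apply: nested_itv => // n; have [] := stP (n, u n).
have [Y HY] : exists Y, forall n, (u n).2 <= Y <= (u n).2 + b / 2 ^+ n.
  by apply: nested_itv => // n; have [] := stP (n, u n).
(* [L] dominates both sides and stays positive for a degenerate rectangle; [e] is chosen so that 4^n
   * 16 e (L / 2^n)^2 is half of the contour value. *)
pose L := a + b + 1; have L0 : 0 < L by rewrite /L; lra.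
pose e := cmod (W x0 x1 y0 y1) / (32 * L ^+ 2).
have e0 : 0 < e by rewrite divr_gt0// mulr_gt0// exprn_gt0.
have [d d0 H] := contour_local X Y e0.
have [n nd] := exists_pow2 L d0.
have {}H := H _ _ _ _ (L / 2 ^+ n) (HX n) (HY n) _ _ nd.
have p0 : 0 < (2 ^+ n : R)^-1 by rewrite invr_gt0 exprn_gt0.
have {}H : cmod (Wn n (u n)) <= 16 * e * (L / 2 ^+ n) ^+ 2.
  by apply: H; rewrite addrC addKr ler_pM2r// /L; lra.
have := le_trans (bad n) (ler_wpM2l (exprn_ge0 n (ler0n R 4)) H).
rewrite (_ : 4 ^+ n * _ = 16 * e * L ^+ 2).
  rewrite /e (_ : 16 * _ * _ = cmod (W x0 x1 y0 y1) / 2); first lra.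
  by field; rewrite gt_eqF.
rewrite expr_div_n -exprM mulnC exprM (_ : 2 ^+ 2 = 4 :> R); last by rewrite -natrX.
by field; rewrite expf_eq0 andbC; apply/negP => /andP[/eqP]; lra.
Qed.

Lemma contour_eq0 (x0 x1 y0 y1 : R) : W x0 x1 y0 y1 = 0.
Proof.
wlog x01 : x0 x1 / x0 <= x1.
  move=> H; have [|/ltW] := leP x0 x1; first exact: H.
  by move/H => E; rewrite -[LHS]opprK -oppr0 -E /W /contour; congr (- _); ring.
wlog y01 : y0 y1 / y0 <= y1.
  move=> H; have [|/ltW] := leP y0 y1; first exact: H.
  by move/H => E; rewrite -[LHS]opprK -oppr0 -E /W /contour; congr (- _); ring.
exact: contour_eq0_ord.
Qed.

(** The antiderivative integrates along the real axis, then vertically. Its increment from z to z +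
    h can be moved to a path inside a small neighbourhood of z, where f is close to f z; each of the
    two legs costs at most 2 (e / 4) |h|. *)
Lemma contour_primitive : exists P : C -> C, forall z, is_derive z (1 : C) P (f z).
Proof.
exists (fun z => A 0 (cre z) - A 0 0 + (B (cre z) (cim z) - B (cre z) 0)) => z.
apply/is_deriveCP => e e0.
have e4 : 0 < e / 4 by lra.
have : {for z, continuous f}.
  exact/differentiable_continuous/derivable1_diffP/ef.
move=> /cvgCP/(_ (e / 4) e4)/nbhsCP[r r0 H].
exists (r / 2); first lra.
move=> h hr.
pose x := cre z; pose y := cim z; pose x' := cre (z + h); pose y' := cim (z + h).
(* The contour over the rectangle with sides [x, x'] and [0, y] vanishes, which lifts the horizontal
   leg from the real axis to the height of z. *)
have E : A 0 x' - A 0 0 + (B x' y' - B x' 0) - (A 0 x - A 0 0 + (B x y - B x 0)) =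
    (A y x' - A y x) + (B x' y' - B x' y).
  by rewrite -[RHS]addr0 -(contour_eq0 x x' 0 y) /W /contour; ring.
rewrite -/x -/y -/x' -/y' E.
have x'E : x' - x = cre h by rewrite /x' /x creD; ring.
have y'E : y' - y = cim h by rewrite /y' /y cimD; ring.
have hx := cre_le h; have hy := cim_le h.
have near_b s t : `|s - x| <= cmod h -> `|t - y| <= cmod h ->
    cmod (f (mkC s t) - f z) <= e / 4.
  move=> sx ty; apply/ltW/H; apply: le_lt_trans (cmod_le _) _.
  by rewrite creB cimB -/x -/y -[cre (mkC s t)]/s -[cim (mkC s t)]/t; lra.
have hA := @rder_mvi R (fun t => A y t - f z * mkC t y)
  (fun t => f (mkC t y) - f z * 1) x x' (e / 4).
have hB := @rder_mvi R (fun t => B x' t - f z * mkC x' t)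
  (fun t => f (mkC x' t) * ci R - f z * ci R) y y' (e / 4).
have dlin w : is_derive w (1 : C) (fun v : C => f z * v) (f z).
  apply/is_deriveCP => e' e'0; exists 1 => // k _.
  by rewrite (_ : _ - _ = 0) ?cmod0 ?mulr_ge0 ?cmod_ge0// ?ltW//; ring.
have {}hA : cmod (A y x' - f z * mkC x' y - (A y x - f z * mkC x y)) <= 2 * (e / 4) * cmod h.
  apply: le_trans (hA _ _) _.
  - move=> t _; apply: rderB => //.
    rewrite (_ : (fun t => f z * _) = (fun t => f z * (ci R * ofR y + ofR t * 1))); last first.
      by apply/funext => u; rewrite mkC_line_x.
    apply: (@rder_line _ (fun v => f z * v)); exact: dlin.
  - move=> t /btw_dist; rewrite x'E => tx; rewrite mulr1; apply: near_b; first exact: le_trans hx.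
    by rewrite subrr normr0 cmod_ge0.
  - by rewrite x'E ler_wpM2l//; lra.
have {}hB : cmod (B x' y' - f z * mkC x' y' - (B x' y - f z * mkC x' y)) <= 2 * (e / 4) * cmod h.
  apply: le_trans (hB _ _) _.
  - move=> t _; apply: rderB => //.
    rewrite (_ : (fun t => f z * _) = (fun t => f z * (ofR x' + ofR t * ci R))); last first.
      by apply/funext => u; rewrite mkC_line_y.
    apply: (@rder_line _ (fun v => f z * v)); exact: dlin.
  - move=> t /btw_dist; rewrite y'E => tx.
    rewrite -mulrBl cmodM cmod_ci mulr1; apply: near_b; last exact: le_trans hy.
    by rewrite x'E.
  - by rewrite y'E ler_wpM2l//; lra.
have zh : h = mkC x' y' - mkC x y.
  have -> : mkC x' y' = z + h by rewrite /x' /y'; case: (z + h).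
  have -> : mkC x y = z by rewrite /x /y; case: (z).
  by rewrite addrAC subrr add0r.
rewrite [X in cmod (_ - f z * X)]zh.
set a := (_ - _ - _) in hA; set b := (_ - _ - _) in hB.
rewrite (_ : _ - _ = a + b); last by rewrite /a /b; ring.
by have := cmodD a b; lra.
Qed.

End Goursat.

(** Along horizontal and vertical lines f is continuous, hence has antiderivatives there; Goursat's
    theorem makes them fit together. *)
Lemma entire_primitive (R : realType) (f : Cplx R -> Cplx R) : entire f ->
  exists P : Cplx R -> Cplx R, forall z, is_derive z (1 : Cplx R) P (f z).
Proof.
move=> ef.
have lineH (y : R) x : rder (fun t => f (mkC t y)) x ('D_1 f (mkC x y) * 1).
  rewrite (_ : (fun t => _) = fun t => f (ci R * ofR y + ofR t * 1)); last first.
    by apply/funext => u; rewrite mkC_line_x.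
  by apply: rder_line; rewrite -mkC_line_x; exact: entireP.
have lineV (x : R) y : rder (fun t => f (mkC x t)) y ('D_1 f (mkC x y) * ci R).
  rewrite (_ : (fun t => _) = fun t => f (ofR x + ofR t * ci R)); last first.
    by apply/funext => u; rewrite mkC_line_y.
  by apply: rder_line; rewrite -mkC_line_y; exact: entireP.
have HA y : exists A : R -> Cplx R, forall x, rder A x (f (mkC x y)).
  by have [? ?] := rder_continuous (lineH y); exact: rder_antiderivative.
have HB x : exists B : R -> Cplx R, forall y, rder B y (f (mkC x y) * ci R).
  have [cr cc] := rder_continuous (lineV x).
  apply: rder_antiderivative.
    rewrite (_ : (fun t => _) = fun t => - cim (f (mkC x t))).
      by move=> t; exact: (cvgN (cc t)).
    by apply/funext => t; rewrite creM /= mulr0 mulr1 sub0r.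
  rewrite (_ : (fun t => _) = fun t => cre (f (mkC x t))) //.
  by apply/funext => t; rewrite cimM /= mulr0 mulr1 addr0.
have [A dA] := choice HA; have [B dB] := choice HB.
exact: (@contour_primitive R f A B ef (fun x y => dA y x) dB).
Qed.

(** * The complex exponential *)

Section ComplexExponential.
Variable R : realType.
Local Notation C := (Cplx R).
Implicit Types z w : C.

Lemma is_deriveR_bound (f : R -> R) (x d : R) : is_derive x (1 : R) f d ->
  forall e : R, 0 < e -> exists2 r : R, 0 < r &
    forall h, `|h| < r -> `|f (x + h) - f x - d * h| <= e * `|h|.
Proof.
move=> [df dE] e e0.
have : h^-1 *: (f (h *: 1 + x) - f x) @[h --> 0^'] --> d.
  by rewrite -dE; move: df; rewrite /derivable /derive; exact.
move=> /cvgrPdist_lt/(_ e e0); rewrite near_withinE => /nbhs_ballP[r /= r0 H].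
exists r => // h hr; have [->|h0] := eqVneq h 0.
  by rewrite addr0 mulr0 subr0 subrr normr0 mulr0.
have := H h; rewrite /ball /= sub0r normrN => /(_ hr h0).
rewrite scaler1 [h + x]addrC distrC => {}H.
have -> : f (x + h) - f x - d * h = h * (h^-1 *: (f (x + h) - f x) - d).
  by rewrite mulrBr -[_ *: _]/(_ * _) mulrA mulfV// mul1r [d * h]mulrC.
by rewrite normrM mulrC ler_wpM2r// ltW.
Qed.

Lemma ofR_int (k : int) : ofR (k%:~R : R) = k%:~R.
Proof.
case: k => n; first by rewrite -!pmulrn ofR_nat.
by rewrite NegzE !mulrNz ofRN -!pmulrn ofR_nat.
Qed.

Definition cexp z : C := mkC (expR (cre z) * cos (cim z)) (expR (cre z) * sin (cim z)).

Lemma cexpD z w : cexp (z + w) = cexp z * cexp w.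
Proof.
apply/eqP; rewrite eq_complex; apply/andP; split; apply/eqP.
  rewrite -/(cre _) -/(cre (_ * _)) creM /cexp !creD !cimD /cre /cim /= expRD cosD; ring.
rewrite -/(cim _) -/(cim (_ * _)) cimM /cexp !creD !cimD /cre /cim /= expRD sinD; ring.
Qed.

Lemma cexp0 : cexp 0 = 1.
Proof. by rewrite /cexp /= expR0 sin0 cos0 mulr0 mulr1. Qed.

Lemma cmod_cexp z : cmod (cexp z) = expR (cre z).
Proof.
have : cmod (cexp z) ^+ 2 = expR (cre z) ^+ 2.
  by rewrite cmod_sqr /= !exprMn -mulrDr cos2Dsin2 mulr1.
by move/eqP; rewrite eqrXn2 ?cmod_ge0 ?expR_ge0// => /eqP.
Qed.

Lemma cexp_neq0 z : cexp z != 0.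
Proof. by rewrite -cmod_gt0 cmod_cexp expR_gt0. Qed.

Lemma cexpN z : cexp (- z) = (cexp z)^-1.
Proof.
by apply: (mulfI (cexp_neq0 z)); rewrite -cexpD subrr cexp0 mulfV// cexp_neq0.
Qed.

Lemma cexpB z w : cexp (z - w) = cexp z / cexp w.
Proof. by rewrite cexpD cexpN. Qed.

Lemma cexpMn n z : cexp (z *+ n) = cexp z ^+ n.
Proof. by elim: n => [|n IH]; rewrite ?mulr0n ?cexp0// mulrS cexpD IH exprS. Qed.

Lemma is_derive_cexp z : is_derive z (1 : C) cexp (cexp z).
Proof.
apply/is_deriveCP => e e0.
suff [r r0 H] : exists2 r : R, 0 < r &
    forall h, cmod h < r -> cmod (cexp h - 1 - h) <= (e / expR (cre z)) * cmod h.
  exists r => // h /H{}H; rewrite cexpD.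
  rewrite (_ : _ - _ = cexp z * (cexp h - 1 - h)); last by ring.
  rewrite cmodM cmod_cexp mulrC -ler_pdivlMr ?expR_gt0//.
  by rewrite mulrAC.
(* The three error terms below cost 1, 4 and 1 times e' |h|, which fits into 8 e' |h|. *)
have {e0 e} [e e0 ->] : exists2 e' : R, 0 < e' & e / expR (cre z) = 8 * e'.
  by exists (e / expR (cre z) / 8); [rewrite !divr_gt0 ?expR_gt0//|field; rewrite gt_eqF ?expR_gt0].
have [r1 r10 H1] := is_deriveR_bound (is_derive_expR (0 : R)) e0.
have [r2 r20 H2] := is_deriveR_bound (is_derive_cos (0 : R)) e0.
have [r3 r30 H3] := is_deriveR_bound (is_derive_sin (0 : R)) e0.
exists (Num.min (Num.min r1 r2) (Num.min r3 (Num.min 1 e))).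
  by rewrite !lt_min r10 r20 r30 e0 ltr01.
move=> h; rewrite !lt_min => /andP[/andP[hr1 hr2] /and3P[hr3 h1 he]].
pose x := cre h; pose y := cim h.
have hx : `|x| <= cmod h := cre_le h.
have hy : `|y| <= cmod h := cim_le h.
have {}H1 := H1 x (le_lt_trans hx hr1).
have {}H2 := H2 y (le_lt_trans hy hr2).
have {}H3 := H3 y (le_lt_trans hy hr3).
rewrite add0r expR0 mul1r in H1.
rewrite add0r cos0 sin0 oppr0 mul0r subr0 in H2.
rewrite add0r cos0 sin0 subr0 mul1r in H3.
have m0 := cmod_ge0 h.
set a := expR x - 1 - x in H1; set b := cos y - 1 in H2; set c := sin y - y in H3.
(* With h = x + i y, the error splits into the real ones of exp, cos and sin at 0, plus the mixed
   term i x y; the bounds |h| < 1 and |h| < e control 1 + x and x y. *)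
have -> : cexp h - 1 - h = ofR a * mkC (cos y) (sin y) + ofR (1 + x) * mkC b c + ofR (x * y) * ci R.
  apply/eqP; rewrite eq_complex; apply/andP; split; apply/eqP.
    rewrite -/(cre _) -[RHS]/(cre _) !creB !creD !creM /cexp -/x -/y /cre /cim /= -/(cre h) -/x /a /b /c; ring.
  rewrite -/(cim _) -[RHS]/(cim _) !cimB !cimD !cimM /cexp -/x -/y /cre /cim /= -/(cim h) -/y /a /b /c; ring.
have e1 : cmod (ofR a * mkC (cos y) (sin y)) <= e * cmod h.
  have -> : mkC (cos y) (sin y) = cexp (mkC 0 y) by rewrite /cexp /= expR0 !mul1r.
  by rewrite cmodM cmod_cexp expR0 mulr1 cmod_ofR (le_trans H1)// ler_pM2l.
have e2 : cmod (ofR (1 + x) * mkC b c) <= 4 * e * cmod h.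
  rewrite cmodM cmod_ofR.
  have : cmod (mkC b c) <= 2 * e * cmod h.
    apply: le_trans (cmod_le _) _; rewrite -[cre _]/b -[cim _]/c.
    have := ler_wpM2l (ltW e0) hy; lra.
  have : `|1 + x| <= 2 by rewrite (le_trans (ler_normD _ _))// normr1; lra.
  have := normr_ge0 (1 + x); have := cmod_ge0 (mkC b c); nra.
have e3 : cmod (ofR (x * y) * ci R) <= e * cmod h.
  rewrite cmodM cmod_ci mulr1 cmod_ofR normrM; apply: ler_pM => //; lra.
have e4 := cmodD (ofR a * mkC (cos y) (sin y) + ofR (1 + x) * mkC b c) (ofR (x * y) * ci R).
have e5 := cmodD (ofR a * mkC (cos y) (sin y)) (ofR (1 + x) * mkC b c).
have := mulr_ge0 (ltW e0) m0; lra.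
Qed.

Lemma cexp_surj z : z != 0 -> exists w, cexp w = z.
Proof.
move=> z0; have m0 : 0 < cmod z by rewrite cmod_gt0.
pose a := cre z / cmod z; pose b := cim z / cmod z.
have ab : a ^+ 2 + b ^+ 2 = 1.
  by rewrite /a /b !expr_div_n -mulrDl -cmod_sqr divff// expf_neq0// gt_eqF.
have a1 : -1 <= a <= 1 by have := sqr_ge0 b; nra.
have [t [ct st]] : exists t : R, cos t = a /\ sin t = b.
  have ca : cos (acos a) = a by apply: acosK; rewrite in_itv.
  have sa : sin (acos a) = `|b|.
    by rewrite sin_acos// -ab addrC addKr sqrtr_sqr.
  have [b0|b0] := leP 0 b.
    by exists (acos a); rewrite ca sa ger0_norm.
  by exists (- acos a); rewrite cosN sinN ca sa ltr0_norm// opprK.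
exists (mkC (ln (cmod z)) t); rewrite /cexp /= lnK ?posrE// ct st /a /b.
rewrite ![cmod z * _]mulrC !divfK ?gt_eqF//; by case: (z).
Qed.

Lemma cos_eq1 (y : R) : cos y = 1 -> exists k : int, y = k%:~R * (2 * pi).
Proof.
move=> cy.
have pp : 0 < 2 * pi :> R by rewrite mulr_gt0// pi_gt0.
pose k := Num.floor (y / (2 * pi)); exists k.
pose t := y - k%:~R * (2 * pi).
have /andP[k1 k2] := floor_itv (y / (2 * pi)); rewrite -/k in k1 k2.
have t0 : 0 <= t by rewrite subr_ge0 -ler_pdivlMr.
have t1 : t < 2 * pi.
  by move: k2; rewrite ltr_pdivrMr// rmorphD /= mulrDl mul1r /t; lra.
have cosk (j : int) (u : R) : cos (u + j%:~R * (2 * pi)) = cos u.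
  have cosn (n : nat) v : cos (v + n%:R * (2 * pi)) = cos v :> R.
    have := periodicn (@cosD2pi R) n v.
    by rewrite (_ : pi *+ 2 *+ n = n%:R * (2 * pi))//; ring.
  case: j => n; first exact: cosn.
  by rewrite NegzE mulrNz mulNr -[LHS](cosn n.+1) subrK.
have ct : cos t = 1.
  by rewrite -cy -(cosk k t) /t subrK.
apply/eqP; rewrite -subr_eq0 -/t; apply/eqP.
have [->//|tn0] := eqVneq t 0.
have tpos : 0 < t by rewrite lt0r tn0.
(* The half-angle formula cos t = 1 - 2 sin^2 (t / 2) excludes the value 1 strictly inside a
   period. *)
have : 0 < sin (t / 2) by apply: sin_gt0_pi; rewrite divr_gt0//= ltr_pdivrMr// mulrC.
have : cos t = 1 - 2 * sin (t / 2) ^+ 2.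
  have := cos2Dsin2 (t / 2); have := cosD (t / 2) (t / 2).
  by rewrite -splitr -!expr2 => ->; lra.
rewrite ct => s2 s0; exfalso.
have : 0 < sin (t / 2) ^+ 2 by rewrite exprn_gt0.
by lra.
Qed.

Lemma cexp_eq1 z : cexp z = 1 -> exists k : int, z = k%:~R * (ofR (2 * pi) * ci R).
Proof.
move=> z1; have x0 : cre z = 0.
  apply: expR_inj; by rewrite -cmod_cexp z1 cmod1 expR0.
have := congr1 (@cre R) z1; rewrite /cexp /= x0 expR0 mul1r => /cos_eq1[k kE].
exists k; rewrite [LHS]creimE x0 add0r kE !ofRM ofR_int; ring.
Qed.

Lemma cexp_2pi (k : int) : cexp (k%:~R * (ofR (2 * pi) * ci R)) = 1.
Proof.
have one : cexp (ofR (2 * pi) * ci R) = 1.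
  rewrite /cexp creM cimM /= !(mul0r, mulr0, mulr1, subr0, addr0) expR0 !mul1r.
  by rewrite [2 * pi]mulrC mulr_natr cos2pi sin2pi.
have H (n : nat) : cexp (n%:R * (ofR (2 * pi) * ci R)) = 1.
  by rewrite mulr_natl cexpMn one expr1n.
by case: k => n; [exact: H|rewrite NegzE mulrNz mulNr cexpN (H n.+1) invr1].
Qed.

End ComplexExponential.

(** * Entire functions *)

Section EntireFunctions.
Variable R : realType.
Local Notation C := (Cplx R).
Implicit Types (f g : C -> C) (z w : C).

Lemma is_derive_compC f g z (df dg : C) :
  is_derive (g z) (1 : C) f df -> is_derive z (1 : C) g dg ->
  is_derive z (1 : C) (f \o g) (df * dg).
Proof.
move=> [f1 f2] [g1 g2].
have Df : differentiable f (g z) := (derivable1_diffP f (g z)).1 f1.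
have Dg : differentiable g z := (derivable1_diffP g z).1 g1.
have Dfg : differentiable (f \o g) z := differentiable_comp Dg Df.
split; first exact: (derivable1_diffP (f \o g) z).2 Dfg.
have E1 : 'D_1 (f \o g) z = 'd (f \o g) z 1 := deriveE (1 : C) Dfg.
have E2 : 'd (f \o g) z 1 = 'd f (g z) ('d g z 1) := congr1 (fun u => u 1) (diff_comp Dg Df).
have E3 : 'D_1 g z = 'd g z 1 := deriveE (1 : C) Dg.
have E4 : 'd f (g z) dg = dg *: (f^`()%classic (g z)) := congr1 (fun u => u dg) (deriv1E f1).
have E5 : 'd g z 1 = dg := etrans (esym E3) g2.
have E6 : f^`()%classic (g z) = df := etrans (derive1E _ _) f2.
exact: etrans E1 (etrans E2 (etrans (congr1 ('d f (g z)) E5)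
  (etrans E4 (etrans (congr1 (fun u => dg *: u) E6) (mulrC dg df))))).
Qed.

Lemma is_deriveBC f g z (df dg : C) :
  is_derive z (1 : C) f df -> is_derive z (1 : C) g dg ->
  is_derive z (1 : C) (fun w => f w - g w) (df - dg).
Proof. exact: is_deriveB. Qed.

Lemma is_deriveDC f g z (df dg : C) :
  is_derive z (1 : C) f df -> is_derive z (1 : C) g dg ->
  is_derive z (1 : C) (fun w => f w + g w) (df + dg).
Proof. exact: is_deriveD. Qed.

Lemma is_deriveMC f g z (df dg : C) :
  is_derive z (1 : C) f df -> is_derive z (1 : C) g dg ->
  is_derive z (1 : C) (fun w => f w * g w) (f z * dg + g z * df).
Proof. exact: is_deriveM. Qed.

Lemma is_deriveZC (a : C) f z (df : C) :
  is_derive z (1 : C) f df -> is_derive z (1 : C) (fun w => a * f w) (a * df).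
Proof. exact: is_deriveZ. Qed.

Lemma is_derive_affine (a b : C) z : is_derive z (1 : C) (fun w => a * w + b) a.
Proof.
apply/is_deriveCP => e e0; exists 1 => // h _.
by rewrite (_ : _ - _ = 0) ?cmod0 ?mulr_ge0 ?cmod_ge0// ?ltW//; ring.
Qed.

Lemma is_derive_oppC z : is_derive z (1 : C) (fun w => - w) (-1).
Proof.
rewrite (_ : (fun w => - w) = fun w => -1 * w + 0); first exact: is_derive_affine.
by apply/funext => w; rewrite addr0 mulN1r.
Qed.

Lemma is_derive_mull (a : C) z : is_derive z (1 : C) (fun w => a * w) a.
Proof.
rewrite (_ : (fun w => a * w) = fun w => a * w + 0); first exact: is_derive_affine.
by apply/funext => w; rewrite addr0.
Qed.

Lemma is_derive_addr (b : C) z : is_derive z (1 : C) (fun w => w + b) 1.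
Proof.
rewrite (_ : (fun w => w + b) = fun w => 1 * w + b); first exact: is_derive_affine.
by apply/funext => w; rewrite mul1r.
Qed.

Lemma entire_continuous f : entire f -> continuous f.
Proof. by move=> ef z; exact/differentiable_continuous/derivable1_diffP/ef. Qed.

Lemma entireD f g : entire f -> entire g -> entire (fun z => f z + g z).
Proof. by move=> ef eg z; exact: derivableD. Qed.
Lemma entireB f g : entire f -> entire g -> entire (fun z => f z - g z).
Proof. by move=> ef eg z; exact: derivableB. Qed.
Lemma entireM f g : entire f -> entire g -> entire (fun z => f z * g z).
Proof. by move=> ef eg z; exact: derivableM. Qed.
Lemma entire_cst (a : C) : entire (fun=> a).
Proof. by move=> z; exact: derivable_cst. Qed.
Lemma entire_id : entire (fun z => z).
Proof. by move=> z; exact: derivable_id. Qed.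
Lemma entire_comp f g : entire f -> entire g -> entire (fun z => f (g z)).
Proof.
move=> ef eg z; have := is_derive_compC (entireP (g z) ef) (entireP z eg).
by case.
Qed.
Lemma entireX f n : entire f -> entire (fun z => f z ^+ n).
Proof.
move=> ef; elim: n => [|n IH]; first exact: entire_cst.
rewrite (_ : (fun z => _) = fun z => f z * f z ^+ n); first exact: entireM.
by apply/funext => z; rewrite exprS.
Qed.
Lemma entire_cexp : entire (@cexp R).
Proof. exact: is_derive_entire (@is_derive_cexp R). Qed.

Lemma continuous_cmod : continuous (@cmod R).
Proof.
move=> z; have : cmod w @[w --> z] --> cmod z; last by [].
apply: (iffRL (@cvgrPdist_lt _ _ _ (nbhs z) (nbhs_filter z) _ _)) => e e0.
apply/nbhsCP; exists e => // w we.
have := cmodBD z w; have := cmodBD w z; rewrite (cmodC z w) => ? ?.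
by rewrite ltr_norml; lra.
Qed.

(** The disc is a closed subset of the continuous image of a compact real square. *)
Lemma compact_disc (r : R) : compact [set z : C | cmod z <= r].
Proof.
have cK : compact ((fun p : R * R => mkC p.1 p.2 : C) @` (`[-r, r]%classic `*` `[-r, r]%classic)).
  apply: continuous_compact; last first.
    by apply: compact_setX; exact: segment_compact.
  apply: continuous_subspaceT => -[x y].
  apply/cvgCP => e e0; have e20 : 0 < e / 2 by rewrite divr_gt0.
  apply: filterS (nbhsx_ballx (x, y) _ e20) => -[x' y'] [].
  rewrite /ball /= => h1 h2; change (cmod (mkC x' y' - mkC x y) < e).
  apply: le_lt_trans (cmod_le _) _; rewrite creB cimB /cre /cim /=.
  by rewrite distrC [X in _ + X]distrC; lra.
apply: subclosed_compact cK _; last first.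
  move=> z /= zr; exists (cre z, cim z); last by case: (z).
  by split; rewrite /= in_itv /= -ler_norml; [apply: le_trans (cre_le z) _|apply: le_trans (cim_le z) _].
by apply: (@closed_comp _ _ (@cmod R) [set x | x <= r]) => [z _|]; [exact: continuous_cmod|exact: closed_le].
Qed.

Lemma continuous_disc_max (f : C -> R) (r : R) : 0 <= r -> continuous f ->
  exists2 z, cmod z <= r & forall w, cmod w <= r -> f w <= f z.
Proof.
move=> r0 cf.
have [] := @compact_EVT_max C R f [set z : C | cmod z <= r].
- by exists (0 : C); change (cmod (0 : C) <= r); rewrite cmod0.
- exact: compact_disc.
- exact: continuous_subspaceT.
move=> z; rewrite inE /= => zr H; exists z => // w wr; apply: H; by rewrite inE.
Qed.

Lemma entire_bounded f (r : R) : entire f ->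
  exists2 M, 0 <= M & forall z, cmod z <= r -> cmod (f z) <= M.
Proof.
move=> ef; have [r0|r0] := leP 0 r; last first.
  by exists 0 => // z zr; have := cmod_ge0 z; lra.
have [|z zr H] := @continuous_disc_max (@cmod R \o f) r r0.
  by move=> z; apply: continuous_comp; [exact: entire_continuous|exact: continuous_cmod].
by exists (cmod (f z)); [exact: cmod_ge0|].
Qed.

Lemma mvi f z v K : entire f ->
  (forall t : R, 0 <= t <= 1 -> cmod ('D_1 f (z + ofR t * v)) <= K) ->
  cmod (f (z + v) - f z) <= 2 * K * cmod v.
Proof.
move=> ef H.
have := @rder_mvi R (fun t => f (z + ofR t * v)) (fun t => 'D_1 f (z + ofR t * v) * v) 0 1 (K * cmod v).
rewrite mul0r mul1r !addr0 subr0 normr1 mulr1 mulrA; apply.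
  by move=> t _; apply: rder_line; exact: entireP.
move=> t tt; rewrite cmodM ler_wpM2r ?cmod_ge0// H//.
by case/orP: tt => /andP[? ?]; lra.
Qed.

Lemma derive0_constant f : entire f -> (forall z, 'D_1 f z = 0) -> forall z w, f z = f w.
Proof.
move=> ef f0 z w; apply/eqP; rewrite -subr_eq0 -cmod_eq0 eq_le cmod_ge0 andbT.
have := @mvi f w (z - w) 0 ef; rewrite subrKC mulr0 mul0r; apply => t _.
by rewrite f0 cmod0.
Qed.

Lemma derive_of f z (d : C) : is_derive z (1 : C) f d -> 'D_1 f z = d.
Proof. by case. Qed.

(** * Cauchy's estimate for the derivative *)

Section CauchyEstimate.
Variables (f : C -> C) (c : C).
Hypothesis ef : entire f.
Let per : C := ofR (2 * pi) * ci R.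

Lemma cexp_per w : cexp (w + per) = cexp w.
Proof. by rewrite cexpD -[per]mul1r -[1 * per]/(1%:~R * per) cexp_2pi mulr1. Qed.

Lemma cexp_opp_per w : cexp (- (w + per)) = cexp (- w).
Proof. by rewrite -[LHS]cexp_per opprD subrK. Qed.

Lemma cre_segment w (t : R) : cre (w + ofR t * per) = cre w.
Proof. by rewrite creD /per !creM !cimM /cre /cim /=; ring. Qed.

(* The period of an antiderivative of f(c + e^w) e^{-w} along 2 pi i is computed
   on any segment of real part ln r, which covers the circle of radius r around
   c: it is 2 pi i f'(c) by letting r tend to 0, and it is bounded on r = 1.  The
   factor 2 comes from bounding real and imaginary parts separately. *)
Lemma cauchy_estimate M : (forall z, cmod (z - c) = 1 -> cmod (f z) <= M) ->
  cmod ('D_1 f c) <= 2 * M.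
Proof.
move=> fM.
pose G w := f (c + cexp w) * cexp (- w).
have eN : entire (fun w : C => - w) := is_derive_entire is_derive_oppC.
have eG : entire G.
  apply: entireM; last by apply: (entire_comp (@entire_cexp)).
  by apply: (entire_comp ef); apply: entireD; [exact: entire_cst|exact: entire_cexp].
have [P dP] := entire_primitive eG.
have eP : entire P by exact: is_derive_entire dP.
have eper : entire (fun w => w + per) by apply: entireD; [exact: entire_id|exact: entire_cst].
have per_eq : cmod per = 2 * pi.
  by rewrite cmodM cmod_ci mulr1 cmod_ofR ger0_norm// mulr_ge0// pi_ge0.
have Gper w : G (w + per) = G w.
  by rewrite /G cexp_per cexp_opp_per.
have P_per w : P (w + per) - P w = P per - P 0.
  rewrite -[X in P X - P 0]add0r.
  apply: (@derive0_constant (fun w => P (w + per) - P w)).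
    exact: (entireB (entire_comp eP eper) eP).
  move=> z; apply: derive_of.
  have := is_deriveBC (is_derive_compC (g := fun w => w + per) (dP (z + per)) (is_derive_addr per z)) (dP z).
  by rewrite mulr1 Gper subrr.
have main : P per - P 0 = 'D_1 f c * per.
  apply/eqP; rewrite -subr_eq0 -cmod_eq0 eq_le cmod_ge0 andbT.
  apply/ler_addgt0Pr => e' e'0; rewrite add0r.
  have p0 : 0 < 2 * (2 * pi) :> R by rewrite !mulr_gt0// pi_gt0.
  have [e e0 ->] : exists2 e, 0 < e & e' = 2 * e * (2 * pi).
    by exists (e' / (2 * (2 * pi))); [exact: divr_gt0|rewrite mulrAC mulrCA mulfV ?mulr1// lt0r_neq0].
  have /is_deriveCP/(_ e e0)[r r0 H] := entireP c ef.
  (* [S] removes an antiderivative of f'(c) + f(c) e^{-w}, the main part of [G] when Re w is very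
     negative. The term in e^{-w} is periodic, so over one period only f'(c) * per is subtracted. *)
  pose S w := P w - ('D_1 f c * w - f c * cexp (- w)).
  pose ze : C := ofR (ln (r / 2)).
  have r20 : 0 < r / 2 by rewrite divr_gt0.
  have dS w : is_derive w (1 : C) S (G w - ('D_1 f c - f c * - cexp (- w))).
    have dE : is_derive w (1 : C) (fun v => cexp (- v)) (- cexp (- w)).
      rewrite -mulrN1.
      exact: (is_derive_compC (g := fun v => - v) (is_derive_cexp (- w)) (is_derive_oppC w)).
    exact: (is_deriveBC (dP w) (is_deriveBC (is_derive_mull ('D_1 f c) w) (is_deriveZC (f c) dE))).
  have eS : entire S by exact: is_derive_entire dS.
  have : cmod (S (ze + per) - S ze) <= 2 * e * cmod per.
    apply: mvi => // t _; rewrite (derive_of (dS _)).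
    set w := ze + _.
    have cw : cmod (cexp w) = r / 2.
      by rewrite cmod_cexp cre_segment /ze /cre /= lnK.
    rewrite (_ : _ - _ = cexp (- w) * (f (c + cexp w) - f c - 'D_1 f c * cexp w)); last first.
      by rewrite /G cexpN; field; rewrite cexp_neq0.
    rewrite cmodM cexpN cmodV cw mulrC ler_pdivrMr//.
    by rewrite -cw; apply: H; rewrite cw; lra.
  rewrite per_eq; congr (cmod _ <= _).
  rewrite /S cexp_opp_per -(P_per ze); ring.
have : cmod (P per - P 0) <= 2 * M * cmod per.
  rewrite -[X in P X - _]add0r; apply: mvi => // t _.
  rewrite (derive_of (dP _)) /G; set w := 0 + _.
  have cw : cmod (cexp w) = 1 by rewrite cmod_cexp cre_segment /cre /= expR0.
  rewrite cmodM cexpN cmodV cw invr1 mulr1; apply: fM.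
  by rewrite addrC addKr.
rewrite main cmodM ler_pM2r// per_eq mulr_gt0// pi_gt0//.
Qed.

End CauchyEstimate.

End EntireFunctions.
Arguments entire_cst {R} a z.

(** * Regularity of derivatives and removable singularities *)

Section DerivativeOfEntire.
Variable R : realType.
Local Notation C := (Cplx R).
Implicit Types (f g : C -> C) (z w : C).

Lemma derive_bounded f (r : R) : entire f ->
  exists2 M, 0 <= M & forall z, cmod z <= r -> cmod ('D_1 f z) <= M.
Proof.
move=> ef; have [M M0 H] := entire_bounded (r + 1) ef.
exists (2 * M) => [|z zr]; first by rewrite mulr_ge0.
apply: cauchy_estimate => // w wz; apply: H.
by have := cmodD (w - z) z; rewrite subrK wz; lra.
Qed.

Lemma entire_lipschitz f (r : R) : entire f ->
  exists2 K, 0 <= K & forall z w, cmod z <= r -> cmod w <= r ->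
    cmod (f z - f w) <= K * cmod (z - w).
Proof.
move=> ef; have [M M0 H] := derive_bounded r ef.
exists (2 * M) => [|z w zr wr]; first by rewrite mulr_ge0.
have := @mvi R f w (z - w) M ef; rewrite subrKC; apply => t /andP[t0 t1].
apply: H; rewrite (_ : w + _ = ofR t * z + ofR (1 - t) * w); last by rewrite ofRB ofR1; ring.
apply: le_trans (cmodD _ _) _; rewrite !cmodM !cmod_ofR !ger0_norm ?subr_ge0//.
have := ler_wpM2l t0 zr; have := @ler_wpM2l _ (1 - t) _ _ _ wr; rewrite subr_ge0 => /(_ t1); lra.
Qed.

Lemma entire_shift f h : entire f -> entire (fun z => f (z + h)).
Proof.
move=> ef; apply: (entire_comp (g := fun z => z + h) ef).
exact: (is_derive_entire (is_derive_addr h)).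
Qed.

Arguments entire_shift [f] h.

Lemma derive_shift_entire f h z : entire f -> 'D_1 (fun w => f (w + h)) z = 'D_1 f (z + h).
Proof.
move=> ef; apply: derive_of.
by have := is_derive_compC (g := fun w => w + h) (entireP (z + h) ef) (is_derive_addr h z); rewrite mulr1.
Qed.

Lemma derive_subtr f g z : entire f -> entire g ->
  'D_1 (fun w => f w - g w) z = 'D_1 f z - 'D_1 g z.
Proof.
by move=> ef eg; apply: derive_of; exact: (is_deriveBC (entireP z ef) (entireP z eg)).
Qed.

(** Cauchy's estimate is applied to the difference f (w + h) - f w, which is O(h) by the Lipschitz
    bound for f. The unit circle and the shift by h explain the radius r + 2. *)
Lemma derive_lipschitz f (r : R) : entire f ->
  exists2 K, 0 <= K & forall z h, cmod z <= r -> cmod h <= 1 ->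
    cmod ('D_1 f (z + h) - 'D_1 f z) <= K * cmod h.
Proof.
move=> ef; have [K K0 H] := entire_lipschitz (r + 2) ef.
exists (2 * K) => [|z h zr h1]; first by rewrite mulr_ge0.
rewrite -(derive_shift_entire h z ef) -(derive_subtr z (entire_shift h ef) ef) -mulrA.
apply: cauchy_estimate; first exact: (entireB (entire_shift h ef) ef).
move=> w wz; have wr : cmod w <= r + 1.
  by have := cmodD (w - z) z; rewrite subrK wz; lra.
have := H (w + h) w; rewrite addrAC subrr add0r; apply; last lra.
by have := cmodD w h; lra.
Qed.

Lemma taylor1 f (r : R) : entire f ->
  exists2 K, 0 <= K & forall z h, cmod z <= r -> cmod h <= 1 ->
    cmod (f (z + h) - f z - 'D_1 f z * h) <= K * cmod h ^+ 2.
Proof.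
move=> ef; have [K K0 H] := derive_lipschitz r ef.
exists (2 * K) => [|z h zr h1]; first by rewrite mulr_ge0.
pose g w := f w - 'D_1 f z * w.
have dg w : is_derive w (1 : C) g ('D_1 f w - 'D_1 f z).
  exact: (is_deriveBC (entireP w ef) (is_derive_mull _ w)).
have := @mvi R g z h (K * cmod h) (is_derive_entire dg).
rewrite (_ : g (z + h) - g z = f (z + h) - f z - 'D_1 f z * h); last by rewrite /g; ring.
rewrite mulrA -mulrA -expr2; apply => t /andP[t0 t1]; rewrite (derive_of (dg _)).
have th : cmod (ofR t * h) <= cmod h.
  by rewrite cmodM cmod_ofR ger0_norm// ler_piMl// cmod_ge0.
by apply: le_trans (H _ _ zr (le_trans th h1)) _; rewrite ler_wpM2l.
Qed.

(** The difference quotients [q h] converge to f' uniformly near c, so Cauchy's estimate makes their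
    derivatives at c a Cauchy family as h tends to 0. Those derivatives are exactly the difference
    quotients of f' at c. *)
Lemma entire_derive f : entire f -> entire (fun z => 'D_1 f z).
Proof.
move=> ef c.
have [K K0 H] := taylor1 (cmod c + 1) ef.
pose q h w := h^-1 * (f (w + h) - f w).
have eq_ h : entire (q h).
  exact: (entireM (entire_cst h^-1) (entireB (entire_shift h ef) ef)).
have dq h : 'D_1 (q h) c = h^-1 * ('D_1 f (c + h) - 'D_1 f c).
  apply: derive_of; apply: is_deriveZC; rewrite -(derive_shift_entire h c ef).
  exact: (is_deriveBC (entireP c (entire_shift h ef)) (entireP c ef)).
have qf h w : h != 0 -> cmod h <= 1 -> cmod w <= cmod c + 1 ->
    cmod (q h w - 'D_1 f w) <= K * cmod h.
  move=> h0 h1 wr; have m0 : 0 < cmod h by rewrite cmod_gt0.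
  rewrite (_ : q h w - _ = h^-1 * (f (w + h) - f w - 'D_1 f w * h)); last first.
    by rewrite /q; field.
  rewrite cmodM cmodV mulrC ler_pdivrMr// -mulrA -expr2; exact: H.
have cq h k : h != 0 -> k != 0 -> cmod h <= 1 -> cmod k <= 1 ->
    cmod ('D_1 (q h) c - 'D_1 (q k) c) <= 2 * (K * (cmod h + cmod k)).
  move=> h0 k0 h1 k1; rewrite -(derive_subtr c (eq_ h) (eq_ k)).
  apply: cauchy_estimate; first exact: (entireB (eq_ h) (eq_ k)).
  move=> w wc; have wr : cmod w <= cmod c + 1.
    by have := cmodD (w - c) c; rewrite subrK wc; lra.
  have := qf h w h0 h1 wr; have := qf k w k0 k1 wr.
  have := cmodB (q h w - 'D_1 f w) (q k w - 'D_1 f w).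
  rewrite (_ : q h w - _ - _ = q h w - q k w); last by ring.
  lra.
have small (e : R) : 0 < e -> exists2 d : R, 0 < d & forall h k, h != 0 -> k != 0 ->
    cmod h < d -> cmod k < d -> cmod ('D_1 (q h) c - 'D_1 (q k) c) < e.
  move=> e0; have p0 : 0 < 4 * (K + 1) by lra.
  exists (Num.min 1 (e / (4 * (K + 1)))); first by rewrite lt_min ltr01 divr_gt0.
  move=> h k h0 k0; rewrite !lt_min => /andP[h1 he] /andP[k1 ke].
  apply: le_lt_trans (cq h k h0 k0 (ltW h1) (ltW k1)) _.
  move: he ke; rewrite !ltr_pdivlMr//; have := cmod_ge0 h; have := cmod_ge0 k.
  have : 0 < cmod h by rewrite cmod_gt0.
  nra.
(* Completeness is used in [R], with [phi] the real and then the imaginary part. *)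
have limit (phi : C -> R) : (forall z w, `|phi z - phi w| <= cmod (z - w)) ->
    exists l : R, phi ('D_1 (q h) c) @[h --> (0 : C)^'] --> l.
  move=> phiL; set F := (F in exists l : R, F --> l).
  suff HF : cauchy F by exact: ((cvg_ex F).1 (cauchy_cvg F HF)).
  apply: cauchy_exP => e e0.
  have [d d0 Hd] := small e e0.
  have dC : ofR (d / 2) != 0 :> C by rewrite -cmod_gt0 cmod_ofR gtr0_norm divr_gt0.
  exists (phi ('D_1 (q (ofR (d / 2))) c)).
  apply/nbhsCP; exists d => // h; rewrite subr0 => hd h0; rewrite /ball /=.
  apply: le_lt_trans (phiL _ _) _; apply: Hd => //.
  by rewrite cmod_ofR gtr0_norm ?divr_gt0//; lra.
have [l1 L1] := limit (@cre R) (fun z w => eq_ind _ (fun x => `|x| <= _) (cre_le _) _ (creB z w)).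
have [l2 L2] := limit (@cim R) (fun z w => eq_ind _ (fun x => `|x| <= _) (cim_le _) _ (cimB z w)).
have : (fun h : C => h^-1 *: ('D_1 f (h *: 1 + c) - 'D_1 f c)) @ (0 : C)^' --> mkC l1 l2.
  apply/cvgCP => e e0; have e20 : 0 < e / 2 by rewrite divr_gt0.
  move/cvgrPdist_lt : L1 => /(_ _ e20) L1; move/cvgrPdist_lt : L2 => /(_ _ e20) L2.
  apply: filterS2 L1 L2 => h h1 h2.
  have -> : h^-1 *: ('D_1 f (h *: 1 + c) - 'D_1 f c) = 'D_1 (q h) c.
    by rewrite dq scaler1 [h + c]addrC.
  apply: le_lt_trans (cmod_le _) _; rewrite creB cimB [cre (mkC _ _)]/= [cim (mkC _ _)]/=.
  by rewrite distrC [X in _ + X]distrC; lra.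
by move=> L; apply/cvg_ex; exists (mkC l1 l2).
Qed.

Lemma taylor2 f z : entire f -> forall e : R, 0 < e -> exists2 r : R, 0 < r &
  forall h, cmod h < r ->
    cmod (f (z + h) - f z - 'D_1 f z * h - 'D_1 ('D_1 f) z / 2 * h ^+ 2) <= e * cmod h ^+ 2.
Proof.
move=> ef e e0; have edf := entire_derive ef.
have e20 : 0 < e / 2 by rewrite divr_gt0.
have /is_deriveCP/(_ _ e20)[r r0 H] := entireP z edf.
exists r => // h hr; set D2 := 'D_1 ('D_1 f) z.
pose g w := f (z + w) - 'D_1 f z * w - D2 / 2 * w ^+ 2.
have dsq w : is_derive w (1 : C) (fun v => v ^+ 2) (2 * w).
  have := is_deriveMC (is_derive_mull 1 w) (is_derive_mull 1 w).
  rewrite (_ : (fun v => _) = fun v => v ^+ 2); last by apply/funext => v; rewrite !mul1r expr2.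
  by rewrite (_ : 1 * w * 1 + 1 * w * 1 = 2 * w); last by ring.
have dg w : is_derive w (1 : C) g ('D_1 f (z + w) - 'D_1 f z - D2 * w).
  have d1 : is_derive w (1 : C) (fun v => f (z + v)) ('D_1 f (z + w)).
    rewrite (_ : (fun v => _) = fun v => f (v + z)); last by apply/funext => v; rewrite addrC.
    by have := entireP w (entire_shift z ef); rewrite (derive_shift_entire z w ef) addrC.
  have := is_deriveBC (is_deriveBC d1 (is_derive_mull ('D_1 f z) w)) (is_deriveZC (D2 / 2) (dsq w)).
  by rewrite (_ : D2 / 2 * (2 * w) = D2 * w); last by field.
have := @mvi R g 0 h (e / 2 * cmod h) (is_derive_entire dg).
rewrite (_ : g (0 + h) - g 0 = f (z + h) - f z - 'D_1 f z * h - D2 / 2 * h ^+ 2); last first.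
  by rewrite /g add0r addr0; ring.
rewrite (_ : 2 * (e / 2 * cmod h) * cmod h = e * cmod h ^+ 2); last by field.
apply => t /andP[t0 t1]; rewrite (derive_of (dg _)) add0r.
have th : cmod (ofR t * h) <= cmod h.
  by rewrite cmodM cmod_ofR ger0_norm// ler_piMl// cmod_ge0.
by apply: le_trans (H _ (le_lt_trans th hr)) _; rewrite ler_pM2l.
Qed.

(** The quotient takes the value f'(a) at a, and the second-order expansion shows that it is
    differentiable there, with derivative f''(a) / 2. *)
Lemma entire_divide f a : entire f -> f a = 0 ->
  exists2 g, entire g & forall z, f z = (z - a) * g z.
Proof.
move=> ef fa.
pose g z := if z == a then 'D_1 f a else f z / (z - a).
exists g; last first.
  move=> z; rewrite /g; have [->|za] := eqVneq z a; first by rewrite fa subrr mul0r.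
  by rewrite mulrC divfK// subr_eq0.
move=> z; have [->|za] := eqVneq z a; last first.
  have za0 : z - a != 0 by rewrite subr_eq0.
  have [] // : is_derive z (1 : C) g ('D_1 (fun w => f w * (w - a)^-1) z).
  apply: near_eq_is_derive; last first.
    apply: derivableP; apply: derivableM; first exact: ef.
    apply: derivableV => //; exact: (entireB (@entire_id R) (entire_cst a)).
  apply/nbhsCP; exists (cmod (z - a)); first by rewrite cmod_gt0.
  move=> w wz; rewrite /g; have [wa|//] := eqVneq w a.
  by move: wz; rewrite wa cmodC ltxx.
have [] // : is_derive a (1 : C) g ('D_1 ('D_1 f) a / 2).
apply/is_deriveCP => e e0; have [r r0 H] := taylor2 a ef e0.
exists r => // h hr; have [->|h0] := eqVneq h 0.
  by rewrite addr0 mulr0 subr0 subrr cmod0 mulr0.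
have key (F D D2 : C) : cmod (F - D * h - D2 * h ^+ 2) <= e * cmod h ^+ 2 ->
    cmod (F / h - D - D2 * h) <= e * cmod h.
  have -> : F - D * h - D2 * h ^+ 2 = h * (F / h - D - D2 * h) by field.
  rewrite cmodM expr2 mulrA [X in _ <= X]mulrC.
  by rewrite ler_pM2l// cmod_gt0.
have := H h hr; rewrite /g eqxx fa subr0.
have -> : (a + h == a) = false by rewrite -subr_eq0 addrC addKr (negbTE h0).
have -> : a + h - a = h by rewrite addrC addKr.
exact: key.
Qed.

End DerivativeOfEntire.
Arguments entire_shift {R} [f] h.

(** * Jensen's inequality *)

Section Subharmonic.
Variable R : realType.
Local Notation C := (Cplx R).
Implicit Types (h : C -> C) (V : C -> R) (z k : C).

Definition sum4 V z k : R :=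
  V (z + k) + V (z + ci R * k) + V (z - k) + V (z - ci R * k).

(* Infinitesimal form of subharmonicity: the second derivatives along k and
   i k add up to a Laplacian, and this condition is closed under sums and
   holds for truncated logarithms of entire functions. *)
Definition sub4 V := forall z (e : R), 0 < e -> exists2 r : R, 0 < r &
  forall k, cmod k < r -> 4 * V z - e * cmod k ^+ 2 <= sum4 V z k.

Lemma sub4D V W : sub4 V -> sub4 W -> sub4 (fun z => V z + W z).
Proof.
move=> sV sW z e e0; have e20 : 0 < e / 2 by lra.
have [r r0 H] := sV z _ e20; have [r' r'0 H'] := sW z _ e20.
exists (Num.min r r'); first by rewrite lt_min r0.
move=> k; rewrite lt_min => /andP[/H + /H']; rewrite /sum4; lra.
Qed.

Lemma sub4_sum N (V : nat -> C -> R) : (forall j, sub4 (V j)) ->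
  sub4 (fun z => \sum_(j < N) V j z).
Proof.
move=> sV; elim: N => [|N IH].
  rewrite (_ : (fun z => _) = fun=> 0); last by apply/funext => z; rewrite big_ord0.
  move=> z e e0; exists 1 => // k _; rewrite /sum4.
  by have := mulr_ge0 (ltW e0) (sqr_ge0 (cmod k)); lra.
rewrite (_ : (fun z => _) = fun z => \sum_(j < N) V j z + V N z); first exact: sub4D.
by apply/funext => z; rewrite big_ord_recr.
Qed.

Lemma sum4_cmod_sqr z k :
  sum4 (fun w => cmod w ^+ 2) z k = 4 * cmod z ^+ 2 + 4 * cmod k ^+ 2.
Proof.
rewrite /sum4 !cmod_sqr !creB !cimB !creD !cimD !creM !cimM.
have -> : cre (ci R) = 0 by []. have -> : cim (ci R) = 1 by [].
ring.
Qed.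

(** Maximum principle. If V 0 exceeded the values on the circle, V + e |z|^2 would have an interior
    maximum for small e. Over the four points the quadratic term gains 4 e |k|^2, while [sub4] loses
    only e |k|^2. *)
Lemma sub4_le_circle V : continuous V -> sub4 V ->
  exists2 z, cmod z = 1 & V 0 <= V z.
Proof.
move=> cV sV.
have [z1 z1c z1max] : exists2 z1, cmod z1 = 1 & forall w, cmod w = 1 -> V w <= V z1.
  have [] := @compact_EVT_max C R V [set z : C | cmod z = 1].
  - by exists (1 : C); change (cmod (1 : C) = 1); rewrite cmod1.
  - apply: subclosed_compact (@compact_disc R 1) _; last by move=> z /= ->.
    apply: (@closed_comp _ _ (@cmod R) [set x | x = 1]) => [z _|]; first exact: continuous_cmod.
    exact: closed_eq.
  - exact: continuous_subspaceT.
  by move=> z; rewrite inE /= => zc H; exists z => // w wc; apply: H; rewrite inE.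
have [?|V0] := leP (V 0) (V z1); first by exists z1.
(* Half of the gap: adding e |z|^2 still leaves the circle strictly below the centre. *)
exfalso; pose e := (V 0 - V z1) / 2; have e0 : 0 < e by rewrite divr_gt0// subr_gt0.
pose W z := V z + e * cmod z ^+ 2.
have cW : continuous W.
  rewrite (_ : W = fun z => V z + e * (cmod z * cmod z)); last first.
    by apply/funext => z; rewrite /W expr2.
  move=> z; have cz := @continuous_cmod R z.
  exact: (cvgD (cV z) (cvgM (cvg_cst e) (cvgM cz cz))).
have [zm zm1 zmax] := continuous_disc_max ler01 cW.
have W0 : W 0 <= W zm by apply: zmax; rewrite cmod0.
rewrite {1}/W cmod0 expr0n mulr0 addr0 in W0.
have zlt : cmod zm < 1.
  rewrite lt_neqAle zm1 andbT; apply/negP => /eqP zE.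
  by move: W0; rewrite /W zE expr1n mulr1; have := z1max _ zE; rewrite /e; lra.
have [r r0 H] := sV zm e e0.
pose d := Num.min (r / 2) ((1 - cmod zm) / 2).
have d0 : 0 < d by rewrite lt_min !divr_gt0// subr_gt0.
have [dr d1] : d <= r / 2 /\ d <= (1 - cmod zm) / 2 by rewrite !ge_min !lexx orbT.
pose k : C := ofR d; have kE : cmod k = d by rewrite cmod_ofR gtr0_norm.
have := H k; rewrite kE => /(_ _); have -> : d < r by lra.
move=> /(_ isT) H4.
have : sum4 W zm k <= 4 * W zm.
  have ik : cmod (ci R * k) = d by rewrite cmodM cmod_ci mul1r.
  have h1 : W (zm + k) <= W zm by apply: zmax; have := cmodD zm k; lra.
  have h2 : W (zm + ci R * k) <= W zm by apply: zmax; have := cmodD zm (ci R * k); lra.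
  have h3 : W (zm - k) <= W zm by apply: zmax; have := cmodB zm k; lra.
  have h4 : W (zm - ci R * k) <= W zm by apply: zmax; have := cmodB zm (ci R * k); lra.
  by rewrite /sum4; lra.
rewrite /W (_ : sum4 _ zm k = sum4 V zm k + e * sum4 (fun w => cmod w ^+ 2) zm k); last first.
  by rewrite /sum4; ring.
rewrite sum4_cmod_sqr kE; have := mulr_gt0 e0 (exprn_gt0 2 d0); lra.
Qed.

(** As a function of k, the product is invariant under k -> i k. Its first and second derivatives at
    0 are therefore fixed under multiplication by i and by -1, so both vanish, and the second-order
    expansion leaves o(|k|^2). *)
Lemma four_point h z : entire h -> forall e : R, 0 < e -> exists2 r : R, 0 < r &
  forall k, cmod k < r ->
    cmod (h (z + k) * h (z + ci R * k) * (h (z - k) * h (z - ci R * k)) - h z ^+ 4) <=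
    e * cmod k ^+ 2.
Proof.
move=> eh e e0.
pose g k := h (z + k) * h (z + ci R * k) * (h (z - k) * h (z - ci R * k)).
have el (a : C) : entire (fun k => h (z + a * k)).
  apply: (entire_comp (g := fun k => z + a * k) eh).
  exact: (is_derive_entire (fun w => is_deriveDC (entireP w (entire_cst z)) (is_derive_mull a w))).
have eg : entire g.
  rewrite (_ : g = fun k => h (z + 1 * k) * h (z + ci R * k) *
     (h (z + (-1) * k) * h (z + (- ci R) * k))).
    exact: (entireM (entireM (el 1) (el _)) (entireM (el _) (el _))).
  by apply/funext => k; rewrite /g mul1r mulN1r mulNr.
have gi k : g (ci R * k) = g k.
  rewrite /g !mulrA ci2 !mulN1r opprK; ring.
have dgi k : 'D_1 g (ci R * k) * ci R = 'D_1 g k.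
  have := is_derive_compC (g := fun w => ci R * w) (entireP (ci R * k) eg) (is_derive_mull (ci R) k).
  rewrite (_ : _ \o _ = g); last by apply/funext => w; rewrite /= gi.
  by move/derive_of.
have edg := entire_derive eg.
have ddgi k : 'D_1 ('D_1 g) (ci R * k) * ci R * ci R = 'D_1 ('D_1 g) k.
  have := is_deriveZC (ci R) (is_derive_compC (g := fun w => ci R * w) (entireP (ci R * k) edg) (is_derive_mull (ci R) k)).
  rewrite (_ : (fun w => _) = 'D_1 g); last by apply/funext => w; rewrite /= mulrC dgi.
  by move/derive_of => ->; rewrite mulrC.
have ci1 : 1 - ci R != 0.
  by rewrite subr_eq0; apply/eqP => /(congr1 (@cim R)) /eqP; rewrite /= eq_sym oner_eq0.
have d1 : 'D_1 g 0 = 0.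
  have := dgi 0; rewrite mulr0 => E; apply: (mulIf ci1).
  by rewrite mul0r mulrBr mulr1 E subrr.
have d2 : 'D_1 ('D_1 g) 0 = 0.
  have := ddgi 0; rewrite mulr0 -mulrA ci2 mulrN1 => /eqP; rewrite eq_sym -subr_eq0 opprK.
  rewrite -mulr2n mulrn_eq0 /= => /eqP; exact.
have [r r0 H] := taylor2 0 eg e0.
exists r => // k kr; have := H k kr; rewrite add0r d1 d2 !mul0r !subr0.
rewrite (_ : g 0 = h z ^+ 4)//.
by rewrite /g mulr0 !addr0 !subr0; ring.
Qed.

Lemma ln1B_ge (x : R) : 0 <= x <= 1 / 2 -> - (2 * x) <= ln (1 - x).
Proof.
move=> /andP[x0 x1]; have p : 0 < 1 - x by lra.
rewrite -[1 - x]invrK lnV ?posrE ?invr_gt0// lerN2.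
have := @le_ln1Dx R (x / (1 - x)); rewrite (_ : 1 + x / (1 - x) = (1 - x)^-1); last first.
  by field; rewrite gt_eqF.
have q : 0 <= x / (1 - x) by rewrite divr_ge0// ltW.
move=> H; apply: le_trans (H _) _; first by lra.
by rewrite ler_pdivrMr//; nra.
Qed.

(** For d > 0 the truncation keeps log |h| finite and continuous across the zeros of h. *)
Definition lnmax (d : R) h z := ln (Num.max (cmod (h z)) d).

(** Where |h| <= d the function is at its minimum. Elsewhere the sum over the four points is at
    least the logarithm of the modulus of their product, which [four_point] compares with |h
    z|^4. *)
Lemma lnmax_sub4 d h : 0 < d -> entire h -> sub4 (lnmax d h).
Proof.
move=> d0 eh z e e0.
have mpos w : 0 < Num.max (cmod (h w)) d by rewrite lt_max d0 orbT.
have [hd|hd] := leP (cmod (h z)) d.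
  exists 1 => // k _.
  have ge w : ln d <= lnmax d h w.
    by rewrite /lnmax ler_ln ?posrE// le_max lexx orbT.
  rewrite /sum4 {1}/lnmax (max_idPr hd).
  have := ge (z + k); have := ge (z - k); have := ge (z + ci R * k); have := ge (z - ci R * k).
  by have := mulr_ge0 (ltW e0) (sqr_ge0 (cmod k)); lra.
pose m := cmod (h z); have m0 : 0 < m by apply: lt_trans d0 hd.
have m40 : 0 < m ^+ 4 by rewrite exprn_gt0.
(* With this tolerance the product has modulus at least m^4 (1 - x), where x = e |k|^2 / 2, and ln
   (1 - x) >= - 2 x gives exactly the allowed loss; |k| < 1 and |k| < 1 / e ensure x <= 1 / 2. *)
have e'0 : 0 < e * m ^+ 4 / 2 by rewrite divr_gt0// mulr_gt0.
have [r r0 H] := four_point z eh e'0.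
exists (Num.min r (Num.min 1 e^-1)); first by rewrite !lt_min r0 ltr01 invr_gt0.
move=> k; rewrite !lt_min => /and3P[kr k1 ke].
have {H} := H k kr; set g := _ * _; rewrite -/m => Hg.
pose x := e * cmod k ^+ 2 / 2.
have kk := cmod_ge0 k.
have x01 : 0 <= x <= 1 / 2.
  apply/andP; split; rewrite /x; first by have := mulr_ge0 (ltW e0) (sqr_ge0 (cmod k)); lra.
  have : cmod k * e < 1 by rewrite -ltr_pdivlMr// div1r.
  by rewrite expr2; nra.
have gm : m ^+ 4 * (1 - x) <= cmod g.
  have := cmodBD (h z ^+ 4) g; rewrite [cmod (h z ^+ 4)]cmodX -/m [cmod (_ - g)]cmodC.
  by rewrite /x; lra.
rewrite {1}/lnmax (max_idPl (ltW hd)) -/m.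
have -> : sum4 (lnmax d h) z k = ln (Num.max (cmod (h (z + k))) d *
    Num.max (cmod (h (z + ci R * k))) d * (Num.max (cmod (h (z - k))) d *
    Num.max (cmod (h (z - ci R * k))) d)).
  by rewrite !lnM ?posrE ?mulr_gt0// /sum4 /lnmax !addrA.
have : ln (m ^+ 4 * (1 - x)) <= ln (Num.max (cmod (h (z + k))) d *
    Num.max (cmod (h (z + ci R * k))) d * (Num.max (cmod (h (z - k))) d *
    Num.max (cmod (h (z - ci R * k))) d)).
  rewrite ler_ln ?posrE ?mulr_gt0//; last lra.
  apply: le_trans gm _; rewrite /g !cmodM.
  by rewrite !ler_pM ?mulr_ge0 ?cmod_ge0 ?le_max ?lexx.
apply: le_trans; rewrite lnM ?posrE//; last lra.
have -> : ln (m ^+ 4) = 4 * ln m by rewrite lnXn// mulr_natl.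
rewrite lerD2l.
apply: le_trans (ln1B_ge x01); rewrite /x; lra.
Qed.

End Subharmonic.

(** * From the four-point inequality to the integral inequality *)

Section Jensen.
Variable R : realType.
Local Notation C := (Cplx R).
Implicit Types (h : C -> C) (z k : C).

Lemma unit_circleE (t : R) : unit_circle t = cexp (ofR t * ci R).
Proof. by rewrite /cexp creM cimM /cre /cim /= !(mulr0, mul0r, mulr1, subr0, addr0) expR0 !mul1r. Qed.

Lemma unit_circleD (s t : R) : unit_circle (s + t) = unit_circle s * unit_circle t :> C.
Proof. by rewrite !unit_circleE ofRD mulrDl cexpD. Qed.

Lemma cmod_unit_circle (t : R) : cmod (unit_circle t) = 1.
Proof. by rewrite unit_circleE cmod_cexp creM /cre /cim /= mulr0 mul0r subrr expR0. Qed.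

Lemma unit_circle_2pi : unit_circle (2 * pi) = 1 :> C.
Proof. by rewrite unit_circleE -[_ * _]mul1r -[1]/(1%:~R) cexp_2pi. Qed.

Lemma unit_circle_surj z : cmod z = 1 -> exists t, z = unit_circle t.
Proof.
move=> z1; have [|w wz] := @cexp_surj R z; first by rewrite -cmod_gt0 z1.
exists (cim w); rewrite -wz unit_circleE {1}(creimE w) (_ : cre w = 0) ?add0r ?[_ * ci R]mulrC//.
by apply: expR_inj; rewrite -cmod_cexp wz expR0.
Qed.

Lemma rder_unit_circle (t : R) : rder (fun s => unit_circle s) t (unit_circle t * ci R).
Proof.
rewrite (_ : (fun s => _) = fun s => cexp (0 + ofR s * ci R)); last first.
  by apply/funext => s; rewrite add0r unit_circleE.
apply: rder_line; rewrite add0r unit_circleE; exact: is_derive_cexp.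
Qed.

Lemma unit_circle_lipschitz (s t : R) : cmod (unit_circle s - unit_circle t) <= 2 * `|s - t|.
Proof.
have := @rder_mvi R (fun s => unit_circle s) _ t s 1 (fun x _ => rder_unit_circle x).
by rewrite mulr1; apply => x _; rewrite cmodM cmod_unit_circle cmod_ci mulr1.
Qed.

Lemma ln_max_lipschitz (d a b : R) : 0 < d ->
  `|ln (Num.max a d) - ln (Num.max b d)| <= `|a - b| / d.
Proof.
move=> d0.
wlog ab : a b / b <= a.
  by move=> H; have [/H//|/ltW/H] := leP b a; rewrite distrC [X in _ <= X / _]distrC.
have pa : 0 < Num.max a d by rewrite lt_max d0 orbT.
have pb : 0 < Num.max b d by rewrite lt_max d0 orbT.
have mm : Num.max b d <= Num.max a d.
  by case: (leP a d) => ?; case: (leP b d) => ?; lra.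
rewrite ger0_norm ?subr_ge0 ?ler_ln ?posrE// -ln_div ?posrE//.
have q : Num.max a d / Num.max b d = 1 + (Num.max a d / Num.max b d - 1) by ring.
rewrite q; apply: le_trans (le_ln1Dx _) _; first by have := divr_gt0 pa pb; lra.
rewrite ger0_norm ?subr_ge0// -[X in _ - X](mulfV (lt0r_neq0 pb)) -mulrBl.
apply: ler_pM.
- by rewrite subr_ge0.
- by rewrite invr_ge0 ltW.
- by case: (leP a d) => ?; case: (leP b d) => ?; lra.
- by rewrite lef_pV2 ?posrE// le_max lexx orbT.
Qed.

Lemma cmod_dist z w : `|cmod z - cmod w| <= cmod (z - w).
Proof.
rewrite ler_norml; have := cmodBD z w; have := cmodBD w z.
by rewrite [cmod (w - z)]cmodC; lra.
Qed.

Lemma lnmax_continuous d h : 0 < d -> entire h -> continuous (lnmax d h).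
Proof.
move=> d0 eh z; apply: (iffRL (@cvgrPdist_lt _ _ _ (nbhs z) (nbhs_filter z) _ _)) => e e0.
have ed : 0 < e * d by rewrite mulr_gt0.
have /cvgCP/(_ _ ed)/nbhsCP[r r0 H] := @entire_continuous R h eh z.
apply/nbhsCP; exists r => // w /H wz.
apply: le_lt_trans (ln_max_lipschitz _ _ d0) _.
by rewrite ltr_pdivrMr//; apply: le_lt_trans (cmod_dist _ _) _; rewrite cmodC.
Qed.

Lemma continuous_sum N (V : nat -> C -> R) : (forall j, continuous (V j)) ->
  continuous (fun z => \sum_(j < N) V j z).
Proof.
move=> cV; elim: N => [|N IH].
  have -> : (fun z => \sum_(j < 0) V j z) = (fun=> 0) :> (C -> R).
    by apply/funext => w; rewrite big_ord0.
  by move=> z; exact: (@cvg_cst _ _ _ (nbhs z) (nbhs_filter z)).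
have -> : (fun z => \sum_(j < N.+1) V j z) = (fun z => \sum_(j < N) V j z + V N z).
  by apply/funext => w; rewrite big_ord_recr.
by move=> z; exact: (cvgD (IH z) (cV N z)).
Qed.

Lemma lnmax_circle_lipschitz d h : 0 < d -> entire h ->
  exists2 L, 0 <= L & forall s t,
    `|lnmax d h (unit_circle s) - lnmax d h (unit_circle t)| <= L * `|s - t|.
Proof.
move=> d0 eh; have [K K0 H] := entire_lipschitz 1 eh.
exists (K * 2 / d) => [|s t]; first by rewrite divr_ge0 ?mulr_ge0// ltW.
apply: le_trans (ln_max_lipschitz _ _ d0) _.
rewrite mulrAC ler_pM2r ?invr_gt0//.
apply: (@le_trans _ _ (cmod (h (unit_circle s) - h (unit_circle t)))).
  exact: cmod_dist.
apply: le_trans (H _ _ _ _) _; rewrite ?cmod_unit_circle//.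
by rewrite -mulrA ler_wpM2l// unit_circle_lipschitz.
Qed.

Lemma lipschitz_continuous (g : R -> R) L : 0 <= L ->
  (forall s t, `|g s - g t| <= L * `|s - t|) -> continuous g.
Proof.
move=> L0 H t; apply/cvgrPdist_lt => e e0; have L10 : 0 < L + 1 by lra.
have eL : 0 < e / (L + 1) by rewrite divr_gt0.
apply: (filterS _ (nbhsx_ballx t _ eL)) => s; rewrite /ball /= => ts.
apply: le_lt_trans (H _ _) _.
by move: ts; rewrite ltr_pdivlMr// => ?; have := normr_ge0 (t - s); nra.
Qed.

(* V(0) <= max over the circle, applied to the average of V over the rotations
   by N-th roots of unity, compares V(0) with a Riemann sum. *)
Lemma jensen_antiderivative d h (G : R -> R) : 0 < d -> entire h ->
  (forall t, is_derive t (1 : R) G (lnmax d h (unit_circle t))) ->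
  2 * pi * lnmax d h 0 <= G (2 * pi) - G 0.
Proof.
move=> d0 eh dG; have [L L0 HL] := lnmax_circle_lipschitz d0 eh.
pose g t := lnmax d h (unit_circle t); pose P := 2 * pi : R.
have P0 : 0 < P by rewrite mulr_gt0// pi_gt0.
have gP t : g (t + P) = g t by rewrite /g unit_circleD unit_circle_2pi mulr1.
have GP t : G (t + P) - G t = G P - G 0.
  have dGP s : is_derive s (1 : R) (fun s => G (s + P)) (g s).
    apply: is_deriveRP => e e0; have [r r0 H] := is_deriveR_bound (dG (s + P)) e0.
    by exists r => // k /H; rewrite -/(g (s + P)) gP [s + k + P]addrAC.
  have dd s : is_derive s (1 : R) (fun s => G (s + P) - G s) 0.
    by rewrite -(subrr (g s)); exact: (is_deriveB (dGP s) (dG s)).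
  have H : `|(G (t + P) - G t) - (G (0 + P) - G 0)| <= 0 * `|t - 0|.
    apply: (@mvi_real R (fun s => G (s + P) - G s) (fun=> 0) 0 t 0 (fun s _ => dd s)) => s _.
    by rewrite normr0.
  by move: H; rewrite mul0r add0r normr_le0 subr_eq0 => /eqP.
have main N : P * lnmax d h 0 <= G P - G 0 + L * P ^+ 2 / N.+1%:R.
  have n0 : 0 < N.+1%:R :> R by rewrite ltr0n.
  pose D := P / N.+1%:R; have D0 : 0 < D by rewrite divr_gt0.
  have ND : N.+1%:R * D = P by rewrite /D mulrC divfK// gt_eqF.
  have eV j : entire (fun z => h (unit_circle (j%:R * D) * z)).
    exact: (entire_comp (g := fun z => unit_circle (j%:R * D) * z) eh (is_derive_entire (is_derive_mull _))).
  have sV := @sub4_sum R N.+1 _ (fun j => lnmax_sub4 d0 (eV j)).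
  have cV := @continuous_sum N.+1 _ (fun j => @lnmax_continuous d _ d0 (eV j)).
  have [z zc] := sub4_le_circle cV sV.
  have [t ->] := unit_circle_surj zc.
  have -> : \sum_(j < N.+1) lnmax d (fun z => h (unit_circle (j%:R * D) * z)) 0 =
      N.+1%:R * lnmax d h 0.
    rewrite (eq_bigr (fun=> lnmax d h 0)); last by move=> j _; rewrite /lnmax mulr0.
    by rewrite sumr_const card_ord mulr_natl.
  have -> : \sum_(j < N.+1) lnmax d (fun z => h (unit_circle (j%:R * D) * z)) (unit_circle t) =
      \sum_(j < N.+1) g (t + j%:R * D).
    by apply: eq_bigr => j _; rewrite /lnmax -unit_circleD addrC.
  (* Error of one rectangle: on an interval of length D, g varies by at most L D. *)
  have step j : g (t + j%:R * D) * D <= G (t + j.+1%:R * D) - G (t + j%:R * D) + L * D ^+ 2.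
    set a := t + j%:R * D.
    have aD : t + j.+1%:R * D - a = D by rewrite /a -natr1; ring.
    have dg s : is_derive s (1 : R) (fun s => G s - g a * s) (g s - g a).
      have H := is_deriveZ (f := id) (g a) (is_derive_id s (1 : R)).
      have := is_deriveB (dG s) H; rewrite -[g a *: 1]/(g a * 1) mulr1; exact.
    have := @mvi_real R (fun s => G s - g a * s) _ a (t + j.+1%:R * D) (L * D) (fun s _ => dg s).
    rewrite aD [`|D|]gtr0_norm// => H.
    have {}H : `|G (t + j.+1%:R * D) - g a * (t + j.+1%:R * D) - (G a - g a * a)| <= L * D * D.
      apply: H => s /btw_dist; rewrite aD [`|D|]gtr0_norm// => sa.
      by apply: le_trans (HL _ _) _; rewrite ler_wpM2l.
    have := ler_norm (- (G (t + j.+1%:R * D) - g a * (t + j.+1%:R * D) - (G a - g a * a))).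
    rewrite normrN expr2; have : g a * (t + j.+1%:R * D) = g a * a + g a * D.
      by rewrite -[in RHS]aD; ring.
    lra.
  have tele M : (\sum_(j < M) g (t + j%:R * D)) * D <= G (t + M%:R * D) - G t + M%:R * (L * D ^+ 2).
    elim: M => [|M IH]; first by rewrite big_ord0 !mul0r !addr0 subrr.
    rewrite big_ord_recr /= mulrDl; have := step M; rewrite -[in M.+1%:R * (L * _)]natr1; lra.
  have := tele N.+1; rewrite ND GP => T.
  move=> Hs; have := ler_wpM2r (ltW D0) Hs; rewrite mulrAC ND => Hs2.
  apply: le_trans Hs2 (le_trans T _); rewrite lerD2l le_eqVlt; apply/orP; left; apply/eqP.
  by rewrite -ND; field; rewrite addrC natr1 gt_eqF.
apply/ler_addgt0Pr => e e0.
have [N hN] : exists N : nat, L * P ^+ 2 / N.+1%:R <= e.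
  exists (Num.bound (L * P ^+ 2 / e)).
  have q0 : 0 <= L * P ^+ 2 / e by rewrite divr_ge0 ?(ltW e0)// mulr_ge0// sqr_ge0.
  rewrite ler_pdivrMr ?ltr0n// [e * _]mulrC -ler_pdivrMr//.
  by apply: le_trans (ltW (archi_boundP q0)) _; rewrite ler_nat.
by apply: le_trans (main N) _; rewrite lerD2l.
Qed.

Definition logmod z : \bar R := if z == 0 then -oo%E else (ln (cmod z))%:E.

Local Notation mu := (@lebesgue_measure R).

Lemma integral_circle_const (M : R) :
  (\int[mu]_(t in `[0%R, (2 * pi)%R]) M%:E = (2 * pi * M)%:E)%E.
Proof.
rewrite integral_cst//= lebesgue_measure_itv/= lte_fin mulr_gt0 ?pi_gt0//.
by rewrite sube0 -EFinM mulrC.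
Qed.

Lemma jensen_lnmax d h : 0 < d -> entire h ->
  ((2 * pi * lnmax d h 0)%:E <=
   \int[mu]_(t in `[0%R, (2 * pi)%R]) (lnmax d h (unit_circle t))%:E)%E.
Proof.
move=> d0 eh; have P0 : 0 < 2 * pi :> R by rewrite mulr_gt0// pi_gt0.
have [L L0 HL] := lnmax_circle_lipschitz d0 eh.
have cg : continuous (fun t : R => lnmax d h (unit_circle t)) := lipschitz_continuous L0 HL.
have [G dG] := continuous_antiderivative cg.
have cG : continuous G.
  by move=> t; apply/differentiable_continuous/derivable1_diffP; have [] := dG t.
rewrite (@continuous_FTC2 R _ G 0 (2 * pi) P0).
- by rewrite -EFinB lee_fin; exact: jensen_antiderivative.
- exact: continuous_subspaceT.
- split; first by move=> t _; have [] := dG t.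
  + by apply: cvg_at_right_filter; exact: cG.
  + by apply: cvg_at_left_filter; exact: cG.
- by move=> t _; rewrite derive1E; apply: derive_val.
Qed.

Lemma cvg_lnmax h z :
  (lnmax n.+1%:R^-1 h z)%:E @[n --> \oo] --> logmod (h z).
Proof.
rewrite /logmod; have [hz|hz] := eqVneq (h z) 0.
  apply/cvgeNyPle => A.
  exists (Num.bound (expR (- A))) => // n /= nA.
  rewrite lee_fin /lnmax hz cmod0 max_r ?invr_ge0// lnV ?posrE ?ltr0n//.
  rewrite lerNl -(expRK (- A)) ler_ln ?posrE ?expR_gt0 ?ltr0n//.
  apply/ltW/(lt_le_trans (archi_boundP (expR_ge0 _))).
  by rewrite ler_nat (leq_trans nA).
apply: cvg_near_cst; exists (Num.bound (cmod (h z))^-1) => // n /= nA.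
rewrite /lnmax max_l// invf_ple ?posrE ?ltr0n ?cmod_gt0//.
apply/ltW/(lt_le_trans (archi_boundP _)); first by rewrite invr_ge0 cmod_ge0.
by rewrite ler_nat (leq_trans nA).
Qed.

(** Below a common bound M, the functions M - log max(|h|, 1 / (n + 1)) are nonnegative and increase
    to M - log |h|, so monotone convergence carries the truncated inequality to the limit. The
    resulting finite bound also gives integrability, even with zeros on the circle. *)
Lemma jensen h : entire h ->
  (logmod (h 0%R) <= (2 * pi)^-1%:E *
    \int[mu]_(t in `[0%R, (2 * pi)%R]) logmod (h (unit_circle t)))%E.
Proof.
move=> eh; rewrite {1}/logmod; have [_|h0] := eqVneq (h 0) 0; first exact: leNye.
have P0 : 0 < 2 * pi :> R by rewrite mulr_gt0// pi_gt0.
rewrite -lee_pdivrMl ?invr_gt0// invrK -EFinM.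
have [M0 M00 HM0] := entire_bounded 1 eh.
(* The maximum with 1 makes [M] dominate the truncation levels [d n] as well. *)
pose M := ln (Num.max M0 1).
pose d n : R := n.+1%:R^-1.
have d0 n : 0 < d n by rewrite invr_gt0 ltr0n.
have d1 n : d n <= 1 by rewrite invf_le1 ?ltr0n// ler1n.
pose v n (t : measurableTypeR R) := lnmax (d n) h (unit_circle t).
have vM n t : v n t <= M.
  rewrite ler_ln ?posrE ?lt_max ?d0 ?ltr01 ?orbT//.
  rewrite ge_max !le_max d1 orbT andbT HM0// cmod_unit_circle//.
pose D : set (measurableTypeR R) := `[0%R, 2 * pi : R]%classic.
have mD : measurable D by exact: measurable_itv.
have mv n : measurable_fun D (EFin \o v n).
  apply/measurable_EFinP; apply: measurable_funTS; apply: continuous_measurable_fun.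
  have [L L0 HL] := lnmax_circle_lipschitz (d0 n) eh; exact: lipschitz_continuous HL.
pose f (n : nat) (t : measurableTypeR R) : \bar R := (M%:E - (v n t)%:E)%E.
pose F (t : measurableTypeR R) : \bar R := (M%:E - logmod (h (unit_circle t)))%E.
have mf n : measurable_fun D (f n) := emeasurable_funB (measurable_cst M%:E) (mv n).
have f0 n t : D t -> (0 <= f n t)%E by move=> _; rewrite /f -EFinB lee_fin subr_ge0.
have ndf t : D t -> nondecreasing_seq (f ^~ t).
  move=> _ n m nm; rewrite /f -!EFinB lee_fin lerD2l lerN2.
  rewrite ler_ln ?posrE ?lt_max ?d0 ?orbT//.
  have dd : d m <= d n by rewrite lef_pV2 ?posrE ?ltr0n// ler_nat.
  by rewrite ge_max !le_max lexx /= dd orbT.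
have fF t : f ^~ t @ \oo --> F t.
  apply: cvgeB; last exact: cvg_lnmax.
  - by [].
  - exact: cvg_cst.
have cv := @cvg_monotone_convergence _ _ _ mu D mD f mf f0 ndf.
have EF : (\int[mu]_(t in D) F t = \int[mu]_(t in D) limn (f ^~ t))%E.
  by apply: eq_integral => t _; rewrite (cvg_lim _ (fF t)).
rewrite -EF in cv.
pose B := (2 * pi * M - 2 * pi * ln (cmod (h 0)))%:E.
have fB n : (\int[mu]_(t in D) f n t <= B)%E.
  have iv : mu.-integrable D (EFin \o v n).
    apply: continuous_compact_integrable; first exact: segment_compact.
    apply: continuous_subspaceT.
    have [L L0 HL] := lnmax_circle_lipschitz (d0 n) eh; exact: lipschitz_continuous HL.
  have iM : mu.-integrable D (EFin \o (fun=> M)).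
    apply: continuous_compact_integrable; first exact: segment_compact.
    by apply: continuous_subspaceT => t; exact: cvg_cst.
  rewrite /f (integralB_EFin mD iM iv) integral_circle_const /B EFinB.
  apply: leeB => //; apply: le_trans (jensen_lnmax (d0 n) eh).
  rewrite lee_fin ler_pM2l// /lnmax ler_ln ?posrE ?lt_max ?cmod_gt0 ?h0//.
  by rewrite le_max lexx.
have FB : (\int[mu]_(t in D) F t <= B)%E.
  rewrite -(cvg_lim _ cv)//; apply: lime_le; first by apply/cvg_ex; eexists; exact: cv.
  by apply: nearW => n; exact: fB.
have F0 t : D t -> (0 <= F t)%E.
  move=> Dt; rewrite -(cvg_lim _ (fF t))//; apply: lime_ge.
    by apply/cvg_ex; eexists; exact: fF.
  by apply: nearW => n; exact: f0.
have mF : measurable_fun D F by apply: (emeasurable_fun_cvg f) => // t _; exact: fF.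
have iF : mu.-integrable D F.
  apply/integrableP; split => //.
  apply: (@le_lt_trans _ _ B); last exact: ltry.
  rewrite (eq_integral F)// => t; rewrite inE => Dt; rewrite gee0_abs// F0//.
have iM : mu.-integrable D (EFin \o cst M).
  apply: continuous_compact_integrable; first exact: segment_compact.
  by apply: continuous_subspaceT => t; exact: cvg_cst.
have -> : (\int[mu]_(t in D) logmod (h (unit_circle t)) =
    \int[mu]_(t in D) ((EFin \o cst M) \- F) t)%E.
  apply: eq_integral => t _; rewrite /F /=.
  by case: (logmod _) => [r| |]//=; rewrite -?EFinB; congr (_%:E); ring.
rewrite (integralB mD iM iF) integral_circle_const.
apply: (@le_trans _ _ ((2 * pi * M)%:E - B)%E).
  by rewrite /B -EFinB lee_fin; lra.
exact: leeB.
Qed.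
End Jensen.

(** * Holomorphic functions of two variables *)

Section CalculusC2.
Variable R : realType.
Local Notation C := (Cplx R).
Local Notation C2 := (Cplx2 R).

Lemma is_derive_is_diff (W : normedModType C) (f : C -> W) (t : C) (v : W) :
  is_derive t (1 : C) f v <-> is_diff t f (fun h => h *: v).
Proof.
split.
  move=> [df dv]; have Df : differentiable f t := (derivable1_diffP f t).1 df.
  apply: DiffDef => //.
  by rewrite (deriv1E df) derive1E dv.
move=> [Df dv]; have df : derivable f t 1 := (derivable1_diffP f t).2 Df.
split => //; have E : 'D_1 f t = 'd f t 1 := deriveE (1 : C) Df.
by rewrite E dv scale1r.
Qed.

Lemma is_derive_chain (V W : normedModType C) (F : V -> W) (phi : C -> V) (t : C) (v : V) :
  differentiable F (phi t) -> is_derive t (1 : C) phi v ->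
  is_derive t (1 : C) (F \o phi) ('d F (phi t) v).
Proof.
move=> DF /is_derive_is_diff[Dp dp]; apply/is_derive_is_diff.
have DFp : differentiable (F \o phi) t := differentiable_comp Dp DF.
apply: DiffDef => //; rewrite (diff_comp Dp DF) dp.
by apply/funext => h /=; rewrite linearZ.
Qed.

Lemma differentiable_fst (q : C2) : differentiable (fst : C2 -> C) q.
Proof.
have l : linear (fst : C2 -> C) by [].
pose m := GRing.isLinear.Build C C2 C _ fst l.
pose L : {linear C2 -> C} := HB.pack (fst : C2 -> C) m.
have -> : (fst : C2 -> C) = L by [].
by apply: linear_differentiable; move=> x; exact: cvg_fst.
Qed.

Lemma diff_fst (q v : C2) : 'd (fst : C2 -> C) q v = v.1.
Proof.
have l : linear (fst : C2 -> C) by [].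
pose m := GRing.isLinear.Build C C2 C _ fst l.
pose L : {linear C2 -> C} := HB.pack (fst : C2 -> C) m.
have -> : (fst : C2 -> C) = L by [].
by rewrite diff_lin//; move=> x; exact: cvg_fst.
Qed.

Lemma differentiable_snd (q : C2) : differentiable (snd : C2 -> C) q.
Proof.
have l : linear (snd : C2 -> C) by [].
pose m := GRing.isLinear.Build C C2 C _ snd l.
pose L : {linear C2 -> C} := HB.pack (snd : C2 -> C) m.
have -> : (snd : C2 -> C) = L by [].
by apply: linear_differentiable; move=> x; exact: cvg_snd.
Qed.

Lemma diff_snd (q v : C2) : 'd (snd : C2 -> C) q v = v.2.
Proof.
have l : linear (snd : C2 -> C) by [].
pose m := GRing.isLinear.Build C C2 C _ snd l.
pose L : {linear C2 -> C} := HB.pack (snd : C2 -> C) m.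
have -> : (snd : C2 -> C) = L by [].
by rewrite diff_lin//; move=> x; exact: cvg_snd.
Qed.

Lemma is_derive_pairP (phi : C -> C2) (t : C) (v : C2) :
  is_derive t (1 : C) phi v <->
  is_derive t (1 : C) (fun t => (phi t).1) v.1 /\
  is_derive t (1 : C) (fun t => (phi t).2) v.2.
Proof.
split.
  move=> H; split.
    have := is_derive_chain (differentiable_fst (phi t)) H.
    by rewrite diff_fst.
  have := is_derive_chain (differentiable_snd (phi t)) H.
  by rewrite diff_snd.
move=> [/is_derive_is_diff H1 /is_derive_is_diff H2]; apply/is_derive_is_diff.
have H := is_diff_pair H1 H2.
rewrite (_ : phi = fun t => ((phi t).1, (phi t).2)); last first.
  by apply/funext => u; case: (phi u).
exact: H.
Qed.

Lemma entire_differentiable (f : C -> C) (t : C) : entire f -> differentiable f t.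
Proof. by move=> ef; exact: (derivable1_diffP f t).1 (ef t). Qed.

Lemma holo_fst (f : C -> C) : entire f -> holomorphic (fun q : C2 => f q.1).
Proof.
by move=> ef q; exact: (differentiable_comp (differentiable_fst q) (entire_differentiable _ ef)).
Qed.

Lemma diff_comp_fst (f : C -> C) (q v : C2) : entire f ->
  'd (fun q : C2 => f q.1) q v = 'D_1 f q.1 * v.1.
Proof.
move=> ef; have Df := entire_differentiable q.1 ef.
have E := diff_comp (differentiable_fst q) Df.
have E1 : 'd (fun q : C2 => f q.1) q v = 'd f (q.1) ('d (fst : C2 -> C) q v) :=
  congr1 (fun u => u v) E.
have E2 : 'd f (q.1) (v.1) = v.1 *: f^`()%classic q.1 := congr1 (fun u => u v.1) (deriv1E (ef q.1)).
exact: etrans E1 (etrans (congr1 ('d f (q.1)) (diff_fst q v)) (etrans E2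
  (etrans (congr1 (fun u => v.1 *: u) (derive1E f q.1)) (mulrC _ _)))).
Qed.

Lemma holo_snd : holomorphic (fun q : C2 => q.2).
Proof. exact: differentiable_snd. Qed.

Lemma holoD (f g : C2 -> C) : holomorphic f -> holomorphic g ->
  holomorphic (fun q => f q + g q).
Proof. by move=> hf hg q; exact: (differentiableD (hf q) (hg q)). Qed.

Lemma holoB (f g : C2 -> C) : holomorphic f -> holomorphic g ->
  holomorphic (fun q => f q - g q).
Proof. by move=> hf hg q; exact: (differentiableB (hf q) (hg q)). Qed.

Lemma holoM (f g : C2 -> C) : holomorphic f -> holomorphic g ->
  holomorphic (fun q => f q * g q).
Proof. by move=> hf hg q; exact: (differentiableM (hf q) (hg q)). Qed.

Lemma holoV (f : C2 -> C) : holomorphic f -> (forall q, f q != 0) ->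
  holomorphic (fun q => (f q)^-1).
Proof. by move=> hf f0 q; exact: (differentiableV (hf q) (f0 q)). Qed.

Lemma holo_pair (f g : C2 -> C) : holomorphic f -> holomorphic g ->
  holomorphic (fun q => (f q, g q)).
Proof. by move=> hf hg q; exact: (differentiable_pair (hf q) (hg q)). Qed.

Lemma holo_cst (a : C) : holomorphic (fun _ : C2 => a).
Proof. by move=> q; exact: differentiable_cst. Qed.

Lemma holo_comp (U V W : normedModType C) (f : V -> W) (g : U -> V) :
  holomorphic f -> holomorphic g -> holomorphic (fun q => f (g q)).
Proof. by move=> hf hg q; exact: (differentiable_comp (hg q) (hf (g q))). Qed.

Lemma logmod_lt (z : C) (A : R) : (logmod z < A%:E)%E = (cmod z < expR A).
Proof.
rewrite /logmod; have [->|z0] := eqVneq z 0; first by rewrite cmod0 expR_gt0 ltNyr.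
by rewrite lte_fin -[X in _ < X]expRK ltr_ln ?posrE ?expR_gt0 ?cmod_gt0.
Qed.

Lemma holo_line (f : C2 -> C) (a b : C2) : holomorphic f ->
  entire (fun z : C => f (a + z *: b)).
Proof.
move=> hf z; apply: (derivable1_diffP _ _).2.
have Dl : differentiable (fun z : C => a + z *: b) z.
  apply: differentiableD; first exact: differentiable_cst.
  by apply: differentiableZl; exact: (entire_differentiable z (@entire_id R)).
exact: (differentiable_comp Dl (hf (a + z *: b))).
Qed.

(** On each complex line f restricts to an entire function of one variable, to which Jensen's
    inequality applies. *)
Lemma psh_log (f : C2 -> C) : holomorphic f -> plurisubharmonic (fun q => logmod (f q)).
Proof.
move=> hf; split.
- by move=> a; rewrite /logmod; case: ifP => _; rewrite ?ltry //.
- move=> x a; rewrite lteNr => H.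
  have {}H : cmod (f x) < expR (- a) by rewrite -logmod_lt.
  exists [set y | cmod (f y) < expR (- a)]; last first.
    by move=> y /= yH; rewrite lteNr -EFinN logmod_lt.
  have := differentiable_continuous (hf x) => /cvgCP.
  have d0 : 0 < expR (- a) - cmod (f x) by rewrite subr_gt0.
  move=> /(_ _ d0); apply: filterS => y yd /=.
  by have := cmodD (f y - f x) (f x); rewrite subrK; lra.
- move=> a b; have := jensen (@holo_line f a b hf).
  by rewrite scale0r addr0.
Qed.

Lemma pluripolar_zeros (f : C2 -> C) (E : set C2) : holomorphic f ->
  (exists a, f a != 0) -> (forall q, E q -> f q = 0) -> pluripolar E.
Proof.
move=> hf [a fa] Ef; exists (fun q => logmod (f q)); split.
- exact: psh_log.
- by exists a; rewrite /logmod (negbTE fa).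
- by move=> q /Ef; rewrite /logmod => ->; rewrite eqxx.
Qed.

End CalculusC2.
Arguments holo_cst {R} a x.

(** * Nonsingular level sets as analytic curves *)

Section LevelSets.
Variable R : realType.
Local Notation C := (Cplx R).
Local Notation C2 := (Cplx2 R).

Lemma nearC2W (q : C2) (P : C2 -> Prop) : (forall y, P y) -> \forall y \near q, P y.
Proof. by move=> H; apply/nbhsC2P; exists 1. Qed.

Lemma nearC2S (q : C2) (P Q : C2 -> Prop) : (forall y, P y -> Q y) ->
  (\forall y \near q, P y) -> \forall y \near q, Q y.
Proof. by move=> H /nbhsC2P[r r0 HP]; apply/nbhsC2P; exists r => // y y1 y2; exact/H/HP. Qed.

Lemma near_preimage (Phi : C2 -> C2) q (P : C2 -> Prop) : holomorphic Phi ->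
  (\forall y \near Phi q, P y) -> \forall y \near q, P (Phi y).
Proof. by move=> hPhi H; exact: (differentiable_continuous (hPhi q) H). Qed.

Variable F : C2 -> C.
Hypothesis hF : holomorphic F.
Let A : set C2 := [set q | F q = 0].
Hypothesis dF : forall q, A q -> exists v, 'd F q v != 0.

Lemma level_set_smooth q : A q -> smooth_equation A q F.
Proof.
move=> Aq; split=> //; first by apply: nearC2W => y; exact: hF.
- exact: dF.
- exact: nearC2W.
Qed.

Lemma level_set_closed : closed A.
Proof.
move=> q H; apply/eqP/negPn/negP => Fq.
have /cvgCP/(_ (cmod (F q))) := differentiable_continuous (hF q).
rewrite cmod_gt0 => /(_ Fq)/H[y [Fy]] /=.
by rewrite Fy sub0r cmodN ltxx.
Qed.

Lemma level_set_curve : analytic_curve A.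
Proof.
split.
  move=> p; exists 1%N, (fun=> F); apply: nearC2W => q; split; first by move=> _; exact: hF.
  by split=> [Aq _ //|/(_ ord0)].
move=> q Aq; apply: subset_closure; exists F; exact: level_set_smooth.
Qed.

Lemma level_set_proper : proper_trajectory A.
Proof.
rewrite /proper_trajectory -((closure_id A).1 level_set_closed); exact: level_set_curve.
Qed.

Lemma level_set_tangent (Y : C2 -> C2) :
  (forall q, A q -> 'd F q (Y q) = 0) -> tangent Y A.
Proof. by move=> H q [f [Aq _ _ _]]; exists F; [exact: level_set_smooth|exact: H]. Qed.

End LevelSets.

(** * Transfer along biholomorphisms *)

Section Transfer.
Variable R : realType.
Local Notation C := (Cplx R).
Local Notation C2 := (Cplx2 R).
Implicit Types (Phi Psi X Y : C2 -> C2).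

Definition biholomorphism Phi Psi :=
  [/\ holomorphic Phi, holomorphic Psi, cancel Phi Psi & cancel Psi Phi].

Lemma biholomorphism_sym Phi Psi : biholomorphism Phi Psi -> biholomorphism Psi Phi.
Proof. by case. Qed.

Lemma biholomorphism_automorphism Phi Psi : biholomorphism Phi Psi -> automorphism Phi.
Proof. by case=> h1 h2 h3 h4; split=> //; exists Psi. Qed.

Lemma diff_cancel Phi Psi q v : biholomorphism Phi Psi ->
  'd Psi (Phi q) ('d Phi q v) = v.
Proof.
move=> [hPhi hPsi PhiK _].
have E := diff_comp (hPhi q) (hPsi (Phi q)).
have E1 : 'd (Psi \o Phi) q v = 'd Psi (Phi q) ('d Phi q v) := congr1 (fun u => u v) E.
rewrite -E1 (_ : Psi \o Phi = id); last by apply/funext => p /=; rewrite PhiK.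
by have [_ ->] := is_diff_id q.
Qed.

Lemma push_forward_inv Phi Psi X Y : biholomorphism Phi Psi ->
  push_forward Phi X Y -> push_forward Psi Y X.
Proof.
move=> bP H q; have [_ _ _ PsiK] := bP.
have E := diff_cancel (Psi q) (X (Psi q)) bP.
have E2 : 'd Psi (Phi (Psi q)) (Y (Phi (Psi q))) = X (Psi q) :=
  etrans (congr1 ('d Psi (Phi (Psi q))) (H (Psi q))) E.
by move: E2; rewrite !PsiK => ->.
Qed.

Lemma push_forward_solution Phi X Y phi : holomorphic Phi -> push_forward Phi X Y ->
  entire_solution X phi -> entire_solution Y (Phi \o phi).
Proof.
by move=> hPhi H sol t; rewrite /= H; exact: (is_derive_chain (hPhi (phi t)) (sol t)).
Qed.

Lemma closure_preimage Phi Psi (B : set C2) q : biholomorphism Phi Psi ->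
  closure B (Phi q) -> closure (Phi @^-1` B) q.
Proof.
move=> [hPhi hPsi PhiK PsiK] H N nN.
have : nbhs (Phi q) (Psi @^-1` N).
  by apply: (differentiable_continuous (hPsi (Phi q))); rewrite PhiK.
by move=> /H[y [By Ny]]; exists (Psi y); split=> //=; rewrite PsiK.
Qed.

Lemma preimageK Phi Psi (B : set C2) : biholomorphism Phi Psi ->
  Psi @^-1` (Phi @^-1` B) = B.
Proof. by move=> [_ _ _ PsiK]; apply/seteqP; split=> q /=; rewrite PsiK. Qed.

Lemma image_preimage_biholo Phi Psi (B : set C2) : biholomorphism Phi Psi ->
  Phi @` B = Psi @^-1` B.
Proof.
move=> [_ _ PhiK PsiK]; apply/seteqP; split=> q /=; first by move=> [p Bp <-]; rewrite PhiK.
by move=> Bq; exists (Psi q).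
Qed.

Lemma preimage_closure Phi Psi (B : set C2) : biholomorphism Phi Psi ->
  closure (Phi @^-1` B) = Phi @^-1` (closure B).
Proof.
move=> bP; apply/seteqP; split=> q /=; last exact: closure_preimage bP.
move=> H; rewrite -(preimageK B bP).
apply: (closure_preimage (biholomorphism_sym bP)).
by have [_ _ -> _] := bP.
Qed.

Lemma smooth_equation_preimage Phi Psi (S : set C2) q f : biholomorphism Phi Psi ->
  smooth_equation S (Phi q) f -> smooth_equation (Phi @^-1` S) q (f \o Phi).
Proof.
move=> bP [Sq Df [v dv] Sf]; have [hPhi hPsi PhiK PsiK] := bP; split => //.
- apply: nearC2S (near_preimage hPhi Df) => y Dy.
  exact: (differentiable_comp (hPhi y) Dy).
- exists ('d Psi (Phi q) v).
  have Dq : differentiable f (Phi q) := nbhs_singleton Df.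
  have E1 u : 'd (f \o Phi) q u = 'd f (Phi q) ('d Phi q u) :=
    congr1 (fun w => w u) (diff_comp (hPhi q) Dq).
  have := diff_cancel (Phi q) v (biholomorphism_sym bP); rewrite PhiK => E2.
  by rewrite E1 E2.
- exact: near_preimage hPhi Sf.
Qed.

Lemma smooth_point_preimage Phi Psi (S : set C2) : biholomorphism Phi Psi ->
  smooth_point (Phi @^-1` S) = Phi @^-1` (smooth_point S).
Proof.
move=> bP; apply/seteqP; split=> q /=.
  have [_ _ PhiK _] := bP; rewrite -{1}[q]PhiK.
  move=> [f /(smooth_equation_preimage (biholomorphism_sym bP))].
  by rewrite (preimageK _ bP) => H; exists (f \o Psi).
by move=> [f H]; exists (f \o Phi); exact: smooth_equation_preimage bP H.
Qed.

Lemma analytic_curve_preimage Phi Psi (S : set C2) : biholomorphism Phi Psi ->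
  analytic_curve S -> analytic_curve (Phi @^-1` S).
Proof.
move=> bP [aS dS]; have [hPhi hPsi PhiK PsiK] := bP; split.
  move=> p; have [n [F H]] := aS (Phi p); exists n, (fun i => F i \o Phi).
  have H1 := near_preimage hPhi H.
  apply: (nearC2S _ H1) => q [DF SF].
  split; last exact: SF.
  by move=> i; exact: (differentiable_comp (hPhi q) (DF i)).
by rewrite (smooth_point_preimage _ bP) (preimage_closure _ bP) => q /dS.
Qed.

Lemma proper_trajectory_preimage Phi Psi (T : set C2) : biholomorphism Phi Psi ->
  proper_trajectory (Phi @` T) -> proper_trajectory T.
Proof.
move=> bP; rewrite /proper_trajectory (image_preimage_biholo _ bP).
rewrite (preimage_closure _ (biholomorphism_sym bP)) => /(analytic_curve_preimage bP).
by rewrite (preimageK _ (biholomorphism_sym bP)).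
Qed.

Lemma proper_trajectory_image Phi Psi (T : set C2) : biholomorphism Phi Psi ->
  proper_trajectory T -> proper_trajectory (Phi @` T).
Proof.
move=> bP pT; apply: (proper_trajectory_preimage (biholomorphism_sym bP)).
rewrite (image_preimage_biholo _ (biholomorphism_sym bP)) (image_preimage_biholo _ bP).
by rewrite (preimageK _ (biholomorphism_sym bP)).
Qed.

Lemma tangent_preimage Phi Psi X Y (S : set C2) : biholomorphism Phi Psi ->
  push_forward Phi X Y -> tangent Y S -> tangent X (Phi @^-1` S).
Proof.
move=> bP H tY q; rewrite (smooth_point_preimage _ bP) => /tY[f Sf df].
exists (f \o Phi); first exact: smooth_equation_preimage bP Sf.
have [hPhi _ _ _] := bP; have [_ Df _ _] := Sf.
have Dq : differentiable f (Phi q) := nbhs_singleton Df.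
have E1 u : 'd (f \o Phi) q u = 'd f (Phi q) ('d Phi q u) :=
  congr1 (fun w => w u) (diff_comp (hPhi q) Dq).
exact: etrans (E1 (X q)) (etrans (congr1 ('d f (Phi q)) (esym (H q))) df).
Qed.

Lemma trajectory_image Phi X Y T : holomorphic Phi -> injective Phi ->
  push_forward Phi X Y -> trajectory X T -> trajectory Y (Phi @` T).
Proof.
move=> hPhi iP H [phi [sol [t nt] ->]]; exists (Phi \o phi); split.
- exact: push_forward_solution H sol.
- by exists t => /= /iP.
- by rewrite image_comp.
Qed.

Lemma trajectory_preimage Phi Psi X Y T : biholomorphism Phi Psi ->
  push_forward Phi X Y -> trajectory Y T -> trajectory X (Phi @^-1` T).
Proof.
move=> bP H tT; rewrite -(image_preimage_biholo _ (biholomorphism_sym bP)).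
have [_ hPsi _ PsiK] := bP.
exact: (trajectory_image hPsi (can_inj PsiK) (push_forward_inv bP H) tT).
Qed.

Lemma trajectory_iso_preimage Phi Psi X Y T M : biholomorphism Phi Psi ->
  push_forward Phi X Y -> trajectory_iso Y (Phi @` T) M -> trajectory_iso X T M.
Proof.
move=> bP H [g [[gM gi gs] gd]]; have [hPhi _ PhiK _] := bP.
exists (g \o Phi); split.
  split.
  - by move=> q Tq /=; apply: gM; exists q.
  - move=> p q; rewrite !inE => Tp Tq /= E; apply: (can_inj PhiK).
    by apply: gi => //; rewrite inE; [exists p|exists q].
  - by move=> m /gs[_ [q Tq <-] <-]; exists q.
move=> phi sol rT t.
have := gd (Phi \o phi) (push_forward_solution hPhi H sol) _ t; apply.
by rewrite -rT image_comp.
Qed.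

Lemma complete_preimage Phi Psi X Y : biholomorphism Phi Psi ->
  push_forward Phi X Y -> complete_field Y -> complete_field X.
Proof.
move=> bP H cY p; have [phi sol p0] := cY (Phi p); have [_ hPsi PhiK _] := bP.
exists (Psi \o phi); first exact: push_forward_solution (push_forward_inv bP H) sol.
by rewrite /= p0 PhiK.
Qed.

Lemma zero_push_forward Phi Psi X Y q : biholomorphism Phi Psi ->
  push_forward Phi X Y -> (X q = 0 <-> Y (Phi q) = 0).
Proof.
move=> bP H; split; first by rewrite H => ->; rewrite linear0.
move=> E; have E1 := diff_cancel q (X q) bP.
have E2 : 'd Phi q (X q) = 0 := etrans (esym (H q)) E.
exact: etrans (esym E1) (etrans (congr1 ('d Psi (Phi q)) E2) (linear0 _)).
Qed.

(** The exceptional set of the model is the zero set of f; its preimage is the zero set of f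
    composed with [Phi], hence again pluripolar, and invariance passes through the solutions. *)
Lemma almost_all_preimage Phi Psi X Y (P Q : set C2 -> Prop) (f : C2 -> C) : biholomorphism Phi Psi ->
  push_forward Phi X Y -> holomorphic f -> (exists a, f a != 0) ->
  flow_invariant Y [set q | f q = 0] ->
  (forall T, trajectory Y (Phi @` T) -> Q (Phi @` T) -> P T) ->
  (forall z T, f z != 0 -> trajectory Y T -> T z -> Q T) ->
  almost_all_trajectories X P.
Proof.
move=> bP H hf [a fa] fi QP YQ; have [hPhi hPsi PhiK PsiK] := bP.
exists [set q | f (Phi q) = 0]; split.
- apply: (@pluripolar_zeros _ (fun q => f (Phi q))) => //; first exact: holo_comp.
  by exists (Psi a); rewrite PsiK.
- move=> phi sol E0 t.
  exact: (fi _ (push_forward_solution hPhi H sol) E0 t).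
- move=> z T /= /eqP fz tT Tz.
  have tPT := trajectory_image hPhi (can_inj PhiK) H tT.
  by apply: QP => //; apply: (YQ (Phi z)) => //; exists z.
Qed.

End Transfer.

(** * Straightening the curve *)

Section Straightening.
Variable R : realType.
Local Notation C := (Cplx R).
Local Notation C2 := (Cplx2 R).
Variables (c : C) (al be : C -> C).
Hypothesis eal : entire al.
Hypothesis ebe : entire be.
Hypothesis al0 : forall z, al z != 0.

Definition straight (q : C2) : C2 := (q.1 - c, al q.1 * q.2 + be q.1).
Definition unstraight (q : C2) : C2 :=
  (q.1 + c, (q.2 - be (q.1 + c)) * (al (q.1 + c))^-1).

Lemma entire_subr (a : C) : entire (fun z => z - a).
Proof. exact: (entireB (@entire_id R) (entire_cst a)). Qed.

Arguments entire_subr a z : clear implicits.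

Lemma straight_biholo : biholomorphism straight unstraight.
Proof.
split.
- apply: holo_pair; first exact: (holo_fst (entire_subr c)).
  exact: (holoD (holoM (holo_fst eal) (@holo_snd R)) (holo_fst ebe)).
- apply: holo_pair; first exact: (holo_fst (is_derive_entire (is_derive_addr c))).
  apply: holoM; first exact: (holoB (@holo_snd R) (holo_fst (entire_shift c ebe))).
  exact: (holoV (holo_fst (entire_shift c eal)) (fun q => al0 _)).
- move=> [x y]; rewrite /straight /unstraight /= subrK addrK.
  by rewrite [al x * y]mulrC mulfK.
- move=> [x y]; rewrite /straight /unstraight /= addrK.
  by rewrite mulrCA mulfV// mulr1 subrK.
Qed.

Lemma diff_straight q v : 'd straight q v =
  (v.1, ('D_1 al q.1 * q.2 + 'D_1 be q.1) * v.1 + al q.1 * v.2).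
Proof.
have H (f : C -> C) : entire f ->
    is_diff q (fun q : C2 => f q.1) (fun v => 'D_1 f q.1 * v.1).
  move=> ef; apply: DiffDef; first exact: holo_fst.
  by apply/funext => u; exact: diff_comp_fst.
have Hs : is_diff q (snd : C2 -> C) (fun v : C2 => v.2).
  by apply: DiffDef; [exact: differentiable_snd|apply/funext => u; exact: diff_snd].
have := is_diff_pair (H _ (entire_subr c)) (is_diffD (is_diffM (H _ eal) Hs) (H _ ebe)).
move=> [_ E]; have E1 := congr1 (fun u => u v) E.
apply: etrans E1 _ => /=.
have -> : 'D_1 (fun z : C => z - c) q.1 = 1 by apply: derive_of; exact: is_derive_addr.
congr (_, _); first by rewrite mul1r.
have key (A D x B v1 v2 : C) :
    A * v2 + x * (D * v1) + B * v1 = (D * x + B) * v1 + A * v2 by ring.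
exact: key.
Qed.

Lemma straight_fiber : fiber_preserving straight.
Proof.
move=> z; exists (z - c); rewrite (image_preimage_biholo _ straight_biholo).
apply/seteqP; split=> q; rewrite /vertical_line /=.
  by move=> <-; rewrite addrK.
by move=> ->; rewrite subrK.
Qed.

(** The solution v of the triangular system 'd straight q v = Y (straight q), where the nonvanishing
    of [al] allows the division. *)
Definition pull (Y : C2 -> C2) (q : C2) : C2 :=
  let y := Y (straight q) in
  (y.1, (y.2 - ('D_1 al q.1 * q.2 + 'D_1 be q.1) * y.1) * (al q.1)^-1).

Lemma push_forward_pull Y : push_forward straight (pull Y) Y.
Proof.
move=> q; rewrite diff_straight /pull /=; case: (Y (straight q)) => y1 y2 /=.
by congr (_, _); rewrite mulrCA mulfV// mulr1 addrC subrK.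
Qed.

Lemma holo_pull Y : holomorphic Y -> holomorphic (pull Y).
Proof.
move=> hY; have [hP _ _ _] := straight_biholo.
have hYP := holo_comp hY hP.
have h1 : holomorphic (fun q => (Y (straight q)).1) := holo_comp (@differentiable_fst R) hYP.
have h2 : holomorphic (fun q => (Y (straight q)).2) := holo_comp (@differentiable_snd R) hYP.
apply: holo_pair => //.
apply: holoM; last exact: (holoV (holo_fst eal) (fun q => al0 _)).
apply: (holoB h2); apply: holoM => //; apply: holoD; last exact: (holo_fst (entire_derive ebe)).
exact: (holoM (holo_fst (entire_derive eal)) (@holo_snd R)).
Qed.

End Straightening.

(** * Diagonal linear vector fields *)

Section LinearFields.
Variable R : realType.
Local Notation C := (Cplx R).
Local Notation C2 := (Cplx2 R).

Definition lin (l m : C) (q : C2) : C2 := (l * q.1, m * q.2).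

Lemma holo_lin l m : holomorphic (lin l m).
Proof.
apply: holo_pair; first exact: (holoM (holo_cst l) (@differentiable_fst R)).
exact: (holoM (holo_cst m) (@holo_snd R)).
Qed.

Lemma is_derive_cexp_mul (a l t : C) :
  is_derive t (1 : C) (fun t => a * cexp (l * t)) (l * (a * cexp (l * t))).
Proof.
have := is_deriveZC a (is_derive_compC (g := fun t => l * t) (is_derive_cexp (l * t)) (is_derive_mull l t)).
by rewrite (_ : a * (cexp (l * t) * l) = l * (a * cexp (l * t))); last by ring.
Qed.

(** Multiplied by the integrating factor e^{-l t}, a solution becomes constant. *)
Lemma linear_ode (l : C) (x : C -> C) :
  (forall t, is_derive t (1 : C) x (l * x t)) -> forall t, x t = x 0 * cexp (l * t).
Proof.
move=> dx t.
pose y t := x t * cexp (- l * t).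
have dy u : is_derive u (1 : C) y 0.
  have de := is_derive_compC (g := fun t => - l * t) (is_derive_cexp (- l * u)) (is_derive_mull (- l) u).
  have := is_deriveMC (dx u) de.
  by rewrite (_ : x u * _ + _ = 0); last by rewrite /=; ring.
have := derive0_constant (is_derive_entire dy) (fun z => derive_of (dy z)) t 0.
rewrite /y mulr0 cexp0 mulr1 mulNr cexpN => <-.
by rewrite divfK// cexp_neq0.
Qed.

Lemma lin_solution l m (a b : C) :
  entire_solution (lin l m) (fun t => (a * cexp (l * t), b * cexp (m * t))).
Proof. by move=> t; apply/is_derive_pairP; split; exact: is_derive_cexp_mul. Qed.

Lemma lin_solutionE l m phi : entire_solution (lin l m) phi ->
  forall t, phi t = ((phi 0).1 * cexp (l * t), (phi 0).2 * cexp (m * t)).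
Proof.
move=> sol t; rewrite [LHS]surjective_pairing; congr (_, _).
  by apply: (linear_ode (x := fun t => (phi t).1)) => u; have /is_derive_pairP[] := sol u.
by apply: (linear_ode (x := fun t => (phi t).2)) => u; have /is_derive_pairP[] := sol u.
Qed.

Lemma lin_complete l m : complete_field (lin l m).
Proof.
move=> [a b]; exists (fun t => (a * cexp (l * t), b * cexp (m * t))).
  exact: lin_solution.
by rewrite !mulr0 cexp0 !mulr1.
Qed.

Definition leaf (l m a b : C) : set C2 :=
  range (fun t => (a * cexp (l * t), b * cexp (m * t))).

Lemma lin_trajectory l m T : trajectory (lin l m) T ->
  exists a b, (a != 0) || (b != 0) /\ T = leaf l m a b.
Proof.
move=> [phi [sol [t nt] ->]]; exists (phi 0).1, (phi 0).2; split.
  apply: contra_notT nt; rewrite negb_or !negbK => /andP[/eqP E1 /eqP E2].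
  by rewrite [RHS]surjective_pairing (lin_solutionE sol t) E1 E2 !mul0r.
by rewrite /leaf; congr image; apply/funext => u; exact: lin_solutionE.
Qed.

Lemma cexp_nontriv (l : C) : l != 0 -> exists t, cexp (l * t) != 1.
Proof.
move=> l0; exists (l^-1); rewrite mulfV//; apply/eqP => /(congr1 (@cmod R)).
rewrite cmod_cexp cmod1 -[RHS]expR0 => /expR_inj /eqP.
by rewrite /cre /= oner_eq0.
Qed.

Lemma leaf_trajectory l m a b : l != 0 -> m != 0 -> (a != 0) || (b != 0) ->
  trajectory (lin l m) (leaf l m a b).
Proof.
move=> l0 m0 ab; exists (fun t => (a * cexp (l * t), b * cexp (m * t))).
split=> //; first exact: lin_solution.
case/orP: ab => [a0|b0].
  have [t tn] := cexp_nontriv l0; exists t => -[/(mulfI a0) E _].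
  by move: tn; rewrite E mulr0 cexp0 eqxx.
have [t tn] := cexp_nontriv m0; exists t => -[_ /(mulfI b0) E].
by move: tn; rewrite E mulr0 cexp0 eqxx.
Qed.

Lemma cexp_onto (a l z : C) : a != 0 -> l != 0 -> z != 0 ->
  exists t, a * cexp (l * t) = z.
Proof.
move=> a0 l0 z0; have [|w wE] := @cexp_surj R (z / a); first by rewrite mulf_neq0// invr_eq0.
by exists (w / l); rewrite [l * _]mulrC divfK// wE mulrC divfK.
Qed.

(** The first coordinate is the isomorphism: it takes every nonzero value, and it is injective on
    the leaf because each of its periods is one of the second coordinate, which may be identically
    0. *)
Lemma leaf_Cstar_fst l m a b : l != 0 -> a != 0 ->
  (forall t, cexp (l * t) = 1 -> b * cexp (m * t) = b) ->
  of_type_Cstar (lin l m) (leaf l m a b).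
Proof.
move=> l0 a0 H; exists fst; split.
  split.
  - by move=> _ [t _ <-] /=; rewrite mulf_neq0// cexp_neq0.
  - move=> _ _ /set_mem[t _ <-] /set_mem[u _ <-] /= E; congr (_, _) => //.
    have /H : cexp (l * (u - t)) = 1.
      by rewrite mulrBr cexpB -(mulfI a0 E) mulfV// cexp_neq0.
    by rewrite mulrBr cexpB => Hb; rewrite -[in LHS]Hb -mulrA divfK// cexp_neq0.
  - move=> z /= z0; have [t <-] := cexp_onto a0 l0 z0.
    by exists (a * cexp (l * t), b * cexp (m * t)) => //; exists t.
move=> phi sol rT t.
have p0 : (phi 0).1 != 0.
  have : range phi (phi 0) by exists 0.
  by rewrite rT => -[u _ <-] /=; rewrite mulf_neq0// cexp_neq0.
have /is_derive_pairP[/= [d1 d2] _] := sol t; split=> //.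
rewrite d2 (lin_solutionE sol) /=.
by rewrite !mulf_neq0// cexp_neq0.
Qed.

Lemma leaf_Cstar_snd l m a b : m != 0 -> b != 0 ->
  (forall t, cexp (m * t) = 1 -> a * cexp (l * t) = a) ->
  of_type_Cstar (lin l m) (leaf l m a b).
Proof.
move=> l0 a0 H; exists snd; split.
  split.
  - by move=> _ [t _ <-] /=; rewrite mulf_neq0// cexp_neq0.
  - move=> _ _ /set_mem[t _ <-] /set_mem[u _ <-] /= E; congr (_, _) => //.
    have /H : cexp (m * (u - t)) = 1.
      by rewrite mulrBr cexpB -(mulfI a0 E) mulfV// cexp_neq0.
    by rewrite mulrBr cexpB => Hb; rewrite -[in LHS]Hb -mulrA divfK// cexp_neq0.
  - move=> z /= z0; have [t <-] := cexp_onto a0 l0 z0.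
    by exists (a * cexp (l * t), b * cexp (m * t)) => //; exists t.
move=> phi sol rT t.
have p0 : (phi 0).2 != 0.
  have : range phi (phi 0) by exists 0.
  by rewrite rT => -[u _ <-] /=; rewrite mulf_neq0// cexp_neq0.
have /is_derive_pairP[/= _ [d1 d2]] := sol t; split=> //.
rewrite d2 (lin_solutionE sol) /=.
by rewrite !mulf_neq0// cexp_neq0.
Qed.

(** The chart is the inverse of the parametrization. Uniqueness of solutions up to a time shift
    makes it a translation when read through any other solution on the same trajectory. *)
Lemma injective_type_C (Y : C2 -> C2) (phi : C -> C2) : injective phi ->
  (forall psi t0, entire_solution Y psi -> psi 0 = phi t0 -> forall t, psi t = phi (t0 + t)) ->
  of_type_C Y (range phi).
Proof.
move=> iphi U; pose g q := xget 0 [set t | phi t = q].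
have gphi t : g (phi t) = t.
  by apply: iphi; apply: (@xgetPex _ (0 : C) [set u | phi u = phi t]); exists t.
exists g; split.
  split=> //.
  - by move=> _ _ /set_mem[t _ <-] /set_mem[u _ <-]; rewrite !gphi => ->.
  - by move=> t _; exists (phi t) => //; exists t.
move=> psi sol rT t.
have [t0 _ E0] : range phi (psi 0) by rewrite -rT; exists 0.
have E := U psi t0 sol (esym E0).
have -> : g \o psi = fun t => t + t0.
  by apply/funext => u; rewrite /= E gphi addrC.
have [d1 ->] := is_derive_addr t0 t; split=> //; exact: oner_neq0.
Qed.

Lemma leaf_C l m a b : a != 0 -> b != 0 ->
  (forall t, cexp (l * t) = 1 -> cexp (m * t) = 1 -> t = 0) ->
  of_type_C (lin l m) (leaf l m a b).
Proof.
move=> a0 b0 H; apply: injective_type_C.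
  move=> t u [/(mulfI a0) E1 /(mulfI b0) E2]; apply/eqP; rewrite -subr_eq0; apply/eqP/H.
    by rewrite mulrBr cexpB E1 mulfV// cexp_neq0.
  by rewrite mulrBr cexpB E2 mulfV// cexp_neq0.
move=> psi t0 sol E t; rewrite (lin_solutionE sol) E /= !mulrDr !cexpD.
by rewrite !mulrA.
Qed.

Lemma lin_polynomial l m : polynomial_field (lin l m).
Proof.
exists (l *: 'X)%:P, (m%:P *: 'X) => q.
by rewrite hornerC hornerZ hornerX hornerZ hornerX hornerM !hornerC.
Qed.

Lemma lin_flow_invariant l m : flow_invariant (lin l m) [set q | q.1 * q.2 = 0].
Proof.
move=> phi sol /= /eqP; rewrite mulf_eq0 => E t; rewrite (lin_solutionE sol) /=.
by case/orP: E => /eqP ->; rewrite mul0r ?mul0r ?mulr0.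
Qed.

End LinearFields.

(** * Non-proper leaves *)

Section SilverRotation.
Variable R : realType.
Local Notation C := (Cplx R).
Local Notation C2 := (Cplx2 R).

(* tau is a root of t^2 = 1 - 2 t in (0, 1), so its powers are integral affine
   functions of tau tending to 0: multiples of tau are arbitrarily close to
   integers without being integers. *)
Definition tau : R := Num.sqrt 2 - 1.

Lemma tau_sqr : tau ^+ 2 = 1 - 2 * tau.
Proof. by rewrite /tau sqrrB1 sqr_sqrtr//; ring. Qed.

Lemma tau_bounds : 0 < tau <= 1 / 2.
Proof.
have s0 : 0 <= Num.sqrt 2 :> R := sqrtr_ge0 2.
have s2 : Num.sqrt 2 ^+ 2 = 2 :> R by rewrite sqr_sqrtr.
by rewrite /tau; nra.
Qed.

Lemma tau_pow m : exists A B : int, tau ^+ m = A%:~R + B%:~R * tau.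
Proof.
elim: m => [|m [A [B E]]]; first by exists 1, 0; rewrite expr0 mul0r addr0.
exists B, (A - 2 * B); rewrite exprSr E.
rewrite mulrDl -mulrA -expr2 tau_sqr rmorphB rmorphM /=; ring.
Qed.

Lemma tau_small (e : R) : 0 < e -> exists m, tau ^+ m.+1 < e.
Proof.
move=> e0; have /andP[t0 t1] := tau_bounds; have [m mE] := exists_pow2 1 e0.
exists m; apply: le_lt_trans mE; rewrite exprSr.
have p : tau ^+ m <= 1 / 2 ^+ m.
  have -> : 1 / 2 ^+ m = (1 / 2) ^+ m :> R by rewrite expr_div_n expr1n.
  by rewrite lerXn2r ?nnegrE//; lra.
apply: le_trans p; rewrite ler_piMr ?exprn_ge0// ?ltW//; lra.
Qed.

(** If k tau is an integer, the recurrence for the powers makes every k tau^m an integer; these tend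
    to 0, so one of them is 0. *)
Lemma tau_irrational (k k' : int) : k%:~R * tau = k'%:~R -> k = 0.
Proof.
move=> E; have /andP[t0 t1] := tau_bounds.
have H m : exists l l' : int, k%:~R * tau ^+ m = l%:~R /\ k%:~R * tau ^+ m.+1 = l'%:~R.
  elim: m => [|m [l [l' [E1 E2]]]]; first by exists k, k'; rewrite expr0 mulr1 expr1.
  exists l', (l - 2 * l'); split=> //.
  rewrite rmorphB rmorphM /= -E1 -E2 -addn2 exprD tau_sqr exprS; ring.
have k0 : 0 < `|k%:~R| + 1 :> R by rewrite ltr_wpDl.
have [m mE] := tau_small (divr_gt0 ltr01 k0).
have [_ [l [_ lE]]] := H m.
have tm : 0 < tau ^+ m.+1 by rewrite exprn_gt0.
have l1 : `|l%:~R| < 1 :> R.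
  rewrite -lE normrM [`|tau ^+ _|]gtr0_norm//.
  by move: mE; rewrite ltr_pdivlMr//; nra.
have l0 : l = 0 by apply/eqP; rewrite -absz_eq0; move: l1; rewrite -intr_norm -[1]/(1%:~R) ltr_int; case: (l) => -[].
by move/eqP: lE; rewrite l0 mulf_eq0 [tau ^+ _ == 0]gt_eqF// orbF intr_eq0 => /eqP.
Qed.

Let T : C := ofR (2 * pi) * ci R.

Lemma cexp_near0 (e : R) : 0 < e ->
  exists2 r : R, 0 < r & forall h : C, cmod h < r -> cmod (cexp h - 1) < e.
Proof.
move=> e0; have := @entire_continuous R _ (@entire_cexp R) 0.
move=> /cvgCP/(_ _ e0)/nbhsCP[r r0 H]; exists r => // h hr.
by have := H h; rewrite subr0 cexp0; apply.
Qed.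

(** For tau^m = A + B tau, rotating B times by 2 pi tau amounts to a single rotation by 2 pi tau^m,
    an angle that is small but strictly between 0 and 2 pi. *)
Lemma small_rotation (e : R) : 0 < e -> exists j : int,
  cexp (j%:~R * (ofR tau * T)) != 1 /\ cmod (cexp (j%:~R * (ofR tau * T)) - 1) < e.
Proof.
move=> e0; have [r r0 H] := cexp_near0 e0; have /andP[t0 t1] := tau_bounds.
have p0 : 0 < 2 * pi :> R by rewrite mulr_gt0// pi_gt0.
have [m mE] := tau_small (divr_gt0 r0 p0).
have [A [B AB]] := tau_pow m.+1; exists B.
have -> : cexp (B%:~R * (ofR tau * T)) = cexp (ofR (tau ^+ m.+1) * T).
  have -> : ofR (tau ^+ m.+1) = A%:~R + B%:~R * ofR tau.
    by rewrite AB [LHS]ofRD [ofR (_ * tau)]ofRM !ofR_int.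
  by rewrite mulrDl cexpD cexp_2pi mul1r mulrA.
have tm : 0 < tau ^+ m.+1 by rewrite exprn_gt0.
have tm1 : tau ^+ m.+1 < 1 by rewrite exprn_ilt1// ?ltW//; lra.
split.
  apply/eqP => /cexp_eq1[k]; rewrite -/T.
  have T0 : T != 0 by rewrite -cmod_gt0 cmodM cmod_ci mulr1 cmod_ofR gtr0_norm.
  move=> /(mulIf T0); rewrite -ofR_int => /ofR_inj kE.
  move: tm tm1; rewrite kE ltr0z -[1]/(1%:~R) ltr_int => h1 h2.
  by move: h1 h2; case: (k) => [[|n]|n].
apply: H; rewrite !cmodM cmod_ci mulr1 !cmod_ofR !gtr0_norm//.
by rewrite -ltr_pdivlMr.
Qed.

(** The difference quotients along v vanish for arbitrarily small h, hence so does their limit. *)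
Lemma diff_eq0 (f : C2 -> C) (q v : C2) : differentiable f q ->
  (forall r : R, 0 < r -> exists h : C, [/\ h != 0, cmod h < r & f (q + h *: v) = f q]) ->
  'd f q v = 0.
Proof.
move=> Df H; apply/eqP; rewrite -cmod_eq0 eq_le cmod_ge0 andbT.
have E0 : q + (0 : C) *: v = q by rewrite scale0r addr0.
have Dl : is_derive (0 : C) (1 : C) (fun z : C => q + z *: v) v.
  apply/is_derive_pairP; split=> /=.
    have := is_deriveDC (entireP 0 (entire_cst q.1)) (is_derive_mull v.1 0).
    rewrite derive_cst add0r (_ : (fun w => _) = fun t => q.1 + t * v.1)//.
    by apply/funext => w; rewrite mulrC.
  have := is_deriveDC (entireP 0 (entire_cst q.2)) (is_derive_mull v.2 0).
  rewrite derive_cst add0r (_ : (fun w => _) = fun t => q.2 + t * v.2)//.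
  by apply/funext => w; rewrite mulrC.
have Df' : differentiable f (q + (0 : C) *: v) by rewrite E0.
have /is_deriveCP D := is_derive_chain Df' Dl.
apply/ler_addgt0Pr => e e0; rewrite add0r.
have [r r0 {}D] := D e e0; have [h [h0 hr hE]] := H r r0.
have := D h hr; rewrite add0r /= E0 hE subrr sub0r cmodN cmodM.
by rewrite ler_pM2r// cmod_gt0.
Qed.

Lemma closureC2P (B : set C2) (q : C2) : closure B q <->
  forall r : R, 0 < r -> exists y, [/\ B y, cmod (y.1 - q.1) < r & cmod (y.2 - q.2) < r].
Proof.
split=> [H r r0|H N /nbhsC2P[r r0 HN]].
  have [|y [By [y1 y2]]] := H [set y | cmod (y.1 - q.1) < r /\ cmod (y.2 - q.2) < r].
    by apply/nbhsC2P; exists r.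
  by exists y.
by have [y [By y1 y2]] := H r r0; exists y; split=> //; exact: HN.
Qed.

Lemma closure_rotate (B : set C2) (u v : C) : cmod u = 1 -> cmod v = 1 ->
  (forall y, B y -> B (y.1 * u, y.2 * v)) ->
  forall q, closure B q -> closure B (q.1 * u, q.2 * v).
Proof.
move=> u1 v1 H q /closureC2P Bq; apply/closureC2P => r r0.
have [y [By y1 y2]] := Bq r r0; exists (y.1 * u, y.2 * v); split; first exact: H.
- by rewrite /= -mulrBl cmodM u1 mulr1.
- by rewrite /= -mulrBl cmodM v1 mulr1.
Qed.

(* Near each point off the axes the closure is accumulated along both
   coordinate directions, so no local equation has a nonzero differential. *)
Lemma leaf_not_proper (l a b : C) : l != 0 -> a != 0 -> b != 0 ->
  ~ proper_trajectory (leaf l (l * ofR tau) a b).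
Proof.
move=> l0 a0 b0 [_ dense]; set S := closure _ in dense.
have /andP[t0 t1] := tau_bounds.
have tau0 : ofR tau != 0 :> C by rewrite -cmod_gt0 cmod_ofR gtr0_norm.
pose u (j : int) := cexp (j%:~R * (ofR tau * T)).
have u1 j : cmod (u j) = 1.
  rewrite cmod_cexp (_ : cre _ = 0) ?expR0// -ofR_int /T !creM !cimM /cre /cim /=; ring.
have leafC j y : leaf l (l * ofR tau) a b y -> leaf l (l * ofR tau) a b (y.1 * 1, y.2 * u j).
  move=> [t _ <-]; exists (t + j%:~R * T / l) => //=; congr (_, _).
    by rewrite mulrDr cexpD [l * (_ / l)]mulrC divfK// cexp_2pi !mulr1.
  rewrite mulrDr cexpD mulrA; congr (_ * cexp _).
  by field.
(* A period of the second coordinate rotates the first by j turns of angle 2 pi / tau. Since tau^2 =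
   1 - 2 tau gives 1 / tau = tau + 2, this is the same rotation [u j] as in the other direction. *)
have leafC' j y : leaf l (l * ofR tau) a b y -> leaf l (l * ofR tau) a b (y.1 * u j, y.2 * 1).
  move=> [t _ <-]; exists (t + j%:~R * T / (l * ofR tau)) => //=; congr (_, _).
    rewrite mulrDr cexpD mulrA; congr (_ * _).
    have -> : l * (j%:~R * T / (l * ofR tau)) = j%:~R * (ofR tau * T) + (j *+ 2)%:~R * T.
      have tt : ofR tau * ofR tau = 1 - 2 * ofR tau :> C.
        by rewrite -ofRM -expr2 tau_sqr ofRB ofR1 ofRM ofR_nat.
      apply: (mulIf tau0).
      rewrite (_ : l * _ * ofR tau = j%:~R * T); last by field; rewrite l0 tau0.
      rewrite (_ : (j *+ 2)%:~R = 2 * j%:~R :> C); last by rewrite mulr2n intrD; ring.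
      rewrite (_ : (_ + _) * ofR tau = j%:~R * T * (ofR tau * ofR tau + 2 * ofR tau)); last by ring.
      by rewrite tt subrK mulr1.
    by rewrite cexpD cexp_2pi mulr1.
  by rewrite mulrDr cexpD [l * ofR tau * (_ / _)]mulrC divfK ?mulf_neq0// cexp_2pi !mulr1.
have Srot j y : S y -> S (y.1 * 1, y.2 * u j).
  by apply: closure_rotate => // [|y' /leafC]; [exact: cmod1|exact].
have Srot' j y : S y -> S (y.1 * u j, y.2 * 1).
  by apply: closure_rotate => // [|y' /leafC']; [exact: cmod1|exact].
have Sab : S (a, b).
  by apply: subset_closure; exists 0 => //; rewrite !mulr0 cexp0 !mulr1.
(* Density yields a smooth point of the closure so close to (a, b) that neither of its coordinates
   vanishes. *)
have := (closureC2P _ _).1 (dense _ Sab) (Num.min (cmod a) (cmod b)).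
rewrite lt_min !cmod_gt0 a0 b0 => /(_ isT)[q []] /=.
move=> [f [Sq /nbhs_singleton Df [v dv] near0]] qa qb.
have q10 : q.1 != 0.
  by apply: contraTneq qa => ->; rewrite sub0r cmodN -leNgt ge_min lexx.
have q20 : q.2 != 0.
  by apply: contraTneq qb => ->; rewrite sub0r cmodN -leNgt ge_min lexx orbT.
have fq : f q = 0 by apply/(nbhs_singleton near0).
move/nbhsC2P : near0 => [s s0 near0].
have d1 : 'd f q (1, 0) = 0.
  apply: diff_eq0 => // r r0.
  have m0 : 0 < Num.min r s / cmod q.1 by rewrite divr_gt0 ?cmod_gt0// lt_min r0.
  have [j [uj1 uj]] := small_rotation m0.
  have small : cmod (q.1 * (u j - 1)) < Num.min r s.
    by rewrite cmodM mulrC -ltr_pdivlMr ?cmod_gt0.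
  exists (q.1 * (u j - 1)); split.
  - by rewrite mulf_neq0// subr_eq0.
  - by apply: lt_le_trans small _; rewrite ge_min lexx.
  - rewrite fq; apply/near0.
    + rewrite /= addrC addKr [_ *: 1]mulr1.
      by apply: lt_le_trans small _; rewrite ge_min lexx orbT.
    + by rewrite /= addrC addKr [_ *: 0]mulr0 cmod0.
    + have := Srot' j _ Sq; congr S; rewrite [RHS]surjective_pairing /=.
      rewrite [_ *: 1]mulr1 [_ *: 0]mulr0 addr0 mulr1; congr (_, _); ring.
have d2 : 'd f q (0, 1) = 0.
  apply: diff_eq0 => // r r0.
  have m0 : 0 < Num.min r s / cmod q.2 by rewrite divr_gt0 ?cmod_gt0// lt_min r0.
  have [j [uj1 uj]] := small_rotation m0.
  have small : cmod (q.2 * (u j - 1)) < Num.min r s.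
    by rewrite cmodM mulrC -ltr_pdivlMr ?cmod_gt0.
  exists (q.2 * (u j - 1)); split.
  - by rewrite mulf_neq0// subr_eq0.
  - by apply: lt_le_trans small _; rewrite ge_min lexx.
  - rewrite fq; apply/near0.
    + by rewrite /= addrC addKr [_ *: 0]mulr0 cmod0.
    + rewrite /= addrC addKr [_ *: 1]mulr1.
      by apply: lt_le_trans small _; rewrite ge_min lexx orbT.
    + have := Srot j _ Sq; congr S; rewrite [RHS]surjective_pairing /=.
      rewrite [_ *: 1]mulr1 [_ *: 0]mulr0 addr0 mulr1; congr (_, _); ring.
move/eqP: dv; apply.
have -> : v = v.1 *: ((1 : C), (0 : C)) + v.2 *: ((0 : C), (1 : C)).
  rewrite [LHS]surjective_pairing; congr (_, _) => /=.
    by rewrite [_ *: 1]mulr1 [_ *: 0]mulr0 addr0.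
  by rewrite [_ *: 1]mulr1 [_ *: 0]mulr0 add0r.
by rewrite linearD !linearZ /= d1 d2 !scaler0 addr0.
Qed.

End SilverRotation.

(** * Model curves and fields *)

Section Models.
Variable R : realType.
Local Notation C := (Cplx R).
Local Notation C2 := (Cplx2 R).

Definition horizontal (n : C) (q : C2) : C2 := (n, 0).

Lemma horizontal_solutionE n phi : entire_solution (horizontal n) phi ->
  forall t, phi t = ((phi 0).1 + n * t, (phi 0).2).
Proof.
move=> sol t; rewrite [LHS]surjective_pairing; congr (_, _).
  have d u : is_derive u (1 : C) (fun v => (phi v).1 - n * v) 0.
    have /is_derive_pairP[/= d1 _] := sol u.
    by have := is_deriveBC d1 (is_derive_mull n u); rewrite subrr.
  have := derive0_constant (is_derive_entire d) (fun z => derive_of (d z)) t 0.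
  by rewrite mulr0 subr0 => <-; rewrite subrK.
apply: (derive0_constant (f := fun v => (phi v).2)).
  by move=> u; have /is_derive_pairP[_ [d1 _]] := sol u.
by move=> u; have /is_derive_pairP[_ [_ d2]] := sol u.
Qed.

Lemma horizontal_solution (n a b : C) :
  entire_solution (horizontal n) (fun t => (n * t + a, b)).
Proof.
move=> t; apply/is_derive_pairP; split; first exact: is_derive_affine.
exact: is_derive_cst.
Qed.

Lemma horizontal_trajectory (n : C) T : n != 0 ->
  trajectory (horizontal n) T <-> exists b, T = [set q | q.2 - b = 0].
Proof.
move=> n0.
have E (a b : C) : range (fun t => (n * t + a, b)) = [set q : C2 | q.2 - b = 0].
  apply/seteqP; split=> [_ [t _ <-]|[x y] /= /eqP]; first by rewrite /= subrr.
  rewrite subr_eq0 => /eqP ->; exists ((x - a) / n) => //.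
  by rewrite [n * _]mulrC divfK// subrK.
split.
  move=> [phi [sol _ ->]]; exists (phi 0).2; rewrite -(E (phi 0).1).
  by congr image; apply/funext => t; rewrite (horizontal_solutionE sol t) addrC.
move=> [b ->]; exists (fun t => (n * t + 0, b)); split; last by rewrite E.
- exact: horizontal_solution.
- by exists 1 => -[/eqP]; rewrite mulr1 mulr0 !addr0 (negbTE n0).
Qed.

Lemma horizontal_type_C (n b : C) : n != 0 ->
  of_type_C (horizontal n) [set q | q.2 - b = 0].
Proof.
move=> n0.
have <- : range (fun t => (n * t + 0, b)) = [set q : C2 | q.2 - b = 0].
  apply/seteqP; split=> [_ [t _ <-]|[x y] /= /eqP]; first by rewrite /= subrr.
  rewrite subr_eq0 => /eqP ->; exists (x / n) => //.
  by rewrite [n * _]mulrC divfK// addr0.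
apply: injective_type_C => [t u [/addIr/(mulfI n0)]//|psi t0 sol E t].
by rewrite (horizontal_solutionE sol) E /= !addr0 mulrDr.
Qed.

Lemma diff_vertical (F : C2 -> C) (q : C2) (p : C) : holomorphic F ->
  is_derive (0 : C) (1 : C) (fun t => F (q.1, t + q.2)) p -> 'd F q (0, 1) = p.
Proof.
move=> hF D; pose phi (t : C) : C2 := (q.1, t + q.2).
have dphi : is_derive (0 : C) (1 : C) phi (0, 1).
  apply/is_derive_pairP; split; first exact: is_derive_cst.
  exact: is_derive_addr.
have p0 : phi 0 = q by rewrite /phi add0r -surjective_pairing.
have := derive_of (is_derive_chain (hF (phi 0)) dphi); rewrite p0 => <-.
exact: derive_of D.
Qed.

Lemma line_proper (b : C) : proper_trajectory [set q : C2 | q.2 - b = 0].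
Proof.
apply: (level_set_proper (F := fun q : C2 => q.2 - b)).
  exact: (holoB (@holo_snd R) (holo_cst b)).
move=> q _; exists (0, 1).
have H : holomorphic (fun q : C2 => q.2 - b) := holoB (@holo_snd R) (holo_cst b).
have D : is_derive (0 : C) (1 : C) (fun t : C => t + q.2 - b) 1.
  rewrite (_ : (fun t => _) = fun t => t + (q.2 - b)); first exact: is_derive_addr.
  by apply/funext => t; rewrite addrA.
by rewrite (diff_vertical H D) oner_neq0.
Qed.

Lemma horizontal_polynomial n : polynomial_field (horizontal n).
Proof. by exists n%:P%:P, 0%:P%:P => q; rewrite !hornerC. Qed.

Lemma horizontal_complete n : complete_field (horizontal n).
Proof.
move=> [a b]; exists (fun t => (n * t + a, b)); first exact: horizontal_solution.
by rewrite mulr0 add0r.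
Qed.

(** F vanishes along the whole solution through a point of the level set; differentiating at time 0
    gives tangency. *)
Lemma tangent_invariant (F : C2 -> C) (Y : C2 -> C2) : holomorphic F ->
  (forall q, F q = 0 -> exists v, 'd F q v != 0) -> complete_field Y ->
  flow_invariant Y [set q | F q = 0] -> tangent Y [set q | F q = 0].
Proof.
move=> hF dF cY fi; apply: level_set_tangent => // q Fq.
have [phi sol p0] := cY q; rewrite -p0.
have D := is_derive_chain (hF (phi 0)) (sol 0).
have : is_derive (0 : C) (1 : C) (F \o phi) 0.
  rewrite (_ : F \o phi = fun=> 0); first exact: is_derive_cst.
  by apply/funext => t; apply: (fi phi sol); rewrite /= p0.
by move/derive_of; rewrite (derive_of D).
Qed.

(** * The curves w z^k = d *)

Section HyperbolicCurves.
Variable k : nat.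

Definition hyp (d : C) (q : C2) : C := q.2 * q.1 ^+ k - d.

Lemma holo_hyp d : holomorphic (hyp d).
Proof.
have ep : entire (fun z : C => z ^+ k) := @entireX R _ k (@entire_id R).
exact: (holoB (holoM (@holo_snd R) (holo_fst ep)) (holo_cst d)).
Qed.

Lemma diff_hyp d q : 'd (hyp d) q (0, 1) = q.1 ^+ k.
Proof.
apply: (diff_vertical (holo_hyp d)).
have -> : (fun t => hyp d (q.1, t + q.2)) = fun t => q.1 ^+ k * t + (q.2 * q.1 ^+ k - d).
  by apply/funext => t; rewrite /hyp /=; ring.
exact: is_derive_affine.
Qed.

Lemma hyp_nonsingular d q : d != 0 -> hyp d q = 0 -> exists v, 'd (hyp d) q v != 0.
Proof.
move=> d0 /eqP; rewrite subr_eq0 => /eqP E; exists (0, 1).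
rewrite diff_hyp; apply: contraNneq d0 => q0.
by rewrite -E q0 mulr0.
Qed.

Lemma cexpNk (l t : C) : cexp (- (k%:R * l) * t) * cexp (l * t) ^+ k = 1.
Proof.
rewrite -cexpMn -cexpD (_ : _ + _ = 0) ?cexp0//.
by rewrite -mulr_natl; ring.
Qed.

(** w z^k is a first integral. Conversely z is nonzero on the level set, so the exponential reaches
    it at some time, and z determines w. *)
Lemma leaf_hyp (l a b : C) : l != 0 -> a != 0 -> b != 0 -> (0 < k)%N ->
  leaf l (- (k%:R * l)) a b = [set q | hyp (b * a ^+ k) q = 0].
Proof.
move=> l0 a0 b0 k0; apply/seteqP; split=> [_ [t _ <-]|[x y]] /=; rewrite /hyp /=.
  rewrite exprMn (_ : _ * _ = b * a ^+ k * (cexp (- (k%:R * l) * t) * cexp (l * t) ^+ k)); last by ring.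
  by rewrite cexpNk mulr1 subrr.
move/eqP; rewrite subr_eq0 => /eqP E.
have x0 : x != 0.
  apply: contra_eq_neq E => ->; rewrite expr0n gtn_eqF// mulr0 eq_sym.
  by rewrite mulf_neq0// expf_neq0.
have [t tE] := cexp_onto a0 l0 x0; exists t => //; rewrite tE; congr (_, _).
have xk : x ^+ k != 0 by rewrite expf_neq0.
apply: (mulIf xk); rewrite E -tE exprMn.
have -> : b * a ^+ k = b * a ^+ k * (cexp (- (k%:R * l) * t) * cexp (l * t) ^+ k).
  by rewrite cexpNk mulr1.
ring.
Qed.

(** Meant for the leaves on the axes, which omit the origin: the closure fills the puncture and is
    the smooth curve {F = 0} parametrized by [P]. *)
Lemma punctured_closure (P : C -> C2) (F : C2 -> C) (T : set C2) :
  holomorphic F -> (forall q, exists v, 'd F q v != 0) ->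
  (forall q, F q = 0 -> exists z, q = P z) ->
  (forall q, T q -> F q = 0) -> (forall z, z != 0 -> T (P z)) ->
  (forall z w, cmod ((P z).1 - (P w).1) <= cmod (z - w) /\ cmod ((P z).2 - (P w).2) <= cmod (z - w)) ->
  proper_trajectory T.
Proof.
move=> hF dF FP TF TP PL; have cF := level_set_closed hF.
rewrite /proper_trajectory (_ : closure T = [set q | F q = 0]).
  by apply: level_set_curve => // q _; exact: dF.
apply/seteqP; split=> [q|q /FP[z ->]].
  by move/(closureS TF); rewrite -((closure_id _).1 cF).
apply/closureC2P => r r0.
have [w w0 wz] : exists2 w : C, w != 0 & cmod (w - z) < r.
  have r2 : ofR (r / 2) != 0 :> C by rewrite -cmod_gt0 cmod_ofR gtr0_norm divr_gt0.
  have rr : cmod (ofR (r / 2) : C) < r by rewrite cmod_ofR gtr0_norm ?divr_gt0//; lra.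
  have [->|z0] := eqVneq z 0; first by exists (ofR (r / 2)); rewrite ?subr0.
  by exists z => //; rewrite subrr cmod0.
exists (P w); split; first exact: TP.
- exact: le_lt_trans (PL w z).1 wz.
- exact: le_lt_trans (PL w z).2 wz.
Qed.

Lemma leaf_hyp_proper (l a b : C) : l != 0 -> (a != 0) || (b != 0) -> (0 < k)%N ->
  proper_trajectory (leaf l (- (k%:R * l)) a b).
Proof.
move=> l0 ab k0.
have m0 : - (k%:R * l) != 0 by rewrite oppr_eq0 mulf_neq0// pnatr_eq0 -lt0n.
have [a0|a0] := eqVneq a 0.
  move: ab; rewrite a0 eqxx /= => b0.
  apply: (punctured_closure (P := fun z => (0, z)) (F := fst)).
  - exact: differentiable_fst.
  - by move=> q; exists (1, 0); rewrite diff_fst oner_neq0.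
  - by move=> [x y] /= ->; exists y.
  - by move=> _ [t _ <-] /=; rewrite mul0r.
  - move=> z z0; have [t tE] := cexp_onto b0 m0 z0.
    by exists t => //; rewrite mul0r tE.
  - by move=> z w; split; [rewrite [X in cmod X]subrr cmod0 cmod_ge0|exact: lexx].
have [b0|b0] := eqVneq b 0.
  rewrite b0; apply: (punctured_closure (P := fun z => (z, 0)) (F := snd)).
  - exact: differentiable_snd.
  - by move=> q; exists (0, 1); rewrite diff_snd oner_neq0.
  - by move=> [x y] /= ->; exists x.
  - by move=> _ [t _ <-] /=; rewrite mul0r.
  - move=> z z0; have [t tE] := cexp_onto a0 l0 z0.
    by exists t => //; rewrite mul0r tE.
  - by move=> z w; split; [exact: lexx|rewrite [X in cmod X]subrr cmod0 cmod_ge0].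
rewrite leaf_hyp//; apply: level_set_proper; first exact: holo_hyp.
move=> q; apply: hyp_nonsingular => //.
by rewrite mulf_neq0// expf_neq0.
Qed.

Lemma leaf_hyp_Cstar (l a b : C) : l != 0 -> (a != 0) || (b != 0) -> (0 < k)%N ->
  of_type_Cstar (lin l (- (k%:R * l))) (leaf l (- (k%:R * l)) a b).
Proof.
move=> l0 ab k0.
have m0 : - (k%:R * l) != 0 by rewrite oppr_eq0 mulf_neq0// pnatr_eq0 -lt0n.
have [a0|a0] := eqVneq a 0.
  move: ab; rewrite a0 eqxx /= => b0.
  by apply: leaf_Cstar_snd => // t _; rewrite mul0r.
apply: leaf_Cstar_fst => // t E; have := cexpNk l t.
by rewrite E expr1n mulr1 => ->; rewrite mulr1.
Qed.

Lemma hyp_flow_invariant (l d : C) :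
  flow_invariant (lin l (- (k%:R * l))) [set q | hyp d q = 0].
Proof.
move=> phi sol /= E t; rewrite (lin_solutionE sol t) /hyp /= exprMn -[RHS]E /hyp; congr (_ - _).
rewrite (_ : _ * _ = (phi 0).2 * (phi 0).1 ^+ k * (cexp (- (k%:R * l) * t) * cexp (l * t) ^+ k)); last by ring.
by rewrite cexpNk mulr1.
Qed.

End HyperbolicCurves.

(* Correct f to order j at z0 by nonvanishing factors exp(-c (z - z0)^j). *)
Lemma unit_normalization (f : C -> C) (z0 : C) (j : nat) : entire f -> f z0 != 0 ->
  exists al g : C -> C, [/\ entire al, entire g, forall z, al z != 0 &
    forall z, al z * f z = 1 + (z - z0) ^+ j.+1 * g z].
Proof.
move=> ef f0; elim: j => [|j [al [g [eal eg al0 E]]]].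
  have [||g eg gE] := @entire_divide R (fun z => (f z0)^-1 * f z - 1) z0.
  - exact: (entireB (entireM (entire_cst _) ef) (entire_cst 1)).
  - by rewrite mulVf// subrr.
  exists (fun=> (f z0)^-1), g; split.
  - exact: entire_cst.
  - exact: eg.
  - by move=> z; rewrite invr_eq0.
  - by move=> z; rewrite expr1 -gE addrC subrK.
pose c := g z0.
(* [ex] is (e^{-c y} - 1) / y; its value -c at 0 is what cancels g z0 below. *)
have [||ex eex exE] := @entire_divide R (fun y => cexp (- c * y) - 1) 0.
- apply: (entireB _ (entire_cst 1)).
  exact: (entire_comp (@entire_cexp R) (is_derive_entire (is_derive_mull (- c)))).
- by rewrite mulr0 cexp0 subrr.
have ex0 : ex 0 = - c.
  have d1 := is_deriveBC (is_derive_compC (g := fun y => - c * y) (is_derive_cexp (- c * 0)) (is_derive_mull (- c) 0))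
    (is_derive_cst (1 : C) (0 : C) (1 : C)).
  have d2 := is_deriveMC (is_derive_addr 0 0) (entireP 0 eex).
  have E1 : (fun w : C => cexp (- c * w) - 1) = (fun w : C => (w + 0) * ex w).
    by apply/funext => y; rewrite exE subr0 addr0.
  have dex : is_derive (0 : C) (1 : C) (fun w : C => (w + 0) * ex w) (cexp (- c * 0) * - c - 0).
    by rewrite -E1; exact: d1.
  have := etrans (esym (derive_of d2)) (derive_of dex).
  by rewrite mulr0 cexp0 mul1r subr0 addr0 mul0r add0r mulr1.
have ep : entire (fun z => (z - z0) ^+ j.+1).
  exact: (@entireX R _ j.+1 (entireB (@entire_id R) (entire_cst z0))).
have ecx : entire (fun z => cexp (- c * (z - z0) ^+ j.+1)).
  apply: (entire_comp (@entire_cexp R) (g := fun z => - c * (z - z0) ^+ j.+1)).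
  exact: (entireM (entire_cst (- c)) ep).
(* With y = (z - z0)^(j+1), one has (1 + y g) e^{-c y} = 1 + y (ex y + g e^{-c y}). The bracket
   vanishes at z0, so one more factor z - z0 splits off. *)
have [||h eh hE] := @entire_divide R (fun z => ex ((z - z0) ^+ j.+1) + g z * cexp (- c * (z - z0) ^+ j.+1)) z0.
- exact: (entireD (entire_comp eex ep) (entireM eg ecx)).
- by rewrite subrr expr0n /= ex0 mulr0 cexp0 mulr1 addNr.
exists (fun z => al z * cexp (- c * (z - z0) ^+ j.+1)), h; split.
- exact: (entireM eal ecx).
- exact: eh.
- by move=> z; rewrite mulf_neq0// cexp_neq0.
- move=> z; rewrite mulrAC E [(z - z0) ^+ j.+2]exprSr -[_ * _ * h z]mulrA -hE.
  have := exE ((z - z0) ^+ j.+1); rewrite subr0.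
  move: (_ ^+ _) => y; move: (cexp _) => e H.
  have -> : e = 1 + y * ex y by rewrite -H addrC subrK.
  ring.
Qed.

End Models.

(** * Infinite families *)

Section Families.
Variable R : realType.
Local Notation C := (Cplx R).
Local Notation C2 := (Cplx2 R).

Lemma infinite_range (T : Type) (X : nat -> T) : injective X -> infinite_set (range X).
Proof.
move=> iX; apply/infiniteP; rewrite (card_le_eqr (inj_card_eq _)); first exact: card_lexx.
by move=> m n _ _; exact: iX.
Qed.

Lemma infinitely_many_family (P : (C2 -> C2) -> Prop) (X : nat -> C2 -> C2) :
  injective X -> (forall n, P (X n)) -> infinitely_many P.
Proof.
move=> iX PX; apply: sub_infinite_set (infinite_range iX).
by move=> _ [n _ <-]; exact: PX.
Qed.

Lemma equivalent_sym (X Y : C2 -> C2) : equivalent X Y -> equivalent Y X.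
Proof.
move=> [Phi [hPhi [Psi [hPsi K1 K2]]] H].
have bP : biholomorphism Phi Psi by split.
exists Psi; first exact: (biholomorphism_automorphism (biholomorphism_sym bP)).
exact: push_forward_inv bP H.
Qed.

Lemma dvdn_of_int (n n' : nat) (k : int) :
  n'.+1%:R = n.+1%:R * k%:~R :> C -> (n.+1 %| n'.+1)%N.
Proof.
case: k => k.
  by rewrite -[k%:~R]/(k%:R) -natrM => /eqP; rewrite eqr_nat => /eqP ->; rewrite dvdn_mulr.
rewrite NegzE mulrNz -[(k.+1)%:~R]/(k.+1%:R) mulrN -natrM => /eqP.
by rewrite -addr_eq0 -natrD pnatr_eq0.
Qed.

Section Conjugates.
Variables Phi Psi : C2 -> C2.
Hypothesis bP : biholomorphism Phi Psi.

Lemma push_forward_inj (X Y Y' : C2 -> C2) :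
  push_forward Phi X Y -> push_forward Phi X Y' -> Y = Y'.
Proof.
move=> H H'; apply/funext => q; have [_ _ _ PsiK] := bP.
by rewrite -(PsiK q) H H'.
Qed.

(* 2 pi i / n is a period of a solution of X, hence of the solution of X' it is
   mapped to, which makes it a multiple of 2 pi i / n'. *)
Lemma lin_periods (mu : C) (n n' : nat) (X X' : C2 -> C2) :
  (forall k : int, n'.+1%:R * mu = n.+1%:R * k%:~R -> (n.+1 %| n'.+1)%N) ->
  push_forward Phi X (lin n.+1%:R (n.+1%:R * mu)) ->
  push_forward Phi X' (lin n'.+1%:R (n'.+1%:R * mu)) ->
  equivalent X X' -> (n.+1 %| n'.+1)%N.
Proof.
move=> Hmu H H' [A [hA [B [hB AK BK]]] AX].
have [hPhi hPsi PhiK PsiK] := bP.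
pose nn : C := n.+1%:R; have nn0 : nn != 0 by rewrite pnatr_eq0.
pose T : C := ofR (2 * pi) * ci R.
have T0 : T != 0.
  by rewrite -cmod_gt0 cmodM cmod_ci mulr1 cmod_ofR gtr0_norm ?mulr_gt0 ?pi_gt0.
have s1 := push_forward_solution hPsi (push_forward_inv bP H) (@lin_solution R nn (nn * mu) 1 0).
have s2 := push_forward_solution hPhi H' (push_forward_solution hA AX s1).
set psi := Phi \o _ in s2.
have E0 : nn * (T / nn) = T by rewrite mulrC divfK.
have per : psi (T / nn) = psi 0.
  have E1 : cexp T = 1 by rewrite -[T]mul1r -[1 * T]/(1%:~R * T) cexp_2pi.
  by rewrite /psi /= E0 E1 !mulr0 cexp0 !mul0r.
have E t := lin_solutionE s2 t.
have [a0|a0] := eqVneq (psi 0).1 0; last first.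
  have := congr1 fst per; rewrite (E (T / nn)) /= => /(canRL (mulKf a0)).
  rewrite mulVf// => /cexp_eq1[k kE]; apply: (@dvdn_of_int _ _ k).
  have kT : n'.+1%:R * (T / nn) = k%:~R * T := kE.
  by apply: (mulIf T0); rewrite -mulrA -kT [RHS]mulrCA E0.
(* The automorphism may send the solution into {z = 0}. Its periods are then governed by the second
   eigenvalue n' mu, the case that [Hmu] covers. *)
have [b0|b0] := eqVneq (psi 0).2 0; last first.
  have := congr1 snd per; rewrite (E (T / nn)) /= => /(canRL (mulKf b0)).
  rewrite mulVf// => /cexp_eq1[k kE]; apply: (Hmu k).
  have kT : n'.+1%:R * mu * (T / nn) = k%:~R * T := kE.
  by apply: (mulIf T0); rewrite -[RHS]mulrA -kT [RHS]mulrCA E0.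
(* With both coordinates zero the image would rest at the origin, although a composite of bijections
   is applied to a moving solution. *)
have [t tn] := cexp_nontriv nn0; exfalso.
have inj : injective (Phi \o (A \o Psi)).
  move=> p q /= /(can_inj PhiK)/(can_inj AK)/(can_inj PsiK); exact.
have : psi t = psi 0.
  by rewrite (E t) [RHS]surjective_pairing a0 b0 !mul0r.
move/inj/(congr1 fst) => /= E1; move: tn.
by rewrite -(mul1r (cexp (nn * t))) E1 (mulr0 nn) cexp0 mul1r eqxx.
Qed.

End Conjugates.

End Families.

(** * Finite values of a meromorphic function *)

Section FinitePart.
Variable R : realType.
Local Notation C := (Cplx R).
Local Notation C2 := (Cplx2 R).
Variable s : C -> one_point_compactification C.
Hypothesis s_mero : meromorphic s.

(** The 0 at a pole is a placeholder; [pole_numerator] puts the correct value there after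
    multiplying by (z - z0)^k. *)
Definition finite_part (z : C) : C := odflt 0 (s z).

Lemma near_derivable (f g : C -> C) (a : C) :
  (\forall z \near a, f z = g z) -> derivable f a (1 : C) -> derivable g a (1 : C).
Proof. by move=> fg df; exact: near_eq_derivable fg df. Qed.

Lemma finite_part_derivable a : s a <> None -> derivable finite_part a (1 : C).
Proof.
move=> sa; have [[g H]|[k [_ //]]] := s_mero a.
have Dg : derivable g a (1 : C) := (derivable1_diffP g a).2 (nbhs_singleton H).1.
apply: near_derivable Dg.
move/nbhsCP : H => [r r0 H]; apply/nbhsCP; exists r => // z /H[_ sz].
by rewrite /finite_part sz.
Qed.

Lemma finite_partE z : s z <> None -> s z = Some (finite_part z).
Proof. by rewrite /finite_part; case: (s z). Qed.

End FinitePart.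

(** * Trajectories of the models and inequivalent families *)

Section Assembly.
Variable R : realType.
Local Notation C := (Cplx R).
Local Notation C2 := (Cplx2 R).

Lemma ofR_tau_irrational (k k' : int) : k%:~R * ofR (tau R) = k'%:~R :> C -> k = 0.
Proof.
move=> E; apply: (@tau_irrational R k k'); apply: ofR_inj.
by rewrite [LHS]ofRM !ofR_int.
Qed.

Lemma ofR_tau_neq0 : ofR (tau R) != 0 :> C.
Proof. by have /andP[t0 _] := tau_bounds R; rewrite -cmod_gt0 cmod_ofR gtr0_norm. Qed.

(** A nonzero common period of the two coordinates would make a nonzero integer multiple of tau an
    integer. *)
Lemma leaf_tau_C (l a b : C) : l != 0 -> a != 0 -> b != 0 ->
  of_type_C (lin l (l * ofR (tau R))) (leaf l (l * ofR (tau R)) a b).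
Proof.
move=> l0 a0 b0; apply: leaf_C => // t /cexp_eq1[k kE] /cexp_eq1[k' kE'].
set T := ofR (2 * pi) * ci R in kE kE'.
have T0 : T != 0.
  by rewrite -cmod_gt0 cmodM cmod_ci mulr1 cmod_ofR gtr0_norm ?mulr_gt0 ?pi_gt0.
have k0 : k = 0.
  apply: (@ofR_tau_irrational k k'); apply: (mulIf T0).
  by rewrite -kE' mulrAC -kE mulrAC.
move/eqP: kE; rewrite k0 mul0r mulf_eq0 (negbTE l0) => /eqP; exact.
Qed.

(** Every leaf is a punctured line through the origin, parametrized by a coordinate that is nonzero
    on it. *)
Lemma lin_scalar_type_Cstar (l : C) T : l != 0 ->
  trajectory (lin l l) T -> of_type_Cstar (lin l l) T.
Proof.
move=> l0 /lin_trajectory[a [b [ab ->]]].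
have [a0|a0] := eqVneq a 0; last by apply: leaf_Cstar_fst => // t ->; rewrite mulr1.
apply: leaf_Cstar_snd => //; first by move: ab; rewrite a0 eqxx.
by move=> t ->; rewrite mulr1.
Qed.

Lemma leaf_through (l m : C) (z : C2) T : trajectory (lin l m) T -> T z ->
  z.1 * z.2 != 0 -> exists a b, [/\ a != 0, b != 0 & T = leaf l m a b].
Proof.
move=> /lin_trajectory[a [b [_ ->]]] [t _ <-] /=.
rewrite mulf_eq0 negb_or => /andP[h1 h2]; exists a, b; split=> //.
  by apply: contraNneq h1 => ->; rewrite mul0r.
by apply: contraNneq h2 => ->; rewrite mul0r.
Qed.

Lemma leaf_axis (l m : C) : l != 0 ->
  leaf l m 1 0 = [set q : C2 | q.2 = 0] `\ (0, 0).
Proof.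
move=> l0; apply/seteqP; split=> [_ [t _ <-]|[x y] [/= -> xy]].
  split=> /=; first by rewrite mul0r.
  by move/(congr1 fst) => /eqP; rewrite [_ == _](negbTE _)//= mul1r cexp_neq0.
have x0 : x != 0 by apply/eqP => x0; apply: xy; rewrite x0.
have [t <-] := cexp_onto (oner_neq0 C) l0 x0; exists t => //.
by rewrite mul0r.
Qed.

Lemma axis_tangent (Y : C2 -> C2) : (forall q, q.2 = 0 -> (Y q).2 = 0) ->
  tangent Y [set q : C2 | q.2 = 0].
Proof.
move=> H; apply: (level_set_tangent (@differentiable_snd R)).
  by move=> q _; exists (0, 1); rewrite diff_snd oner_neq0.
by move=> q q0; rewrite diff_snd; exact: H.
Qed.

Lemma complete_holomorphic_pull (c : C) (al be : C -> C) (Y : C2 -> C2) :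
  entire al -> entire be -> (forall z, al z != 0) ->
  holomorphic Y -> complete_field Y -> complete_holomorphic (pull c al be Y).
Proof.
move=> eal ebe al0 hY cY; split; first exact: holo_pull.
exact: (complete_preimage (straight_biholo c eal ebe al0) (push_forward_pull c eal ebe al0 Y)).
Qed.

(** Equivalence is symmetric, so comparing periods gives divisibility in both directions and forces
    equal indices. *)
Lemma inequivalent_family (Phi Psi : C2 -> C2) (mu : C) (X : nat -> C2 -> C2)
    (P : (C2 -> C2) -> Prop) : biholomorphism Phi Psi ->
  (forall n n' (k : int), n'.+1%:R * mu = n.+1%:R * k%:~R -> (n.+1 %| n'.+1)%N) ->
  (forall n, push_forward Phi (X n) (lin n.+1%:R (n.+1%:R * mu))) ->
  (forall n, P (X n)) -> infinitely_many_inequivalent P.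
Proof.
move=> bP Hmu HX PX; exists (range X).
have eqn n n' : equivalent (X n) (X n') -> n = n'.
  move=> E; have d1 := lin_periods bP (Hmu n n') (HX n) (HX n') E.
  have d2 := lin_periods bP (Hmu n' n) (HX n') (HX n) (equivalent_sym E).
  by apply/eqP; rewrite -eqSS eqn_dvd d1 d2.
split.
- apply: infinite_range => n n' E.
  have := push_forward_inj bP (HX n); rewrite E => /(_ _ (HX n')) H.
  have := congr1 (fun Y : C2 -> C2 => (Y (1, 1)).1) H; rewrite /= !mulr1 => /eqP.
  by rewrite eqr_nat eqSS => /eqP.
- by move=> _ [n _ <-]; exact: PX.
- by move=> _ _ [n _ <-] [n' _ <-] nn' /eqn nE; apply: nn'; rewrite nE.
Qed.

(** * The case of an entire function *)

Section NoPole.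
Variable s : C -> one_point_compactification C.
Hypothesis s_mero : meromorphic s.
Hypothesis s_finite : forall z, s z <> None.

Let S := finite_part s.
Let be z := - S z.

Lemma finite_part_entire : entire S.
Proof. by move=> z; exact: finite_part_derivable. Qed.

Lemma entire_minus_finite_part : entire be.
Proof.
rewrite (_ : be = fun z => 0 - S z); last by apply/funext => z; rewrite sub0r.
exact: (entireB (entire_cst 0) finite_part_entire).
Qed.

Let ebe := entire_minus_finite_part.
Let e1 : entire (fun _ : C => 1 : C) := entire_cst 1.
Let one0 (z : C) : (fun _ : C => 1 : C) z != 0 := oner_neq0 C.
Let Phi c := straight c (fun=> 1) be.
Let Psi c := unstraight c (fun=> 1) be.
Let bP c : biholomorphism (Phi c) (Psi c) := straight_biholo c e1 ebe one0.
Let X c Y := pull c (fun=> 1) be Y.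
Let pX c Y : push_forward (Phi c) (X c Y) Y := push_forward_pull c e1 ebe one0 Y.

(** The horizontal shift c is free: 0 serves for the constant fields, and the abscissa of p brings p
    to the origin for the diagonal ones. *)
Lemma graph_straight c : graph s = Phi c @^-1` [set q : C2 | q.2 = 0].
Proof.
apply/seteqP; split=> -[x y]; rewrite /graph /Phi /straight /be /=.
  by rewrite (finite_partE (@s_finite x)) => -[<-]; rewrite mul1r subrr.
by rewrite mul1r => /eqP; rewrite subr_eq0 => /eqP ->; exact: finite_partE.
Qed.

Lemma no_pole_horizontal : infinitely_many (fun X : C2 -> C2 =>
  [/\ complete_holomorphic X, tangent X (graph s),
      forall q, graph s q -> X q <> 0 &
      forall T, trajectory X T -> proper_trajectory T /\ of_type_C X T] /\
  trajectory X (graph s) /\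
  exists Phi Y,
    [/\ automorphism Phi, fiber_preserving Phi,
        exists2 L, complex_line L & Phi @` graph s `<=` L,
        push_forward Phi X Y & polynomial_field Y]).
Proof.
pose Y n : C2 -> C2 := horizontal n.+1%:R.
apply: (infinitely_many_family (X := fun n => X 0 (Y n))) => [n n' E|n].
  have := push_forward_inj (bP 0) (pX 0 (Y n)).
  rewrite -/(X 0 (Y n)) E => /(_ _ (pX 0 (Y n'))) H.
  have := congr1 (fun Y : C2 -> C2 => (Y (1, 1)).1) H => /eqP.
  by rewrite /= eqr_nat eqSS => /eqP.
have n0 : n.+1%:R != 0 :> C by rewrite pnatr_eq0.
have hY : holomorphic (Y n) := holo_pair (holo_cst _) (holo_cst _).
split; [split|split].
- exact: (complete_holomorphic_pull 0 e1 ebe one0 hY (@horizontal_complete R _)).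
- rewrite (graph_straight 0); apply: (tangent_preimage (bP 0) (pX 0 (Y n))).
  exact: axis_tangent.
- move=> q _ /(zero_push_forward q (bP 0) (pX 0 (Y n))).1 [/eqP].
  by rewrite (negbTE n0).
- move=> T tT; have [hPhi _ PhiK _] := bP 0.
  have := trajectory_image hPhi (can_inj PhiK) (pX 0 (Y n)) tT.
  move=> /(horizontal_trajectory _ n0)[b bE]; split.
    by apply: (proper_trajectory_preimage (bP 0)); rewrite bE; exact: line_proper.
  apply: (trajectory_iso_preimage (bP 0) (pX 0 (Y n))); rewrite bE.
  exact: horizontal_type_C.
- rewrite (graph_straight 0); apply: (trajectory_preimage (bP 0) (pX 0 (Y n))).
  apply/(horizontal_trajectory _ n0); exists 0.
  by apply/seteqP; split=> q /=; rewrite subr0.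
- exists (Phi 0), (Y n); split.
  + exact: biholomorphism_automorphism (bP 0).
  + exact: straight_fiber e1 ebe one0.
  + exists [set q : C2 | 0 * q.1 + 1 * q.2 = 0].
      by exists 0, 1, 0; rewrite oner_neq0 orbT.
    rewrite (graph_straight 0) => _ [q /= q0 <-].
    by rewrite mul0r add0r mul1r.
  + exact: pX.
  + exact: horizontal_polynomial.
Qed.

Section AtPoint.
Variable p : C2.
Hypothesis Cp : graph s p.

Let good (X : C2 -> C2) :=
  [/\ complete_holomorphic X, tangent X (graph s),
      forall q, graph s q -> (X q = 0 <-> q = p),
      trajectory X (graph s `\ p) &
      of_type_Cstar X (graph s `\ p)].

Let c := p.1.

Lemma straight_base : Phi c p = (0, 0).
Proof.
move: Cp; rewrite (graph_straight c) => p2.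
by rewrite [LHS]surjective_pairing; congr (_, _); [exact: subrr|exact: p2].
Qed.

Lemma punctured_graph : graph s `\ p = Phi c @^-1` ([set q : C2 | q.2 = 0] `\ (0, 0)).
Proof.
rewrite (graph_straight c); have [_ _ PhiK _] := bP c.
apply/seteqP; split=> q [/= q0 qp]; split=> //.
  by move=> E; apply: qp; apply: (can_inj PhiK); rewrite E straight_base.
by move=> E; apply: qp; rewrite E straight_base.
Qed.

Lemma lin_good (l m : C) : l != 0 -> m != 0 -> good (X c (lin l m)).
Proof.
move=> l0 m0; split.
- exact: (complete_holomorphic_pull c e1 ebe one0 (holo_lin l m) (lin_complete l m)).
- rewrite (graph_straight c); apply: (tangent_preimage (bP c) (pX c (lin l m))).
  by apply: axis_tangent => q q0; rewrite /lin /= q0 mulr0.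
- move=> q _; apply: iff_trans (zero_push_forward q (bP c) (pX c (lin l m))) _.
  have [_ _ PhiK _] := bP c; split=> [|->].
    move=> [/eqP + /eqP]; rewrite !mulf_eq0 (negbTE l0) (negbTE m0) /= => /eqP E1 /eqP E2.
    apply: (can_inj PhiK); rewrite straight_base -/(Phi c q).
    by rewrite [LHS]surjective_pairing; congr (_, _); [exact: E1|exact: E2].
  by rewrite straight_base /lin /= !mulr0.
- rewrite punctured_graph -(leaf_axis m l0).
  apply: (trajectory_preimage (bP c) (pX c (lin l m))).
  by apply: leaf_trajectory => //; rewrite oner_neq0.
- apply: (trajectory_iso_preimage (bP c) (pX c (lin l m))).
  rewrite punctured_graph -(leaf_axis m l0) (image_preimage_biholo _ (bP c)) (preimageK _ (bP c)).
  by apply: (leaf_Cstar_fst l0 (oner_neq0 C)) => t _; rewrite mul0r.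
Qed.

Lemma no_pole_type_C : infinitely_many_inequivalent (fun X =>
  [/\ good X, field_of_type_C X &
      almost_all_trajectories X (fun T => ~ proper_trajectory T)]).
Proof.
have t0 := ofR_tau_neq0.
apply: (inequivalent_family (X := fun n => X c (lin n.+1%:R (n.+1%:R * ofR (tau R)))) (bP c)).
(* Irrationality of tau forbids n' tau = n k, so no image solution can have its periods determined
   by the second coordinate. *)
- move=> n n' k E; exfalso.
  have := @ofR_tau_irrational (Posz n'.+1) (Posz n.+1 * k).
  by rewrite intrM => /(_ E).
- by move=> n; exact: pX.
move=> n; have n0 : n.+1%:R != 0 :> C by rewrite pnatr_eq0.
have hf : holomorphic (fun q : C2 => q.1 * q.2) := holoM (@differentiable_fst R) (@holo_snd R).
have f0 : exists a : C2, a.1 * a.2 != 0 by exists (1, 1); rewrite /= mulr1 oner_neq0.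
split.
- by apply: lin_good => //; rewrite mulf_neq0.
- apply: (almost_all_preimage (bP c) (pX c _) hf f0 (@lin_flow_invariant R _ _)
    (Q := of_type_C (lin n.+1%:R (n.+1%:R * ofR (tau R))))).
    by move=> T _; exact: (trajectory_iso_preimage (bP c) (pX c _)).
  move=> z T z0 tT Tz; have [a [b [a0 b0 ->]]] := leaf_through tT Tz z0.
  exact: leaf_tau_C.
- apply: (almost_all_preimage (bP c) (pX c _) hf f0 (@lin_flow_invariant R _ _)
    (Q := fun T => ~ proper_trajectory T)).
    by move=> T _ H /(proper_trajectory_image (bP c)).
  move=> z T z0 tT Tz; have [a [b [a0 b0 ->]]] := leaf_through tT Tz z0.
  exact: leaf_not_proper.
Qed.

Lemma no_pole_type_Cstar : infinitely_many_inequivalent (fun X =>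
  good X /\ field_of_type_Cstar X).
Proof.
apply: (inequivalent_family (mu := 1) (X := fun n => X c (lin n.+1%:R (n.+1%:R * 1))) (bP c)).
- by move=> n n' k; rewrite mulr1; exact: dvdn_of_int.
- by move=> n; exact: pX.
move=> n; have n0 : n.+1%:R != 0 :> C by rewrite pnatr_eq0.
rewrite mulr1; split; first exact: lin_good.
(* All trajectories of the scalar model are of the required type, so the exceptional set is empty:
   the zero set of the constant 1. *)
apply: (almost_all_preimage (bP c) (pX c _) (holo_cst 1) _ _
    (Q := of_type_Cstar (lin n.+1%:R n.+1%:R))).
- by exists 0; exact: oner_neq0.
- by move=> phi _ /= /eqP; rewrite oner_eq0.
- by move=> T _; exact: (trajectory_iso_preimage (bP c) (pX c _)).
- by move=> z T _ tT _; exact: lin_scalar_type_Cstar.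
Qed.

Lemma no_pole_good : infinitely_many_inequivalent good.
Proof.
have [F [iF FP FE]] := no_pole_type_C; exists F; split=> // Y /FP[]//.
Qed.

End AtPoint.

End NoPole.

(** * The case of one pole *)

Section OnePole.
Variable s : C -> one_point_compactification C.
Hypothesis s_mero : meromorphic s.
Hypothesis s_pole : at_most_one_pole s.
Variables (z0 : C) (k : nat).
Hypothesis pole : pole_of_order s z0 k.

(** Away from z0 the function s is finite, hence differentiable; at z0 the product s (z - z0)^k is
    continued by the local numerator g. *)
Lemma pole_numerator : exists f : C -> C, [/\ entire f, f z0 != 0 &
  forall z, z != z0 -> s z = Some (f z / (z - z0) ^+ k)].
Proof.
have [k0 sz0 [g [g0 /nbhs_singleton Dg /nbhsCP[r r0 H]]]] := pole.
have sfin z : z != z0 -> s z <> None.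
  by move=> /eqP zz0 sz; apply: zz0; exact: s_pole.
pose f z := if z == z0 then g z0 else finite_part s z * (z - z0) ^+ k.
have fE z : z != z0 -> f z = finite_part s z * (z - z0) ^+ k by rewrite /f => /negbTE ->.
have e1 : entire (fun z => (z - z0) ^+ k).
  exact: (@entireX R _ k (entireB (@entire_id R) (entire_cst z0))).
exists f; split.
- move=> z; have [->|zz0] := eqVneq z z0.
    apply: (near_derivable (f := g)); last exact: (derivable1_diffP g z0).2 Dg.
    apply/nbhsCP; exists r => // w wr; have [->|ww0] := eqVneq w z0; first by rewrite /f eqxx.
    have := H w wr ww0; rewrite (finite_partE (sfin w ww0)) (fE w ww0) => -[->].
    by rewrite divfK// expf_neq0// subr_eq0.
  apply: (near_derivable (f := fun z => finite_part s z * (z - z0) ^+ k)).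
    apply/nbhsCP; exists (cmod (z - z0)); first by rewrite cmod_gt0 subr_eq0.
    move=> w wz; rewrite fE//; apply: contraTneq wz => ->.
    by rewrite cmodC ltxx.
  exact: (derivableM (finite_part_derivable s_mero (sfin z zz0)) (e1 z)).
- by rewrite /f eqxx.
- move=> z zz0; rewrite (finite_partE (sfin z zz0)) (fE z zz0) mulfK// expf_neq0// subr_eq0//.
Qed.

Lemma one_pole : infinitely_many (fun X : C2 -> C2 =>
  [/\ complete_holomorphic X, tangent X (graph s),
      forall q, graph s q -> X q <> 0 &
      forall T, trajectory X T -> proper_trajectory T /\ of_type_Cstar X T] /\
  trajectory X (graph s) /\
  exists Phi Y,
    [/\ automorphism Phi, fiber_preserving Phi,
        Phi @` graph s `<=` [set q : C2 | q.2 * q.1 ^+ k - 1 = 0],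
        push_forward Phi X Y & polynomial_field Y]).
Proof.
have [k0 sz0 _] := pole; have [f [ef f0 fE]] := pole_numerator.
have [al [g [eal eg al0 ag]]] := unit_normalization k.-1 ef f0.
rewrite prednK// in ag.
(* On the graph w = f / (z - z0)^k, and al f = 1 + (z - z0)^k g, so (al w - g) (z - z0)^k = 1: this
   choice of [be] straightens the curve onto w z^k = 1. *)
pose be z := - g z.
have ebe : entire be.
  rewrite (_ : be = fun z => 0 - g z); last by apply/funext => z; rewrite sub0r.
  exact: (entireB (entire_cst 0) eg).
pose Phi := straight z0 al be.
have bP : biholomorphism Phi (unstraight z0 al be) := straight_biholo z0 eal ebe al0.
have graphE : graph s = Phi @^-1` [set q | hyp k 1 q = 0].
  apply/seteqP; split=> -[x y]; rewrite /graph /hyp /Phi /straight /be /=.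
    have [->|xz0] := eqVneq x z0; first by rewrite sz0.
    have p0 : (x - z0) ^+ k != 0 by rewrite expf_neq0// subr_eq0.
    rewrite (fE x xz0) => -[<-]; have := ag x.
    move: ((x - z0) ^+ k) p0 => P p0 E.
    rewrite mulrBl (_ : al x * (f x / P) * P = al x * f x); last by field.
    by rewrite E; ring.
  have [->|xz0] := eqVneq x z0.
    by rewrite subrr expr0n gtn_eqF// mulr0 sub0r => /eqP; rewrite oppr_eq0 oner_eq0.
  have p0 : (x - z0) ^+ k != 0 by rewrite expf_neq0// subr_eq0.
  rewrite (fE x xz0) => E; congr Some; apply: (mulIf p0); apply: (mulfI (al0 x)).
  rewrite divfK// ag; move: ((x - z0) ^+ k) E => P E.
  by apply/eqP; rewrite -subr_eq0 -oppr_eq0 -E; apply/eqP; ring.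
pose Y n : C2 -> C2 := lin n.+1%:R (- (k%:R * n.+1%:R)).
pose X n := pull z0 al be (Y n).
have pX n : push_forward Phi (X n) (Y n) := push_forward_pull z0 eal ebe al0 (Y n).
apply: (infinitely_many_family (X := X)) => [n n' E|n].
  have := push_forward_inj bP (pX n); rewrite E => /(_ _ (pX n')) H.
  have := congr1 (fun Y : C2 -> C2 => (Y (1, 1)).1) H; rewrite /= !mulr1 => /eqP.
  by rewrite eqr_nat eqSS => /eqP.
have n0 : n.+1%:R != 0 :> C by rewrite pnatr_eq0.
have m0 : - (k%:R * n.+1%:R) != 0 :> C.
  by rewrite oppr_eq0 mulf_neq0// pnatr_eq0 -lt0n.
split; [split|split].
- exact: (complete_holomorphic_pull z0 eal ebe al0 (holo_lin _ _) (lin_complete _ _)).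
- rewrite graphE; apply: (tangent_preimage bP (pX n)).
  apply: tangent_invariant.
  + exact: holo_hyp.
  + by move=> q; apply: hyp_nonsingular; exact: oner_neq0.
  + exact: lin_complete.
  + exact: hyp_flow_invariant.
(* A zero of the model lies on {z = 0}, which the curve w z^k = 1 misses because k > 0. *)
- move=> q Cq /(zero_push_forward q bP (pX n)).1 [/eqP].
  rewrite mulf_eq0 (negbTE n0) => /eqP E _.
  have E0 : (Phi q).1 = 0 := E.
  have : hyp k 1 (Phi q) = 0 by move: Cq; rewrite graphE.
  rewrite /hyp E0 expr0n gtn_eqF// mulr0 sub0r => /eqP.
  by rewrite oppr_eq0 oner_eq0.
- move=> T tT; have [hPhi _ PhiK _] := bP.
  have /lin_trajectory[a [b [ab E]]] := trajectory_image hPhi (can_inj PhiK) (pX n) tT.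
  split; first by apply: (proper_trajectory_preimage bP); rewrite E; exact: leaf_hyp_proper.
  by apply: (trajectory_iso_preimage bP (pX n)); rewrite E; exact: leaf_hyp_Cstar.
- rewrite graphE; apply: (trajectory_preimage bP (pX n)).
  have := leaf_hyp n0 (oner_neq0 C) (oner_neq0 C) k0.
  rewrite expr1n mulr1 => <-; apply: leaf_trajectory => //.
  by rewrite oner_neq0.
- exists Phi, (Y n); split.
  + exact: biholomorphism_automorphism bP.
  + exact: straight_fiber eal ebe al0.
  + by rewrite graphE => _ [q /= qE <-].
  + exact: pX.
  + exact: lin_polynomial.
Qed.

End OnePole.

End Assembly.

Theorem theorem4 (R : realType)
    (s : Cplx R -> one_point_compactification (Cplx R))
    (s_mero : meromorphic s) (s_pole : at_most_one_pole s) :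
  let C := graph s in
  ((forall z, s z <> None) ->
    infinitely_many (fun X : Cplx2 R -> Cplx2 R =>
      [/\ complete_holomorphic X,
          tangent X C,
          forall q, C q -> X q <> 0 &
          forall T, trajectory X T -> proper_trajectory T /\ of_type_C X T] /\
      trajectory X C /\
      exists Phi Y,
        [/\ automorphism Phi, fiber_preserving Phi,
            exists2 L, complex_line L & Phi @` C `<=` L,
            push_forward Phi X Y & polynomial_field Y])
    /\
    forall p, C p ->
      let good (X : Cplx2 R -> Cplx2 R) :=
        [/\ complete_holomorphic X,
            tangent X C,
            forall q, C q -> (X q = 0 <-> q = p),
            trajectory X (C `\ p) &
            of_type_Cstar X (C `\ p)] in
      [/\ infinitely_many_inequivalent good,
          infinitely_many_inequivalent (fun X =>
            [/\ good X, field_of_type_C X &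
                almost_all_trajectories X (fun T => ~ proper_trajectory T)]) &
          infinitely_many_inequivalent (fun X =>
            good X /\ field_of_type_Cstar X)])
  /\
  (forall z0 k, pole_of_order s z0 k ->
    infinitely_many (fun X : Cplx2 R -> Cplx2 R =>
      [/\ complete_holomorphic X,
          tangent X C,
          forall q, C q -> X q <> 0 &
          forall T, trajectory X T -> proper_trajectory T /\ of_type_Cstar X T] /\
      trajectory X C /\
      exists Phi Y,
        [/\ automorphism Phi, fiber_preserving Phi,
            Phi @` C `<=` [set q : Cplx2 R | q.2 * q.1 ^+ k - 1 = 0],
            push_forward Phi X Y & polynomial_field Y])).
Proof.
move=> C; split=> [s_finite | z0 k pole]; last exact: (one_pole s_mero s_pole pole).
split=> [|p Cp good]; first exact: (no_pole_horizontal s_mero s_finite).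
split.
- exact: (no_pole_good s_mero s_finite Cp).
- exact: (no_pole_type_C s_mero s_finite Cp).
- exact: (no_pole_type_Cstar s_mero s_finite Cp).
Qed.
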